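(* Let $k\geq 3$ be an odd integer. Let $\mu=\sum_{\lambda\in\Lambda}a(\lambda)\delta_\lambda$ be a measure on $\mathbb{R}^k$ whose support $\Lambda$ is a locally finite set. Suppose that $\mu$ is a temperate distribution, and that its Fourier transform $\widehat{\mu}=\sum_{s\in S}b(s)\delta_s$ is also a measure, supported on a locally finite set $S\subset\mathbb{R}^k$. (The sets $\Lambda$ and $S$ may contain the origin; if $0\notin\Lambda$ put $a(0)=0$, and if $0\notin S$ put $b(0)=0$.) Then $$\sigma=-2a(0)\,\delta'_0+\sum_{\lambda\in\Lambda\setminus\{0\}}\frac{a(\lambda)}{|\lambda|}\big(\delta_{|\lambda|}-\delta_{-|\lambda|}\big)$$ is a temperate distribution on $\mathbb{R}$ whose one-dimensional Fourier transform is $$\widehat{\sigma}=2i\,b(0)\,\alpha_k\,\delta_0^{(k-2)}-i\sum_{s\in S\setminus\{0\}}\frac{b(s)}{|s|^{k-2}}\Big[\sum_{j=0}^{(k-3)/2}\beta_{j,k}\,|s|^j\Big((-1)^j\,\delta^{(j)}_{|s|}-\delta^{(j)}_{-|s|}\Big)\Big],$$ where $$\alpha_k=\frac{(-1)^{(k-3)/2}}{(k-2)!!}\Big(\frac{1}{2\pi}\Big)^{(k-3)/2},\qquad \beta_{j,k}=\frac{(-1)^j\,(k-j-3)!}{j!\,(k-2j-3)!!}\Big(\frac{1}{2\pi}\Big)^{(k-3)/2}\quad (0\leq j\leq (k-3)/2).$$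
   Context: A set is locally finite if it has no finite accumulation points. The coefficients $a(\lambda),b(s)$ are complex, $|\cdot|$ is the Euclidean norm, and $\delta_x$ is the unit mass at $x$; $\delta_x^{(j)}$ is its $j$-th distributional derivative, $\langle\delta_x^{(j)},\varphi\rangle=(-1)^j\varphi^{(j)}(x)$. A temperate distribution is a distribution (continuous linear functional on the space of infinitely smooth compactly supported functions) that extends to a continuous linear functional on the Schwartz space. Infinite sums of distributions supported on a locally finite set are understood via their action on compactly supported smooth test functions. The Fourier transform of a Schwartz function on $\mathbb{R}^k$ is $\widehat{\varphi}(\xi)=\int_{\mathbb{R}^k}\varphi(x)e^{-2\pi i\langle\xi,x\rangle}\,dx$, and that of a temperate distribution is defined by $\langle\widehat{\sigma},\varphi\rangle=\langle\sigma,\widehat{\varphi}\rangle$ (bilinear pairing, no conjugation). The double factorial is $n!!=n(n-2)(n-4)\cdots$ (ending in $1$ or $2$), with $0!!=1$. *)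

(* Defs.v *)
From HB Require Import structures.
From mathcomp Require Import all_boot all_order all_algebra.
From mathcomp Require Export complex.
From mathcomp Require Import all_classical all_reals all_analysis.

Set Implicit Arguments.
Unset Strict Implicit.
Unset Printing Implicit Defensive.

Import Order.TTheory GRing.Theory Num.Theory.
Import numFieldNormedType.Exports.

Local Open Scope classical_set_scope.
Local Open Scope complex_scope.
Local Open Scope ring_scope.

Definition locally_finite {T : topologicalType} (A : set T) : Prop :=
  forall x : T, ~ limit_point A x.

(* The normed modules over R carry no complex structure, so a complex-valued
   function is differentiated through its real and imaginary parts. *)
Section TestFunctions.
Context {R : realType} {V : normedModType R}.
Implicit Types (f g : V -> R[i]) (s : seq V) (K : set V).

Definition iter_derive s (h : V -> R) : V -> R :=
  foldr (fun (v : V) (h' : V -> R) => 'D_v h') h s.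

Definition iter_deriveC s f (x : V) : R[i] :=
  iter_derive s (fun y => complex.Re (f y)) x +i*
  iter_derive s (fun y => complex.Im (f y)) x.

Definition smooth f : Prop := forall s (x : V),
  differentiable (iter_derive s (fun y => complex.Re (f y))) x /\
  differentiable (iter_derive s (fun y => complex.Im (f y))) x.

Definition supp f : set V := closure [set x | f x != 0].

Definition test_function f : Prop := smooth f /\ compact (supp f).

(* The seminorm of f with index w = (s, m), namely
   sup_x |x|^m |D_s f(x)|, is at most c.  Here |x| is the norm of V, on row
   vectors the sup norm; an equivalent norm yields the same topology. *)
Definition seminorm_le (w : seq V * nat) f (c : R) : Prop :=
  forall x : V, `|x| ^+ w.2 * Normc.normc (iter_deriveC w.1 f x) <= c.

Definition schwartz f : Prop :=
  smooth f /\ forall w, exists c : R, seminorm_le w f c.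

Definition linear_on (P : set (V -> R[i])) (T : (V -> R[i]) -> R[i]) : Prop :=
  forall (c : R[i]) f g, P f -> P g ->
    T (fun x => c * f x + g x) = c * T f + T g.

(* Continuity of T on P for the topology generated by the seminorms: a basic
   neighbourhood of f is given by finitely many indices W and a radius d. *)
Definition continuous_on (P : set (V -> R[i])) (T : (V -> R[i]) -> R[i]) :
    Prop :=
  forall f, P f -> forall e : R, 0 < e ->
  exists (W : seq (seq V * nat)) (d : R), 0 < d /\
    forall g, P g ->
      (forall w, w \in W -> seminorm_le w (fun x => g x - f x) d) ->
      Normc.normc (T g - T f) <= e.

(* A linear functional on test functions is continuous iff it is so on the
   test functions supported in K, for each compact K; there the weights |x|^m
   are bounded and do not change the topology of uniform convergence of all
   derivatives. *)
Definition distribution (D : (V -> R[i]) -> R[i]) : Prop :=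
  linear_on test_function D /\
  forall K, compact K ->
    continuous_on [set f | test_function f /\ supp f `<=` K] D.

Definition schwartz_functional (T : (V -> R[i]) -> R[i]) : Prop :=
  linear_on schwartz T /\ continuous_on schwartz T.

Definition extends (T D : (V -> R[i]) -> R[i]) : Prop :=
  forall f, test_function f -> T f = D f.

Definition temperate (D : (V -> R[i]) -> R[i]) : Prop :=
  distribution D /\ exists T, schwartz_functional T /\ extends T D.

(* With F the Fourier transform of functions on V: the Fourier transform of
   the temperate distribution D is E.  The extension T of D is unique, as test
   functions are dense in the Schwartz space. *)
Definition fourier_transform_is (F : (V -> R[i]) -> V -> R[i])
    (D E : (V -> R[i]) -> R[i]) : Prop :=
  exists T, [/\ schwartz_functional T, extends T D &
    extends (fun f => T (F f)) E].

(* The measure \sum_(x in A) c(x) delta_x.  For A locally finite and f a test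
   function only finitely many terms are nonzero, and the big operator over
   sets computes such finitely supported sums. *)
Definition dirac_sum (A : set V) (c : V -> R[i]) (f : V -> R[i]) : R[i] :=
  \sum_(x \in A) c x * f x.

End TestFunctions.

Section LebesgueMeasure.
Context {R : realType}.
Local Notation TR := (measurableTypeR R).
Local Open Scope ereal_scope.

Fixpoint lebesgue_measureR n : set (n.-tuple TR) -> \bar R :=
  match n with
  | 0 => \d_([tuple] : 0.-tuple TR)
  | n'.+1 => pushforward (lebesgue_measure \x @lebesgue_measureR n')
               (fun p : TR * n'.-tuple TR => [tuple of p.1 :: p.2])
  end.

Let measurable_cons_tuple n : measurable_fun [set: TR * n.-tuple TR]
  (fun p : TR * n.-tuple TR => [tuple of p.1 :: p.2]).
Proof. exact: measurable_cons. Qed.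

Lemma lebesgue_measureR_ex n :
  exists m : {sigma_finite_measure set (n.-tuple TR) -> \bar R},
    (m : set _ -> _) = @lebesgue_measureR n.
Proof.
elim: n => [|n [m mE]] /=.
  by exists (\d_([tuple] : 0.-tuple TR)).
rewrite -mE.
set f := fun p : TR * n.-tuple TR => _.
pose l : {sigma_finite_measure set TR -> \bar R} := lebesgue_measure.
pose mu : {measure set (TR * n.-tuple TR)%type -> \bar R} := l \x m.
have mf : measurable_fun setT f by exact: measurable_cons_tuple.
pose g (t : n.+1.-tuple TR) : TR * n.-tuple TR :=
  (thead t, [tuple of behead t]).
have mg : measurable_fun setT g.
  apply/measurable_fun_pairP; split.
    exact: measurable_tnth.
  exact: measurable_behead.
have fK : cancel f g.
  by move=> [x t]; rewrite /g /f /= theadE; congr (_, _); apply: val_inj.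
pose nu : {measure set (n.+1.-tuple TR) -> \bar R} :=
  measure_function_pushforward__canonical__measure_function_Measure mu mf.
have sf : sigma_finite setT nu.
  have /sigma_finiteP[F [TF ndF Foo]] := sigma_finiteT l.
  have /sigma_finiteP[G [TG ndG Goo]] := sigma_finiteT m.
  exists (fun i => g @^-1` (F i `*` G i)).
    rewrite -preimage_bigcup (_ : \bigcup_i _ = setT) ?preimage_setT//.
    rewrite -setXTT TF TG predeqE => -[x y]; split.
      by move=> [i _ []/= ? ?]; split; exists i.
    move=> [/= [i _ Fx] [j _ Gy]]; exists (maxn i j) => //; split.
    - by move: x Fx; exact/subsetPset/ndF/leq_maxl.
    - by move: y Gy; exact/subsetPset/ndG/leq_maxr.
  move=> i; have [? ?] := Foo i; have [? ?] := Goo i; split.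
    by rewrite -[X in measurable X]setTI; apply: mg => //; exact: measurableX.
  rewrite /nu/= /pushforward -comp_preimage.
  rewrite (_ : g \o f = id) ?preimage_id; last exact/funext.
  by rewrite /mu /= product_measure1E// lte_mul_pinfty// ge0_fin_numE.
pose S := Measure_isSigmaFinite.Build _ _ _ nu sf.
by exists (HB.pack_for (@SigmaFiniteMeasure.type _ _ R) (nu : set _ -> \bar R)
  (Measure.class nu) S).
Qed.

Let lebesgue_measureR0 n : @lebesgue_measureR n set0 = 0.
Proof. by have [m <-] := lebesgue_measureR_ex n; exact: measure0. Qed.

Let lebesgue_measureR_ge0 n A : 0 <= @lebesgue_measureR n A.
Proof. by have [m <-] := lebesgue_measureR_ex n; exact: measure_ge0. Qed.

Let lebesgue_measureR_additive n : semi_sigma_additive (@lebesgue_measureR n).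
Proof.
have [m <-] := lebesgue_measureR_ex n; exact: measure_semi_sigma_additive.
Qed.

HB.instance Definition _ n := isMeasure.Build _ _ _ (@lebesgue_measureR n)
  (@lebesgue_measureR0 n) (@lebesgue_measureR_ge0 n)
  (@lebesgue_measureR_additive n).

Let lebesgue_measureR_sigma_finite n :
  sigma_finite setT (@lebesgue_measureR n).
Proof. by have [m <-] := lebesgue_measureR_ex n; exact: sigma_finiteT. Qed.

HB.instance Definition _ n := Measure_isSigmaFinite.Build _ _ _
  (@lebesgue_measureR n) (lebesgue_measureR_sigma_finite n).

End LebesgueMeasure.
Arguments lebesgue_measureR R n : clear implicits.

Section FourierTransform.
Context {R : realType}.

Definition integralC {d} {T : measurableType d} (mu : {measure set T -> \bar R})
    (f : T -> R[i]) : R[i] :=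
  Rintegral mu setT (fun x => complex.Re (f x)) +i*
  Rintegral mu setT (fun x => complex.Im (f x)).

Definition expi (t : R) : R[i] := cos t +i* sin t.

Definition dotR {k} (x y : 'rV[R]_k) : R := \sum_(j < k) x ord0 j * y ord0 j.

Definition enorm {k} (x : 'rV[R]_k) : R := Num.sqrt (dotR x x).

Definition rowt {k} (t : k.-tuple (measurableTypeR R)) : 'rV[R]_k :=
  \row_(j < k) tnth t j.

Definition fourierRk {k} (f : 'rV[R]_k -> R[i]) (xi : 'rV[R]_k) : R[i] :=
  integralC (lebesgue_measureR R k)
    (fun t => f (rowt t) * expi (- (2 * pi * dotR xi (rowt t)))).

Definition fourierR (f : R -> R[i]) (xi : R) : R[i] :=
  integralC (@lebesgue_measure R)
    (fun x => f x * expi (- (2 * pi * (xi * x)))).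

(* The j-th derivative of the unit mass at x. *)
Definition delta (j : nat) (x : R) (f : R -> R[i]) : R[i] :=
  (-1) ^+ j * (derive1n j (fun y => complex.Re (f y)) x +i*
               derive1n j (fun y => complex.Im (f y)) x).

End FourierTransform.

Fixpoint double_fact (n : nat) : nat :=
  match n with
  | 0 | 1 => 1
  | n'.+2 => n * double_fact n'
  end.

Section Coefficients.
Context {R : realType}.

Definition alphak (k : nat) : R :=
  (-1) ^+ ((k - 3) %/ 2) / (double_fact (k - 2))%:R *
  (1 / (2 * pi)) ^+ ((k - 3) %/ 2).

Definition betajk (j k : nat) : R :=
  (-1) ^+ j * ((k - j - 3)`!)%:R / (j`! * double_fact (k - 2 * j - 3))%:R *
  (1 / (2 * pi)) ^+ ((k - 3) %/ 2).

End Coefficients.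

(* Main.v *)
Require Import Defs.
From mathcomp Require Import all_boot all_order all_algebra.
From mathcomp Require Import all_classical all_reals all_analysis.
From mathcomp Require Import measurable_realfun.
From mathcomp Require Import ring lra zify.

Import Order.TTheory GRing.Theory Num.Theory.
Import numFieldNormedType.Exports.

Set Implicit Arguments.
Unset Strict Implicit.
Unset Printing Implicit Defensive.

Local Open Scope classical_set_scope.
Local Open Scope complex_scope.
Local Open Scope ring_scope.

(** For a function [phi] on the line put [psi(r) = phi(r) - phi(-r)], and let
    [F_phi(x) = psi(|x|) / |x|], a radial function on the space with value
    [2 phi'(0)] at the origin.  Pairing [mu] with [F_phi] gives exactly [sigma]
    applied to [phi] ([dirac_sum_lift]).  The map [phi |-> F_phi] is continuous
    between the Schwartz spaces ([radial_lift_small]), hence [sigma] inherits a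
    temperate extension from [mu] ([schwartz_functional_lift]).

    Write [D g = g'(r) / r] and [k = 2 m + 3], and let
    [G_phi(x) = - i (- 1 / (2 pi))^m (D^m (psi / r))(|x|)].  If [phi] is a test
    function, then so is [G_phi], and the Fourier transform of [G_phi] is [F]
    of the Fourier transform of [phi] ([fourierRk_radial_lift]).  Therefore the
    transform of [sigma] at [phi] is the transform of [mu] at [G_phi], that is
    the sum of the [b(s) G_phi(s)].  Expanding [D^m (psi / r)] in derivatives of
    [psi], away from the origin ([rtower_formula]) and at it ([rtower_at0]),
    turns this sum into the stated one ([dirac_sum_hat]).

    The identity between the transforms is proved by density of Gaussians, so
    that neither polar coordinates nor the rotation invariance of Lebesgue
    measure enter.  If [psi / r] is [exp (- t r^2)], both sides are explicit,
    because the Gaussian on the space is a product ([gauss_radial_integral]).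
    In general, in the variable [w = exp (- r^2)] the function
    [D^m (psi / r) / w] is Lipschitz on the unit interval, hence a uniform limit
    of polynomials: so a combination of the [exp (- n r^2)] approximates
    [D^m (psi / r)] up to [e exp (- r^2)] ([gaussian_approximation]).
    Integrating [g' = r D g] from infinity carries this error bound down to
    [psi / r] ([tower_small]), and both sides of the identity change by a
    multiple of [e] ([hankel_identity]).

    Smoothness at the origin rests on [psi(r) / r] being the average of [psi']
    over the segment from [0] to [r] ([avg]), and the weighted bounds on the
    relation [r y = psi] between [psi] and its quotient [y] ([tame_avg]). *)

Local Notation "f ^` ()" := (derive1 f) : ring_scope.
Local Notation "f ^` ( n )" := (derive1n n f) : ring_scope.

(** * Smooth functions on the line *)

Section SmoothLine.
Context {R : realType}.
Implicit Types (u v g h : R -> R) (x y r c : R) (n m : nat).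

Definition smooth1 u := forall n x, derivable (u^`(n)) x 1.

Lemma smooth1_is_derive u n x :
  smooth1 u -> is_derive x 1 (u^`(n)) (u^`(n.+1) x).
Proof. by move=> su; apply: DeriveDef; [exact: su|rewrite derive1nS derive1E]. Qed.

Lemma smooth1_is_derive1 u x : smooth1 u -> is_derive x 1 u (u^`() x).
Proof. exact: (@smooth1_is_derive u 0). Qed.

Lemma is_derive_derive1 u x d : is_derive x 1 u d -> u^`() x = d.
Proof. by move=> ud; rewrite derive1E; exact: derive_val. Qed.

(** Exhibiting a whole sequence of candidate derivatives proves smoothness and
    identifies every derivative at the same time. *)
Lemma smooth1_tower (V : nat -> R -> R) :
    (forall n x, is_derive x 1 (V n) (V n.+1 x)) ->
  (forall n, (V 0%N)^`(n) = V n) /\ smooth1 (V 0%N).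
Proof.
move=> dV.
have E n : (V 0%N)^`(n) = V n.
  elim: n => // n IH; rewrite derive1nS IH; apply/funext => x.
  exact: is_derive_derive1.
by split=> // n x; rewrite E; case: (dV n x).
Qed.

Lemma smooth1_derive u n : smooth1 u -> smooth1 (u^`(n)).
Proof. by move=> su i x; rewrite /derive1n -iterD; exact: su. Qed.

Lemma smooth1_derive1 u : smooth1 u -> smooth1 u^`().
Proof. exact: (@smooth1_derive u 1). Qed.

Lemma derive1nSr u n : u^`()^`(n) = u^`(n.+1).
Proof. by rewrite /derive1n iterSr. Qed.

Lemma smooth1_continuous u n : smooth1 u -> continuous (u^`(n)).
Proof. by move=> su x; exact/differentiable_continuous/derivable1_diffP/su. Qed.

Lemma smooth1_lin u v a b : smooth1 u -> smooth1 v ->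
  (forall n, (fun x => a * u x + b * v x)^`(n) =
             (fun x => a * u^`(n) x + b * v^`(n) x)) /\
  smooth1 (fun x => a * u x + b * v x).
Proof.
move=> su sv.
apply: (smooth1_tower (V := fun n x => a * u^`(n) x + b * v^`(n) x)) => n x.
have ? := smooth1_is_derive n x su; have ? := smooth1_is_derive n x sv.
exact: is_deriveD.
Qed.

Lemma smooth1_refl u : smooth1 u ->
  (forall n, (fun x => u (- x))^`(n) = (fun x => (-1) ^+ n * u^`(n) (- x))) /\
  smooth1 (fun x => u (- x)).
Proof.
move=> su; have [|H1 H2] :=
    smooth1_tower (V := fun n x => (-1) ^+ n * u^`(n) (- x)).
  move=> n x.
  have ? := smooth1_is_derive n (- x) su.
  have ? : is_derive x 1 (fun x => u^`(n) (- x)) (- u^`(n.+1) (- x)).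
    apply: is_derive_eq.
    by rewrite -[RHS]mulN1r mulrC.
  by apply: is_derive_eq; rewrite [_ *: _]mulrN exprS mulN1r mulNr.
have E : (fun x => (-1) ^+ 0 * u^`(0) (- x)) = (fun x => u (- x)).
  by apply/funext => x; rewrite mul1r.
by rewrite -E.
Qed.

Lemma smooth1_mulid u : smooth1 u ->
  (forall n, (fun x => x * u x)^`(n) =
             (fun x => x * u^`(n) x + n%:R * u^`(n.-1) x)) /\
  smooth1 (fun x => x * u x).
Proof.
move=> su; have [|H1 H2] :=
    smooth1_tower (V := fun n x => x * u^`(n) x + n%:R * u^`(n.-1) x).
  move=> n x.
  have ? := smooth1_is_derive n x su.
  have ? := smooth1_is_derive n.-1 x su.
  have E : n%:R * u^`(n.-1.+1) x = n%:R * u^`(n) x.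
    by case: (n) => //; rewrite !mul0r.
  by apply: is_derive_eq; rewrite /GRing.scale/= [n%:R * _]E -natr1 -derive1nS; ring.
have E : (fun x => x * u^`(0) x + 0%:R * u^`(0.-1) x) = (fun x => x * u x).
  by apply/funext => x; rewrite mul0r addr0.
by rewrite -E.
Qed.

End SmoothLine.

(** * Averages along a segment from the origin *)

Section Averages.
Context {R : realType}.
Implicit Types (u v g h chi : R -> R) (x y r c : R) (n m : nat).
Local Notation leb := (@lebesgue_measure R).

(** For [n = 0] and [chi = u'] this is [(u r - u 0) / r], in a form that stays
    smooth at [r = 0]; each differentiation in [r] brings out a factor [t]. *)
Definition avg n chi (r : R) : R :=
  \int[leb]_(t in `[0, 1]) (t ^+ n * chi (t * r)).

Let cont_avg n chi r : continuous chi ->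
  continuous (fun t : R => t ^+ n * chi (t * r)).
Proof.
move=> cchi t; apply: cvgM; first exact: exprn_continuous.
apply: (continuous_comp (f := fun t : R => t * r)); last exact: cchi.
by apply: cvgM; [exact: cvg_id | exact: cvg_cst].
Qed.

Let int_avg n chi r : continuous chi ->
  leb.-integrable `[0, 1] (EFin \o (fun t : R => t ^+ n * chi (t * r))).
Proof.
move=> cchi; apply: continuous_compact_integrable; first exact: segment_compact.
exact/continuous_subspaceT/cont_avg.
Qed.

(** The segment swept by [t * r], for [r] near [x], is compact, so [chi'] is
    bounded on it and the derivative passes under the integral sign. *)
Lemma avg_is_derive n chi x : (forall y, derivable chi y 1) ->
  continuous chi^`() -> is_derive x 1 (avg n chi) (avg n.+1 chi^`() x).
Proof.
move=> dchi cchi'.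
have cchi : continuous chi.
  by move=> y; exact/differentiable_continuous/derivable1_diffP/dchi.
pose f r t : R := t ^+ n * chi (t * r).
have df r t : is_derive r 1 (f ^~ t) (t ^+ n.+1 * chi^`() (t * r)).
  have ? : is_derive (t * r) 1 chi (chi^`() (t * r)).
    by apply: DeriveDef; [exact: dchi|rewrite derive1E].
  have ? : is_derive r 1 (fun r => chi (t * r)) (chi^`() (t * r) * t).
    have ? : is_derive r 1 (fun r => t * r) t.
      by apply: is_derive_eq; rewrite /GRing.scale/= mulr1.
    apply: is_derive_eq.
    by rewrite /GRing.scale/= mulrC.
  apply: is_derive_eq.
  by rewrite /GRing.scale/= exprS; ring.
have d1f r t : partial1of2 f r t = t ^+ n.+1 * chi^`() (t * r).
  by rewrite partial1of2E; apply: derive_val.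
have [K [_ HK]] : bounded_set (chi^`() @` `[-(`|x|+1), `|x|+1]).
  apply: compact_bounded; apply: continuous_compact.
    exact/continuous_subspaceT.
  exact: segment_compact.
pose C := `|K| + 1.
have Ia : `]x - 1, x + 1[%classic x.
  by rewrite /= in_itv/=; apply/andP; split; lra.
have bnd r t : `]x - 1, x + 1[%classic r -> `[0, 1]%classic t ->
    `|partial1of2 f r t| <= C.
  rewrite /= !in_itv/= => /andP[r1 r2] /andP[t0 t1].
  rewrite d1f normrM ger0_norm ?exprn_ge0//.
  apply: le_trans (_ : 1 * `|chi^`() (t * r)| <= _).
    by rewrite ler_wpM2r// exprn_ile1.
  rewrite mul1r; apply: (HK C).
    by rewrite /C (le_lt_trans (ler_norm K))// ltrDl.
  exists (t * r) => //; rewrite /= in_itv/= -ler_norml normrM (ger0_norm t0).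
  apply: (@le_trans _ _ (1 * `|r|)); first by rewrite ler_wpM2r.
  rewrite mul1r ler_norml.
  have := ler_norm x; have := ler_norm (- x); rewrite normrN => *.
  by apply/andP; split; lra.
have mB : measurable (`[0, 1]%classic : set (measurableTypeR R)) by [].
have intC : leb.-integrable `[0, 1] (EFin \o (fun=> C : R)).
  apply: continuous_compact_integrable; first exact: segment_compact.
  by apply: continuous_subspaceT => ?; exact: cvg_cst.
have C0 : 0 <= C by rewrite /C addr_ge0.
have intf r : `]x - 1, x + 1[%classic r ->
  leb.-integrable `[0, 1] (EFin \o f r) by move=> _; exact: int_avg.
have derf r t : `]x - 1, x + 1[%classic r -> `[0, 1]%classic t ->
  derivable (f ^~ t) r 1 by move=> _ _; case: (df r t).
have D1 := derivable_under_integral mB Ia intf derf (fun=> C0) intC bnd.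
have D2 := differentiation_under_integral mB Ia intf derf (fun=> C0) intC bnd.
apply: DeriveDef; first exact: D1.
rewrite -derive1E D2.
by apply: eq_Rintegral => t _; rewrite -/(partial1of2 f x t) d1f.
Qed.

Lemma avg_smooth n chi : smooth1 chi ->
  (forall m, (avg n chi)^`(m) = avg (n + m) chi^`(m)) /\ smooth1 (avg n chi).
Proof.
move=> schi; have := @smooth1_tower _ (fun m => avg (n + m) chi^`(m)).
rewrite addn0; apply=> m x; rewrite addnS derive1nS; apply: avg_is_derive.
  by move=> y; exact: schi.
by rewrite -derive1nS; exact: smooth1_continuous.
Qed.

Lemma avg_le n chi c r : continuous chi ->
  (forall y, `|chi y| <= c) -> `|avg n chi r| <= c.
Proof.
move=> cchi Hc; rewrite /avg.
have mB : measurable (`[0, 1]%classic : set (measurableTypeR R)) by [].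
apply: le_trans (le_normr_Rintegral mB (int_avg n r cchi)) _.
apply: (@le_trans _ _ (\int[leb]_(t in `[0, 1]) c)); last first.
  by rewrite Rintegral_cst//= lebesgue_measure_itv/= lte_fin ltr01 /= subr0 mulr1.
apply: le_Rintegral => //.
- have -> : EFin \o (fun t : R => `|t ^+ n * chi (t * r)|) =
    abse \o (EFin \o (fun t : R => t ^+ n * chi (t * r))) by [].
  by apply: integrable_abse; exact: int_avg.
- apply: continuous_compact_integrable; first exact: segment_compact.
  by apply: continuous_subspaceT => ?; exact: cvg_cst.
move=> t; rewrite /= in_itv/= => /andP[t0 t1].
rewrite normrM ger0_norm ?exprn_ge0//.
by rewrite -[leRHS]mul1r ler_pM ?exprn_ge0// exprn_ile1.
Qed.

Lemma avg0_0 chi : avg 0 chi 0 = chi 0.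
Proof.
rewrite /avg; under eq_Rintegral do rewrite expr0 mul1r mulr0.
by rewrite Rintegral_cst//= lebesgue_measure_itv/= lte_fin ltr01 /= subr0 mulr1.
Qed.

(** The fundamental theorem of calculus along the segment from [0] to [r]. *)
Lemma avg0_derive u r : smooth1 u -> r * avg 0 u^`() r = u r - u 0.
Proof.
move=> su; rewrite /avg; under eq_Rintegral do rewrite expr0 mul1r.
have cu1 : continuous u^`() := smooth1_continuous (n := 1%N) su.
have cu' : continuous (fun t : R => u^`() (t * r)).
  move=> t; apply: (continuous_comp (f := fun t : R => t * r)).
    by apply: cvgM; [exact: cvg_id | exact: cvg_cst].
  exact: cu1.
have mB : measurable (`[0, 1]%classic : set (measurableTypeR R)) by [].
rewrite -RintegralZl//; last first.
  apply: continuous_compact_integrable; first exact: segment_compact.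
  exact: continuous_subspaceT.
rewrite /Rintegral.
have D (t : R) : is_derive t 1 (fun t : R => u (t * r)) (r * u^`() (t * r)).
  have ? : is_derive (t * r) 1 u (u^`() (t * r)).
    exact: (smooth1_is_derive 0 _ su).
  have ? : is_derive t 1 (fun t : R => t * r) r.
    by apply: is_derive_eq; rewrite /GRing.scale/= mulr1 mulr0 add0r.
  by apply: is_derive_eq; exact: mulrC.
have cU : continuous (fun t : R => u (t * r)).
  by move=> t; apply/differentiable_continuous/derivable1_diffP; case: (D t).
rewrite (@continuous_FTC2 _ _ (fun t : R => u (t * r))) ?ltr01//.
- by rewrite -EFinB/= mul1r mul0r.
- apply: continuous_subspaceT => t; apply: cvgM; first exact: cvg_cst.
  exact: cu'.
- split; first by move=> t _; case: (D t).
  + apply: cvg_at_right_filter; exact: cU.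
  + apply: cvg_at_left_filter; exact: cU.
- by move=> t _; exact: is_derive_derive1.
Qed.

End Averages.

(** * Weighted bounds that are uniform in the function *)

Section Control.
Context {R : realType}.
Implicit Types (u v g h : R -> R) (r c : R) (n m : nat).

Definition weighted_le (w : nat * nat) u c : Prop :=
  forall r, `|r ^+ w.1 * u^`(w.2) r| <= c.

(** Letting one family of seminorms and one constant serve all [u] gives two
    things at once: [A u] is bounded when [u] is a Schwartz function, and it is
    small when [u] is small. *)
Definition controlled {X : Type} (A : (R -> R) -> X -> R) : Prop :=
  exists (W : seq (nat * nat)) (C : R), 0 <= C /\
  forall u c, smooth1 u -> 0 <= c -> (forall w, w \in W -> weighted_le w u c) ->
    forall x, `|A u x| <= C * c.

Lemma controlled_base m n : controlled (fun u r => r ^+ m * u^`(n) r).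
Proof.
exists [:: (m, n)], 1; split=> // u c su c0 H r.
by rewrite mul1r; apply: (H (m, n)); rewrite inE.
Qed.

(** The bounds on [B] and [B'] are suprema, so that a mean value of [B u] may be
    used to bound [A u x]. *)
Lemma controlled_by2 {X Y Z : Type} (A : _ -> X -> R) (B : _ -> Y -> R)
    (B' : _ -> Z -> R) (K : R) : controlled B -> controlled B' ->
  (forall u c, smooth1 u -> 0 <= c -> (forall y, `|B u y| <= c) ->
    (forall z, `|B' u z| <= c) -> forall x, `|A u x| <= K * c) ->
  controlled A.
Proof.
move=> [W [C [C0 HB]]] [W' [C' [C'0 HB']]] H.
exists (W ++ W'), (`|K| * (C + C')); split.
  by rewrite mulr_ge0// addr_ge0.
move=> u c su c0 Hc x.
have cc : 0 <= (C + C') * c by rewrite mulr_ge0// addr_ge0.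
apply: (@le_trans _ _ (K * ((C + C') * c))).
  apply: H => // y.
  - apply: le_trans (_ : C * c <= _); last by rewrite ler_wpM2r// lerDl.
    by apply: HB => // w wW; apply: Hc; rewrite mem_cat wW.
  - apply: le_trans (_ : C' * c <= _); last by rewrite ler_wpM2r// lerDr.
    by apply: HB' => // w wW; apply: Hc; rewrite mem_cat wW orbT.
by rewrite -mulrA ler_wpM2r// ler_norm.
Qed.

Lemma controlled_by {X Y : Type} (A : _ -> X -> R) (B : _ -> Y -> R) (K : R) :
  controlled B ->
  (forall u c, smooth1 u -> 0 <= c -> (forall y, `|B u y| <= c) ->
    forall x, `|A u x| <= K * c) ->
  controlled A.
Proof.
by move=> cB H; apply: (controlled_by2 cB cB (K := K)) => u c su c0 + _; exact: H.
Qed.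

Definition tame (B : (R -> R) -> R -> R) : Prop :=
  (forall u, smooth1 u -> smooth1 (B u)) /\
  forall m n, controlled (fun u r => r ^+ m * (B u)^`(n) r).

Definition odd_part u : R -> R := fun r => u r - u (- r).

Lemma smooth1_odd_part u : smooth1 u ->
  (forall n, (odd_part u)^`(n) =
             (fun r => u^`(n) r - (-1) ^+ n * u^`(n) (- r))) /\
  smooth1 (odd_part u).
Proof.
move=> su; have [H1 H2] := smooth1_refl su.
have [H3 H4] := smooth1_lin 1 (-1) su H2.
have E : odd_part u = (fun x => 1 * u x + (-1) * u (- x)).
  by apply/funext => x; rewrite mul1r mulN1r.
split; last by rewrite E.
by move=> n; rewrite E H3 H1; apply/funext => x; rewrite mul1r mulN1r.
Qed.

Lemma tame_odd_part : tame odd_part.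
Proof.
split=> [u su|m n]; first by case: (smooth1_odd_part su).
apply: (controlled_by (K := 2) (controlled_base m n)) => u c su c0 H r.
have [-> _] := smooth1_odd_part su.
rewrite mulrBr (le_trans (ler_normB _ _))//.
have := H r; have := H (- r).
rewrite [in X in X -> _](_ : `|_| = `|r ^+ m * ((-1) ^+ n * u^`(n) (- r))|); last first.
  by rewrite !normrM !normrX normrN1 normrN expr1n mul1r.
lra.
Qed.

Lemma tame_derive B : tame B -> tame (fun u => (B u)^`()).
Proof.
move=> [sB cB]; split=> [u su|m n]; first exact: (smooth1_derive1 (sB _ su)).
have [W [C [C0 H]]] := cB m n.+1; exists W, C; split => // u c su c0 Hw r.
by rewrite derive1nSr; exact: H.
Qed.

(** Write [y] for the average, so that [B u r = r * y r].  With no weight, [y^(n)]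
    is itself an average of [(B u)^(n+1)]; a further factor [r] is traded by
    [r y^(n) = (B u)^(n) - n y^(n-1)]. *)
Lemma tame_avg B : tame B -> (forall u, smooth1 u -> B u 0 = 0) ->
  tame (fun u => avg 0 (B u)^`()).
Proof.
move=> [sB cB] B0; split=> [u su|].
  by case: (avg_smooth 0 (smooth1_derive1 (sB _ su))).
elim=> [|m IH] n.
  apply: (controlled_by (K := 1) (cB 0%N n.+1)) => u c su c0 H r.
  have [-> _] := avg_smooth 0 (smooth1_derive1 (sB _ su)).
  rewrite expr0 !mul1r add0n derive1nSr; apply: avg_le.
    exact: (smooth1_continuous (sB _ su)).
  by move=> y; have := H y; rewrite expr0 mul1r.
apply: (controlled_by2 (K := 1 + n%:R) (cB m n) (IH n.-1)) => u c su c0 H1 H2 r.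
have [_ sy] := avg_smooth 0 (smooth1_derive1 (sB _ su)).
have E : B u = (fun x => x * avg 0 (B u)^`() x).
  by apply/funext => x; rewrite (avg0_derive _ (sB _ su)) B0// subr0.
have [L _] := smooth1_mulid sy.
have /(congr1 (fun f => f r)) := L n; rewrite -E => Ln.
rewrite (_ : r ^+ m.+1 * _ = r ^+ m * (B u)^`(n) r -
    n%:R * (r ^+ m * (avg 0 (B u)^`())^`(n.-1) r)); last first.
  by rewrite Ln exprS; ring.
rewrite (le_trans (ler_normB _ _))// mulrDl mul1r lerD//.
by rewrite normrM ger0_norm// ler_wpM2l.
Qed.

Definition even_fun u := forall r, u (- r) = u r.

Lemma even_derive0 u : smooth1 u -> even_fun u ->
  (forall r, u^`() (- r) = - u^`() r) /\ u^`() 0 = 0.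
Proof.
move=> su eu; have [H _] := smooth1_refl su.
have E : (fun x => u (- x)) = u by apply/funext.
have O r : u^`() (- r) = - u^`() r.
  have /(congr1 (fun f => f r)) := H 1%N.
  by rewrite E expr1 mulN1r /= => ->; rewrite opprK.
split=> //; have := O 0; rewrite oppr0 => /eqP.
by rewrite -subr_eq0 opprK -mulr2n mulrn_eq0/= => /eqP.
Qed.

(** The quotient [(u(r) - u(-r)) / r], extended smoothly over [r = 0]. *)
Definition odd_quot u : R -> R := avg 0 (odd_part u)^`().

(** The operator [g'(r) / r], which is the derivative with respect to
    [r^2 / 2]. *)
Definition rdiv g : R -> R := avg 0 g^`(2%N).

Definition rtower n u : R -> R := iter n rdiv (odd_quot u).

Lemma avg_even v : smooth1 v -> (forall r, v (- r) = - v r) -> v 0 = 0 ->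
  even_fun (avg 0 v^`()).
Proof.
move=> sv ov v0 r; have [->|r0] := eqVneq r 0; first by rewrite oppr0.
have H1 := avg0_derive r sv; have H2 := avg0_derive (- r) sv.
move: H1 H2; rewrite v0 !subr0 ov => H1; rewrite -H1 mulNr => /oppr_inj.
exact: mulfI.
Qed.

Lemma odd_part0 u : odd_part u 0 = 0.
Proof. by rewrite /odd_part oppr0 subrr. Qed.

Lemma odd_part_odd u r : odd_part u (- r) = - odd_part u r.
Proof. by rewrite /odd_part opprK opprB. Qed.

Lemma odd_quotE u r : smooth1 u -> r * odd_quot u r = odd_part u r.
Proof.
move=> su; have [_ so] := smooth1_odd_part su.
by rewrite (avg0_derive _ so) odd_part0 subr0.
Qed.

Lemma rdivE g r : smooth1 g -> even_fun g -> r * rdiv g r = g^`() r.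
Proof.
move=> sg eg; have [_ g0] := even_derive0 sg eg.
have := avg0_derive r (smooth1_derive1 sg).
by rewrite g0 subr0.
Qed.

Lemma rdiv_even g : smooth1 g -> even_fun g -> smooth1 (rdiv g) /\ even_fun (rdiv g).
Proof.
move=> sg eg; have [og g0] := even_derive0 sg eg; split.
  by case: (avg_smooth 0 (smooth1_derive1 (smooth1_derive1 sg))).
exact: (avg_even (smooth1_derive1 sg)).
Qed.

Lemma odd_quot_even u : smooth1 u -> smooth1 (odd_quot u) /\ even_fun (odd_quot u).
Proof.
move=> su; have [_ so] := smooth1_odd_part su; split.
  by case: (avg_smooth 0 (smooth1_derive1 so)).
by apply: avg_even => // *; [exact: odd_part_odd|exact: odd_part0].
Qed.

Lemma rtower_even n u : smooth1 u -> smooth1 (rtower n u) /\ even_fun (rtower n u).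
Proof.
move=> su; elim: n => [|n [s e]]; first exact: odd_quot_even.
exact: rdiv_even.
Qed.

Lemma tame_rtower n : tame (rtower n).
Proof.
elim: n => [|n IH].
  by apply: (tame_avg tame_odd_part) => u _; exact: odd_part0.
apply: (tame_avg (tame_derive IH)) => u su.
have [s e] := rtower_even n su.
by have [] := even_derive0 s e.
Qed.

End Control.

(** * Radial functions *)

Section EuclideanNorm.
Context {R : realType} {k : nat}.
Implicit Types (x y v : 'rV[R]_k).

Lemma dotR_ge0 x : 0 <= dotR x x.
Proof. by apply: sumr_ge0 => j _; rewrite -expr2 sqr_ge0. Qed.

Lemma enorm_ge0 x : 0 <= enorm x.
Proof. exact: sqrtr_ge0. Qed.

Lemma enorm_sqr x : enorm x ^+ 2 = dotR x x.
Proof. by rewrite sqr_sqrtr// dotR_ge0. Qed.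

Lemma coord_le_norm x j : `|x ord0 j| <= `|x|.
Proof.
rewrite [leRHS]mx_normrE.
by apply: le_trans (le_bigmax _ (fun i => `|x i.1 i.2|) (ord0, j)).
Qed.

Lemma norm_le_enorm x : `|x| <= enorm x.
Proof.
rewrite [leLHS]mx_normrE; apply: bigmax_le; first exact: enorm_ge0.
move=> [i j] _ /=; rewrite (ord1 i) -(@ler_pXn2r _ 2) ?nnegrE ?enorm_ge0//.
rewrite enorm_sqr /dotR (bigD1 j)//= real_normK ?num_real// expr2 lerDl.
by apply: sumr_ge0 => l _; rewrite -expr2 sqr_ge0.
Qed.

Lemma enorm_le_norm x : enorm x <= k%:R * `|x|.
Proof.
have [k0|k0] := posnP k.
  rewrite /enorm /dotR big1 ?sqrtr0 ?mulr_ge0// => i _.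
  by move: (ltn_ord i); rewrite {2}k0.
rewrite -(@ler_pXn2r _ 2) ?nnegrE ?enorm_ge0 ?mulr_ge0//.
rewrite enorm_sqr /dotR exprMn.
apply: (@le_trans _ _ (\sum_(j < k) `|x| ^+ 2)).
  apply: ler_sum => j _; rewrite -expr2 -real_normK ?num_real//.
  by rewrite ler_pXn2r ?nnegrE ?coord_le_norm.
rewrite sumr_const card_ord -[leLHS]mulr_natl ler_wpM2r ?sqr_ge0//.
by rewrite expr2 -natrM ler_nat leq_pmulr.
Qed.

Lemma enorm_eq0 x : (enorm x == 0) = (x == 0).
Proof.
apply/idP/eqP => [/eqP x0|->].
  by apply/eqP; rewrite -normr_le0 -x0 norm_le_enorm.
by rewrite /enorm /dotR big1 ?sqrtr0// => i _; rewrite mxE mul0r.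
Qed.

Lemma enorm0 : enorm (0 : 'rV[R]_k) = 0.
Proof. by apply/eqP; rewrite enorm_eq0. Qed.

Lemma dotR_le x v : `|dotR x v| <= (\sum_(j < k) `|v ord0 j|) * enorm x.
Proof.
rewrite /dotR (le_trans (ler_norm_sum _ _ _))// mulr_suml ler_sum// => j _.
by rewrite normrM mulrC ler_wpM2l// (le_trans (coord_le_norm _ _)) ?norm_le_enorm.
Qed.

Lemma coord_derive x v j :
  is_derive x v (fun y : 'rV[R]_k => y ord0 j) (v ord0 j).
Proof.
have d := @differentiable_coord R 1 k x ord0 j.
apply: DeriveDef; first exact: diff_derivable.
rewrite /derive; apply: cvg_lim => //.
apply: (@cvg_trans _ ((cst (v ord0 j)) @ (0 : R)^')); last exact: cvg_cst.
apply: near_eq_cvg; near=> h.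
rewrite /= !mxE addrK -[RHS]/(h^-1 * (h * v ord0 j)) mulrA mulVf ?mul1r//.
by near: h; exact: nbhs_dnbhs_neq.
Unshelve. all: by end_near. Qed.

Lemma dotRl_derive x v w : is_derive x v (fun y : 'rV[R]_k => dotR y w) (dotR v w) /\
  differentiable (fun y : 'rV[R]_k => dotR y w) x.
Proof.
have E : (fun y : 'rV[R]_k => dotR y w) = \sum_(j < k) (fun y => w ord0 j *: y ord0 j).
  apply/funext => y; rewrite fct_sumE; apply: eq_bigr => j _.
  by rewrite /GRing.scale/= mulrC.
rewrite E; split.
  apply: is_derive_eq.
    apply: is_derive_sum => j; apply: is_deriveZ; exact: coord_derive.
  by apply: eq_bigr => j _; rewrite /GRing.scale/= mulrC.
apply: differentiable_sum => j; apply: differentiableZ.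
exact: differentiable_coord.
Qed.

Lemma dotR_sqr_derive x v :
  is_derive x v (fun y : 'rV[R]_k => dotR y y) (2 * dotR x v) /\
  differentiable (fun y : 'rV[R]_k => dotR y y) x.
Proof.
have E : (fun y : 'rV[R]_k => dotR y y) =
    \sum_(j < k) ((fun y => y ord0 j) * (fun y => y ord0 j) : _ -> R).
  by apply/funext => y; rewrite fct_sumE.
rewrite E; split.
  apply: is_derive_eq.
    apply: is_derive_sum => j; apply: is_deriveM; exact: coord_derive.
  rewrite /dotR mulr_sumr; apply: eq_bigr => j _.
  by rewrite /GRing.scale/= mulr2n mulrDl mul1r.
apply: differentiable_sum => j; apply: differentiableM;
exact: differentiable_coord.
Qed.

End EuclideanNorm.

(** This serves at the origin, where the norm itself is not differentiable. *)
Lemma flat_differentiable (R : realType) (V : normedModType R) (f : V -> R) x :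
  (forall e, 0 < e -> \forall h \near (0 : V), `|f (h + x) - f x| <= e * `|h|) ->
  differentiable f x /\ forall v, 'D_v f x = 0.
Proof.
move=> H.
have o : f \o shift x = cst (f x) + (\0 : V -> R) +o_ (0 : V) id.
  apply/eqaddoP => e e0; near=> h.
  rewrite -[X in `|X|]/(f (h + x) - (f x + 0)) addr0; near: h; exact: H.
have c0 : continuous (\0 : V -> R) by move=> z; exact: cvg_cst.
have d0 : 'd f x = \0 :> (V -> R) by exact: (@diff_unique _ _ _ f \0).
have df : differentiable f x.
  by apply/diff_locallyP; rewrite d0; split.
by split=> // v; rewrite deriveE// d0.
Unshelve. all: by end_near. Qed.

Section RadialDerivative.
Context {R : realType} {k : nat}.
Implicit Types (x y v : 'rV[R]_k).

(** [rdiv] is, up to the factor 2, the derivative with respect to [r^2]. *)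
Lemma sqrt_profile_derive (g : R -> R) (s : R) : smooth1 g -> even_fun g -> 0 < s ->
  is_derive s 1 (fun s => g (Num.sqrt s)) (rdiv g (Num.sqrt s) / 2).
Proof.
move=> sg eg s0; have ? := is_derive1_sqrt s0.
have ? := smooth1_is_derive1 (Num.sqrt s) sg.
have n0 : Num.sqrt s != 0 by rewrite gt_eqF ?sqrtr_gt0.
by apply: is_derive_eq; rewrite -(rdivE _ sg eg) /GRing.scale/=; field.
Qed.

(** Away from the origin this is the chain rule; at the origin the vanishing of
    [g'(0)] absorbs the singularity of the norm. *)
Lemma radial_derive (g : R -> R) x : smooth1 g -> even_fun g ->
  differentiable (fun y : 'rV[R]_k => g (enorm y)) x /\
  forall v, 'D_v (fun y : 'rV[R]_k => g (enorm y)) x = dotR x v * rdiv g (enorm x).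
Proof.
move=> sg eg; have [_ g0] := even_derive0 sg eg.
have [->|x0] := eqVneq x 0.
  have [|d D] := @flat_differentiable _ _ (fun y : 'rV[R]_k => g (enorm y)) 0.
    move=> e e0.
    have K0 : 0 < (k%:R + 1 : R) by rewrite ltr_wpDl.
    have : \forall t \near (0 : R), `|g t - g 0| <= e / (k%:R + 1) * `|t|.
      have /derivable1_diffP/diff_locally/eqaddoP := sg 0%N 0.
      move=> /(_ _ (divr_gt0 e0 K0)); apply: filterS => t /=.
      rewrite -[X in `|X| <= _ -> _]/(g (t + 0) - (g 0 + 'd g 0 t)) addr0.
      rewrite diff1E; last exact/derivable1_diffP/(sg 0%N).
      by rewrite g0 scaler0 addr0.
    rewrite -nbhs_nearE => /nbhs_ballP[d /= d0 Hd]; near=> h.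
    rewrite addr0 enorm0; apply: (@le_trans _ _ (e / (k%:R + 1) * `|enorm h|)).
      apply: Hd; rewrite -ball_normE/= sub0r normrN ger0_norm ?enorm_ge0//.
      apply: (le_lt_trans (enorm_le_norm _)).
      apply: (@le_lt_trans _ _ ((k%:R + 1) * `|h|)).
        by rewrite ler_wpM2r// lerDl.
      rewrite -ltr_pdivlMl//; near: h.
      apply/nbhs_ballP; exists ((k%:R + 1)^-1 * d) => /=.
        by rewrite mulr_gt0// invr_gt0.
      by move=> z; rewrite -ball_normE/= sub0r normrN.
    rewrite -mulrA ler_pM2l// ler_pdivrMl// ger0_norm ?enorm_ge0//.
    by rewrite (le_trans (enorm_le_norm _))// ler_wpM2r// lerDl.
  by split => // v; rewrite D /dotR big1 ?mul0r// => j _; rewrite mxE mul0r.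
have q0 : 0 < dotR x x.
  by rewrite lt_neqAle dotR_ge0 andbT eq_sym -enorm_sqr sqrf_eq0 enorm_eq0.
have [_ dq] := dotR_sqr_derive x 0.
have n0 : 0 < enorm x by rewrite lt_neqAle enorm_ge0 eq_sym enorm_eq0 x0.
have dF := sqrt_profile_derive sg eg q0.
have dF' : differentiable (fun s => g (Num.sqrt s)) (dotR x x).
  by apply/derivable1_diffP; case: dF.
have dc : differentiable (fun y : 'rV[R]_k => g (enorm y)) x.
  exact: (@differentiable_comp _ _ _ _ (fun y => dotR y y) (fun s => g (Num.sqrt s))).
split=> // v; rewrite deriveE//.
rewrite (@diff_comp _ _ _ _ (fun y => dotR y y) (fun s => g (Num.sqrt s)))//=.
have [[_ Dq] _] := dotR_sqr_derive x v.
rewrite -(deriveE v dq) Dq -[2 * _]mulr1 -[_ * 1]/((2 * dotR x v) *: (1 : R)) linearZ/=.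
rewrite -derive1E'// (is_derive_derive1 dF) /GRing.scale/=.
by field.
Unshelve. all: by end_near. Qed.

End RadialDerivative.

(** * Directional derivatives of radial functions *)

Section RadialOperators.
Context {R : realType} {k : nat}.
Implicit Types (x y v : 'rV[R]_k) (u : R -> R).

(** The operators reached from the radial functions of the tower by repeated
    directional derivatives: differentiating along [v] multiplies by [x . v] and
    moves one step up the tower. *)
Inductive radial_op : ((R -> R) -> 'rV[R]_k -> R) -> Prop :=
| RadialTower n : radial_op (fun u x => rtower n u (enorm x))
| RadialAdd A B : radial_op A -> radial_op B ->
    radial_op (fun u x => A u x + B u x)
| RadialScale c A : radial_op A -> radial_op (fun u x => c * A u x)
| RadialDot v A : radial_op A -> radial_op (fun u x => dotR x v * A u x).

Lemma radial_op_derive A v : radial_op A -> exists B, radial_op B /\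
  forall u, smooth1 u -> forall x, differentiable (A u) x /\ 'D_v (A u) x = B u x.
Proof.
elim=> {A} [n|A B _ [A' [oA HA]] _ [B' [oB HB]]|c A _ [A' [oA HA]]|
    w A oA0 [A' [oA HA]]].
- exists (fun u x => dotR x v * rtower n.+1 u (enorm x)).
  split; first exact: RadialDot (RadialTower n.+1).
  move=> u su x; have [s e] := rtower_even n su.
  by have [d D] := radial_derive x s e; split; [|rewrite D].
- exists (fun u x => A' u x + B' u x); split; first exact: RadialAdd.
  move=> u su x; have [dA DA] := HA u su x; have [dB DB] := HB u su x.
  split; first exact: differentiableD.
  by rewrite -DA -DB; apply: deriveD; exact: diff_derivable.
- exists (fun u x => c * A' u x); split; first exact: RadialScale.
  move=> u su x; have [dA DA] := HA u su x.
  split; first exact: (differentiableZ c dA).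
  by rewrite -DA; apply: (deriveZ c); exact: diff_derivable.
- exists (fun u x => dotR x w * A' u x + dotR v w * A u x).
  split; first by apply: RadialAdd; [exact: RadialDot|exact: RadialScale].
  move=> u su x; have [dA DA] := HA u su x.
  have [dw Dw] := @dotRl_derive _ _ x v w.
  split; first exact: differentiableM.
  have ? : is_derive x v (A u) (A' u x).
    by apply: DeriveDef => //; exact: diff_derivable.
  have : is_derive x v (fun y => dotR y w * A u y)
      (dotR x w *: A' u x + A u x *: dotR v w) by exact: is_deriveM.
  move=> [_ ->]; rewrite /GRing.scale/=; ring.
Qed.

Lemma radial_op_iter_derive A s : radial_op A -> exists B, radial_op B /\
  forall u, smooth1 u -> iter_derive s (A u) = B u.
Proof.
move=> oA; elim: s => [|v s [B [oB HB]]]; first by exists A.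
have [C [oC HC]] := radial_op_derive v oB.
exists C; split=> // u su; apply/funext => x.
by rewrite -[LHS]/('D_v (iter_derive s (A u)) x) HB//; case: (HC u su x).
Qed.

Lemma radial_op_smooth A u s x : radial_op A -> smooth1 u ->
  differentiable (iter_derive s (A u)) x.
Proof.
move=> oA su; have [B [oB ->//]] := radial_op_iter_derive s oA.
by have [C [_ H]] := radial_op_derive 0 oB; case: (H u su x).
Qed.

(** Powers of [|x|] are paid by the decay of the profile, as [|x|] is at most the
    Euclidean norm; a factor [x . v] costs one more power. *)
Lemma radial_op_controlled A m : radial_op A ->
  controlled (fun u x => `|x| ^+ m * A u x).
Proof.
move=> oA; elim: oA m => {A} [n|A B _ HA _ HB|c A _ HA|w A _ HA] m.
- have [_ /(_ m 0%N) ct] := @tame_rtower R n.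
  apply: (controlled_by (K := 1) ct) => u c su c0 H x.
  rewrite mul1r (le_trans _ (H (enorm x)))// !normrM ler_wpM2r//.
  rewrite !ger0_norm ?exprn_ge0 ?enorm_ge0// lerXn2r ?nnegrE ?enorm_ge0//.
  exact: norm_le_enorm.
- apply: (controlled_by2 (K := 2) (HA m) (HB m)) => u c su c0 H1 H2 x.
  rewrite mulrDr (le_trans (ler_normD _ _))// mulrDl mul1r lerD//.
- apply: (controlled_by (K := `|c|) (HA m)) => u d su c0 H x.
  by rewrite mulrCA normrM ler_wpM2l.
- apply: (controlled_by (K := (\sum_(j < k) `|w ord0 j|) * k%:R) (HA m.+1)).
  move=> u d su c0 H x.
  rewrite mulrCA normrM.
  have S0 : 0 <= \sum_(j < k) `|w ord0 j| by apply: sumr_ge0.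
  apply: (@le_trans _ _ (((\sum_(j < k) `|w ord0 j|) * k%:R * `|x|) * `| `|x| ^+ m * A u x|)).
    apply: ler_wpM2r => //; rewrite (le_trans (dotR_le _ _))// -mulrA ler_wpM2l//.
    exact: enorm_le_norm.
  rewrite -mulrA ler_wpM2l ?mulr_ge0// (le_trans _ (H x))//.
  by rewrite exprS -mulrA [in leRHS]normrM normr_id.
Qed.

End RadialOperators.

(** * Radial lifts of Schwartz functions *)

Section ComplexBasics.
Context {R : realType}.
Implicit Types (z w : R[i]).

Lemma ReDM z w : (complex.Re (z + w) = complex.Re z + complex.Re w) *
  (complex.Im (z + w) = complex.Im z + complex.Im w) *
  (complex.Re (z * w) = complex.Re z * complex.Re w - complex.Im z * complex.Im w) *
  (complex.Im (z * w) = complex.Re z * complex.Im w + complex.Im z * complex.Re w).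
Proof. by case: z => a b; case: w => c d; rewrite /= (addrC (a * d)). Qed.

Lemma ReN z : (complex.Re (- z) = - complex.Re z) * (complex.Im (- z) = - complex.Im z).
Proof. by case: z. Qed.

Definition ReE := (ReDM, ReN).

Lemma eqC z w : complex.Re z = complex.Re w -> complex.Im z = complex.Im w -> z = w.
Proof. by case: z w => a b [c d] /= -> ->. Qed.

Lemma Re_le_normc z : `|complex.Re z| <= Normc.normc z.
Proof. by case: z => a b /=; rewrite -sqrtr_sqr ler_wsqrtr// lerDl sqr_ge0. Qed.

Lemma Im_le_normc z : `|complex.Im z| <= Normc.normc z.
Proof. by case: z => a b /=; rewrite -sqrtr_sqr ler_wsqrtr// lerDr sqr_ge0. Qed.

Lemma normc_le (a b : R) : Normc.normc (a +i* b) <= `|a| + `|b|.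
Proof.
rewrite /= -(@ler_pXn2r _ 2) ?nnegrE ?sqrtr_ge0 ?addr_ge0//.
rewrite sqr_sqrtr ?addr_ge0 ?sqr_ge0// sqrrD !real_normK ?num_real//.
by rewrite addrAC lerDl mulrn_wge0// mulr_ge0.
Qed.

End ComplexBasics.

Local Notation ReF f := (fun y => complex.Re (f y)).
Local Notation ImF f := (fun y => complex.Im (f y)).

Section LineBridge.
Context {R : realType}.
Implicit Types (f g : R -> R[i]) (u : R -> R).

Lemma iter_derive_nseq u n : iter_derive (nseq n (1 : R)) u = u^`(n).
Proof.
elim: n => // n IH; apply/funext => x; rewrite derive1nS derive1E.
by rewrite -[LHS]/('D_1 (iter_derive (nseq n (1 : R)) u) x) IH.
Qed.

Lemma iter_derive_line u (s : seq R) : smooth1 u ->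
  iter_derive s u = (fun x => (\prod_(v <- s) v) * u^`(size s) x).
Proof.
move=> su; elim: s => [|v s IH].
  by apply/funext => x; rewrite big_nil mul1r.
apply/funext => x; rewrite -[LHS]/('D_v (iter_derive s u) x) IH big_cons.
have d : derivable u^`(size s) x 1 by exact: su.
have dd : differentiable u^`(size s) x by apply/derivable1_diffP.
rewrite (@deriveZ _ _ _ (u^`(size s)) (\prod_(v <- s) v)); last exact: diff_derivable.
rewrite deriveE// -[v in 'd _ _ v]mulr1 -[v * 1]/(v *: (1 : R)) linearZ/=.
rewrite -derive1E'// /GRing.scale/=; ring.
Qed.

Lemma smooth_line f : smooth f <-> smooth1 (ReF f) /\ smooth1 (ImF f).
Proof.
split=> [sf|[s1 s2] s x].
  by split=> n x; have [] := sf (nseq n (1 : R)) x;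
    rewrite !iter_derive_nseq => /derivable1_diffP ? /derivable1_diffP ?.
rewrite !iter_derive_line//; split; apply: differentiableM => //;
  exact/derivable1_diffP.
Qed.

Lemma seminorm_weighted f m n c : seminorm_le (nseq n (1 : R), m) f c ->
  weighted_le (m, n) (ReF f) c /\ weighted_le (m, n) (ImF f) c.
Proof.
move=> H; split=> r /=; rewrite normrM normrX;
  apply: le_trans (H r); rewrite ler_wpM2l ?exprn_ge0// /iter_deriveC
  !iter_derive_nseq.
  exact: (Re_le_normc (_ +i* _)).
exact: (Im_le_normc (_ +i* _)).
Qed.

Lemma weighted_seminorm f (s : seq R) m c : smooth f ->
  weighted_le (m, size s) (ReF f) c -> weighted_le (m, size s) (ImF f) c ->
  seminorm_le (s, m) f (`|\prod_(v <- s) v| * (c + c)).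
Proof.
move=> /smooth_line[s1 s2] H1 H2 x; rewrite /iter_deriveC/= !iter_derive_line//.
apply: le_trans (_ : `|x| ^+ m * (`|(\prod_(v <- s) v) * (ReF f)^`(size s) x| +
   `|(\prod_(v <- s) v) * (ImF f)^`(size s) x|) <= _).
  by rewrite ler_wpM2l ?exprn_ge0//; exact: normc_le.
have := H1 x; have := H2 x; rewrite !normrM -mulrDr mulrCA normrX => h1 h2.
by rewrite ler_wpM2l// mulrDr lerD.
Qed.

Lemma weighted_le_trans w u c d : c <= d -> weighted_le w u c -> weighted_le w u d.
Proof. by move=> cd H r; exact: le_trans cd. Qed.

End LineBridge.

Section RadialLift.
Context {R : realType} {k : nat}.
Implicit Types (f g : R -> R[i]) (u : R -> R).
Local Notation E := 'rV[R]_k.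

Definition radial_lift n f (x : E) : R[i] :=
  rtower n (ReF f) (enorm x) +i* rtower n (ImF f) (enorm x).

Lemma radial_lift_smooth n f : smooth f -> smooth (radial_lift n f).
Proof.
move=> /smooth_line[s1 s2] s x; have o := @RadialTower R k n.
by split; [exact: (radial_op_smooth s x o s1)|exact: (radial_op_smooth s x o s2)].
Qed.

(** As [W] and [C] serve all profiles, this yields both that lifts of Schwartz
    functions are Schwartz functions and that lifting is continuous. *)
Lemma radial_lift_seminorm n (w : seq E * nat) :
  exists (W : seq (seq R * nat)) (C : R), 0 <= C /\
  forall f c, smooth f -> 0 <= c -> (forall w', w' \in W -> seminorm_le w' f c) ->
    seminorm_le w (radial_lift n f) (C * c).
Proof.
case: w => s m; have [B [oB HB]] := radial_op_iter_derive s (@RadialTower R k n).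
have [W [C [C0 HC]]] := radial_op_controlled m oB.
exists [seq (nseq w.2 (1 : R), w.1) | w <- W], (C + C).
split; first by rewrite addr_ge0.
move=> f c sf c0 Hc x; have [s1 s2] := (smooth_line f).1 sf.
have HR := HC (ReF f) c s1 c0; have HI := HC (ImF f) c s2 c0.
have K w : w \in W -> weighted_le w (ReF f) c /\ weighted_le w (ImF f) c.
  case: w => m' n' wW; apply: seminorm_weighted; apply: Hc.
  by apply/mapP; exists (m', n').
have {}HR := HR (fun w wW => (K w wW).1) x.
have {}HI := HI (fun w wW => (K w wW).2) x.
rewrite /iter_deriveC/= !HB//.
apply: le_trans (ler_wpM2l _ (normc_le _ _)) _; first by rewrite exprn_ge0.
move: HR HI; rewrite !normrM normrX normr_id mulrDr mulrDl => h1 h2.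
exact: lerD.
Qed.

Lemma finite_bound (W : seq (seq R * nat)) f : schwartz f ->
  exists c : R, 0 <= c /\ forall w, w \in W -> seminorm_le w f c.
Proof.
move=> [_ H]; elim: W => [|w W [c [c0 Hc]]]; first by exists 0.
have [d Hd] := H w; exists (Num.max c d); split; first by rewrite le_max c0.
move=> w'; rewrite inE => /predU1P[->|/Hc H'] x.
  by apply: le_trans (Hd x) _; rewrite le_max lexx orbT.
by apply: le_trans (H' x) _; rewrite le_max lexx.
Qed.

Lemma radial_lift_schwartz n f : schwartz f -> schwartz (radial_lift n f).
Proof.
move=> sf; split; first exact: radial_lift_smooth sf.1.
move=> w; have [W [C [C0 H]]] := radial_lift_seminorm n w.
have [c [c0 Hc]] := finite_bound W sf.
by exists (C * c); apply: H => //; exact: sf.1.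
Qed.

Lemma radial_lift_small n (W : seq (seq E * nat)) (e : R) : 0 < e ->
  exists (W' : seq (seq R * nat)) (d : R), 0 < d /\
  forall f, smooth f -> (forall w, w \in W' -> seminorm_le w f d) ->
  forall w, w \in W -> seminorm_le w (radial_lift n f) e.
Proof.
move=> e0; elim: W => [|w W [W1 [d1 [d10 H1]]]]; first by exists [::], 1.
have [W2 [C [C0 H2]]] := radial_lift_seminorm n w.
pose d2 := e / (C + 1); have C1 : 0 < C + 1 by rewrite ltr_wpDl.
have d20 : 0 < d2 by rewrite divr_gt0.
exists (W1 ++ W2), (Num.min d1 d2); split; first by rewrite lt_min d10.
move=> f sf Hf w'; rewrite inE => /predU1P[->|w'W].
  have := H2 f d2 sf (ltW d20).
  move=> H x; apply: le_trans (H _ x) _.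
    move=> v vW y; apply: le_trans (Hf v _ y) _; last by rewrite ge_min lexx orbT.
    by rewrite mem_cat vW orbT.
  by rewrite mulrCA ger_pMr// ler_pdivrMr// mul1r lerDl.
apply: H1 => // v vW y; apply: le_trans (Hf v _ y) _; last by rewrite ge_min lexx.
by rewrite mem_cat vW.
Qed.

End RadialLift.

(** * Test functions and locally finite sums *)

Section TestProfiles.
Context {R : realType}.
Implicit Types (f g : R -> R[i]) (u : R -> R).

Definition vanishes_beyond (M : R) u := forall r, M < `|r| -> u r = 0.

Lemma vanishes_derive1n M u n : vanishes_beyond M u -> vanishes_beyond M u^`(n).
Proof.
elim: n => // n IH /IH{}IH r Mr; rewrite derive1nS; apply: is_derive_derive1.
apply: (@near_eq_is_derive _ R R (cst (0 : R))).
have op : open [set z : R | M < `|z|].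
  apply: (@open_comp _ _ (fun z : R => `|z|) [set t | M < t]).
    by move=> z _; exact: norm_continuous.
  exact: open_gt.
have : \forall z \near r, M < `|z| by exact: open_nbhs_nbhs.
by apply: filterS => z /IH ->.
Qed.

(** Beyond [M] one may divide by [r], so vanishing passes up the tower. *)
Lemma vanishes_rtower M u n : 0 <= M -> smooth1 u -> vanishes_beyond M u ->
  vanishes_beyond M (rtower n u).
Proof.
move=> M0 su vu.
have nz (r : R) : M < `|r| -> r != 0.
  by move=> Mr; rewrite -normr_gt0 (le_lt_trans M0).
elim: n => [|n IH] r Mr; apply: (mulfI (nz r Mr)); rewrite mulr0.
  by rewrite odd_quotE// /odd_part !vu ?normrN// subr0.
have [s e] := rtower_even n su.
by rewrite rdivE//; exact: (vanishes_derive1n 1 IH).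
Qed.

Lemma test_vanishes f : test_function f ->
  exists M, 0 <= M /\ vanishes_beyond M (ReF f) /\ vanishes_beyond M (ImF f).
Proof.
move=> [_ /compact_bounded[M [_ HM]]].
have F r : `|M| + 1 < `|r| -> f r = 0.
  move=> Mr; apply/eqP/negPn/negP => fr.
  have : `|r| <= `|M| + 1.
    apply: HM; first by rewrite (le_lt_trans (ler_norm M))// ltrDl.
    exact: subset_closure.
  by rewrite leNgt Mr.
exists (`|M| + 1); split; first by rewrite addr_ge0.
by split=> r /F ->.
Qed.

Lemma vanishes_bounded M (u : R -> R) : continuous u -> vanishes_beyond M u ->
  exists c, forall r, `|u r| <= c.
Proof.
move=> cu vu.
have [K [_ HK]] : bounded_set (u @` `[- M, M]).
  by apply: compact_bounded; apply: continuous_compact;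
    [exact/continuous_subspaceT|exact: segment_compact].
exists (`|K| + 1) => r; have [rM|/vu ->] := leP `|r| M; last first.
  by rewrite normr0 addr_ge0.
apply: HK; first by rewrite (le_lt_trans (ler_norm K))// ltrDl.
by exists r => //; rewrite /= in_itv/= -ler_norml.
Qed.

Lemma test_schwartz f : test_function f -> schwartz f.
Proof.
move=> tf; split; first exact: tf.1.
have [M [M0 [v1 v2]]] := test_vanishes tf.
have /smooth_line[s1 s2] := tf.1.
have W u m n : smooth1 u -> vanishes_beyond M u -> exists c, 0 <= c /\ weighted_le (m, n) u c.
  move=> su vu; have [||c Hc] := @vanishes_bounded M (fun r => r ^+ m * u^`(n) r).
  - move=> r; apply: cvgM; first exact: exprn_continuous.
    exact: (smooth1_continuous su).
  - by move=> r /(vanishes_derive1n n vu) ->; rewrite mulr0.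
  by exists c; split=> //; exact: le_trans (normr_ge0 _) (Hc 0).
move=> [s m]; have [c1 [c10 H1]] := W _ m (size s) s1 v1.
have [c2 [c20 H2]] := W _ m (size s) s2 v2.
exists (`|\prod_(v <- s) v| * ((c1 + c2) + (c1 + c2))).
by apply: weighted_seminorm; [exact: tf.1|apply: weighted_le_trans H1|
  apply: weighted_le_trans H2]; rewrite ?lerDl ?lerDr.
Qed.

Lemma radial_lift_test (k n : nat) f : test_function f ->
  test_function (radial_lift n f : 'rV[R]_k -> R[i]).
Proof.
move=> tf; split; first exact: radial_lift_smooth tf.1.
have [M [M0 [v1 v2]]] := test_vanishes tf.
have /smooth_line[s1 s2] := tf.1.
have sub : supp (radial_lift n f : 'rV[R]_k -> R[i]) `<=` [set x | `|x| <= M].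
  have cl : closed [set x : 'rV[R]_k | `|x| <= M].
    apply: (@closed_comp _ _ (fun x : 'rV[R]_k => `|x|) [set r | r <= M]).
      by move=> x _; exact: norm_continuous.
    exact: closed_le.
  rewrite /supp [X in _ `<=` X](closure_id _).1//; apply: closure_subset => x /= fx.
  rewrite leNgt; apply/negP => Mx; move/negP: fx; apply.
  have Me : M < `|enorm x|.
    by rewrite ger0_norm ?enorm_ge0// (lt_le_trans Mx)// norm_le_enorm.
  by rewrite /radial_lift !(vanishes_rtower n M0 _ _ Me).
apply: bounded_closed_compact; last exact: closed_closure.
exists M; split; first exact: num_real.
by move=> N MN x /sub/= xM; exact: le_trans xM (ltW MN).
Qed.

End TestProfiles.

Section LocallyFiniteSums.

(** Every point has a neighbourhood that contains no other point of [A], and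
    finitely many of these neighbourhoods cover [K]. *)
Lemma locally_finite_compact (T : ptopologicalType) (A K : set T) :
  locally_finite A -> compact K -> finite_set (A `&` K).
Proof.
move=> lfA; rewrite compact_cover => cK.
have /choice[U HU] x : exists U : set T, nbhs x U /\ U `&` A `<=` [set x].
  apply: contrapT => nU; apply: (lfA x) => U xU.
  apply: contrapT => nE; apply: nU; exists U; split=> // y [Uy Ay].
  apply: contrapT => /= yx; apply: nE; exists y; split=> //.
  by apply/eqP.
have [|x Kx|D _ KD] := cK T K (fun x => interior (U x)).
- by move=> x _; exact: open_interior.
- by exists x => //; exact: (HU x).1.
apply: sub_finite_set (finite_fset D).
move=> y [Ay /KD[x /= xD /interior_subset Uy]].
by have /= -> := (HU x).2 y (conj Uy Ay).
Qed.

Lemma fsum_split0 (I : choiceType) (F : idomainType) (i0 : I) (A : set I) (f : I -> F) :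
  finite_set (A `&` [set x | f x != 0]) -> (~ A i0 -> f i0 = 0) ->
  \sum_(x \in A) f x = f i0 + \sum_(x \in A `\ i0) f x.
Proof.
move=> finA f0.
have E (B : set I) : \sum_(x \in B) f x = \sum_(x \in B `&` [set x | f x != 0]) f x.
  rewrite fsbig_supp; apply: eq_fsbigl; apply/seteqP; split=> x /= [Bx].
    by move=> /eqP.
  by move=> /eqP.
rewrite E [in RHS]E; have [fi0|fi0] := eqVneq (f i0) 0.
  rewrite fi0 add0r; apply: eq_fsbigl; apply/seteqP; split=> x /=.
    move=> [Ax fx]; split=> //; split=> // xi; move: fx.
    by rewrite xi fi0 eqxx.
  by move=> [[Ax _] fx].
rewrite (fsbigD1 i0)//; last first.
  by split=> //; apply: contrapT => /f0 H; rewrite H eqxx in fi0.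
congr (_ + _); apply: eq_fsbigl; apply/seteqP; split=> x /=; tauto.
Qed.

End LocallyFiniteSums.

(** * The functional on the line *)

Section Lift.
Context {R : realType} {k : nat}.
Implicit Types (f g : R -> R[i]) (u v w : R -> R).
Local Notation E := 'rV[R]_k.

(** Unlike [odd_quot] this makes sense for functions that are not known to be
    smooth, such as the Fourier transform of a test function. *)
Definition sym_quot u (r : R) : R :=
  if r == 0 then 2 * u^`() 0 else (u r - u (- r)) / r.

(** The function called [F_phi] in the introduction, for [phi = f]. *)
Definition sym_lift f (x : E) : R[i] :=
  sym_quot (ReF f) (enorm x) +i* sym_quot (ImF f) (enorm x).

Lemma sym_quotE u r : smooth1 u -> sym_quot u r = odd_quot u r.
Proof.
move=> su; rewrite /sym_quot; case: ifPn => [/eqP->|r0].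
  have [H _] := smooth1_odd_part su.
  rewrite /odd_quot avg0_0 -[(odd_part u)^`()]/((odd_part u)^`(1)) H.
  rewrite oppr0 expr1 mulN1r opprK /=; ring.
by apply: (mulfI r0); rewrite odd_quotE// mulrC divfK.
Qed.

Lemma sym_liftE f : smooth f -> sym_lift f = radial_lift 0 f.
Proof.
by move=> /smooth_line[s1 s2]; apply/funext => x; rewrite /sym_lift !sym_quotE.
Qed.

Lemma sym_lift_schwartz f : schwartz f -> schwartz (sym_lift f).
Proof.
by move=> sf; rewrite sym_liftE; [exact: radial_lift_schwartz|exact: sf.1].
Qed.

Lemma sym_quot_lin (a b : R) u v w r : smooth1 u -> smooth1 v -> smooth1 w ->
  sym_quot (fun x => a * u x + b * v x + w x) r =
  a * sym_quot u r + b * sym_quot v r + sym_quot w r.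
Proof.
move=> su sv sw; rewrite /sym_quot; case: ifPn => r0; last by field.
have [H1 s1] := smooth1_lin a b su sv; have [H2 s2] := smooth1_lin 1 1 s1 sw.
have -> : (fun x => a * u x + b * v x + w x) =
    (fun x => 1 * (a * u x + b * v x) + 1 * w x).
  by apply/funext => x; rewrite !mul1r.
have := congr1 (fun f : R -> R => f 0) (H2 1%N); rewrite H1 !derive1n1 /= => ->.
ring.
Qed.

Lemma sym_lift_lin (c : R[i]) f g x : smooth f -> smooth g ->
  sym_lift (fun y => c * f y + g y) x = c * sym_lift f x + sym_lift g x.
Proof.
move=> /smooth_line[f1 f2] /smooth_line[g1 g2]; case: c => a b.
have E1 : ReF (fun y => (a +i* b) * f y + g y) =
    (fun y => a * complex.Re (f y) + (- b) * complex.Im (f y) + complex.Re (g y)).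
  by apply/funext => y; rewrite !ReE mulNr.
have E2 : ImF (fun y => (a +i* b) * f y + g y) =
    (fun y => a * complex.Im (f y) + b * complex.Re (f y) + complex.Im (g y)).
  by apply/funext => y; rewrite !ReE.
rewrite /sym_lift E1 E2 !sym_quot_lin//.
by apply: eqC; rewrite !ReE /= ?mulNr.
Qed.

Lemma smooth_lin (c : R[i]) f g : smooth f -> smooth g ->
  smooth (fun y => c * f y + g y).
Proof.
move=> /smooth_line[f1 f2] /smooth_line[g1 g2]; case: c => a b.
apply/smooth_line; split.
  have [_ s1] := smooth1_lin a (- b) f1 f2; have [_ s2] := smooth1_lin 1 1 s1 g1.
  rewrite (_ : (fun y => _) = (fun x => 1 * (a * complex.Re (f x) + - b * complex.Im (f x)) +
           1 * complex.Re (g x)))//.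
  by apply/funext => y; rewrite !ReE mulNr !mul1r.
have [_ s1] := smooth1_lin a b f2 f1; have [_ s2] := smooth1_lin 1 1 s1 g2.
rewrite (_ : (fun y => _) = (fun x => 1 * (a * complex.Im (f x) + b * complex.Re (f x)) +
           1 * complex.Im (g x)))//.
by apply/funext => y; rewrite !ReE !mul1r.
Qed.

Lemma schwartz_functional_lift (T : (E -> R[i]) -> R[i]) :
  schwartz_functional T -> schwartz_functional (fun f => T (sym_lift f)).
Proof.
move=> [Tlin Tcont]; split.
  move=> c f g sf sg.
  have -> : sym_lift (fun x => c * f x + g x) = (fun x => c * sym_lift f x + sym_lift g x).
    by apply/funext => x; apply: sym_lift_lin; [exact: sf.1|exact: sg.1].
  by apply: Tlin; exact: sym_lift_schwartz.
move=> f sf e e0.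
have sF := sym_lift_schwartz sf.
have [W [d [d0 H]]] := Tcont _ sF e e0.
have [W' [d' [d'0 H']]] := @radial_lift_small R k 0 W d d0.
exists W', d'; split=> // g sg Hg; apply: H.
  exact: sym_lift_schwartz.
have sgf : smooth (fun x => (-1) * f x + g x) by apply: smooth_lin; [exact: sf.1|exact: sg.1].
have E1 : (fun x => g x - f x) = (fun x => (-1) * f x + g x).
  by apply/funext => x; rewrite mulN1r addrC.
move=> w wW; rewrite (_ : (fun x => _ - _) = radial_lift 0 (fun x => g x - f x)).
  by apply: H' => //; rewrite E1.
rewrite E1 -sym_liftE//; apply/funext => x.
by rewrite sym_lift_lin ?mulN1r 1?addrC//; [exact: sf.1|exact: sg.1].
Qed.

(** Test functions embed continuously in the Schwartz space. *)
Lemma temperate_restriction (T D : (R -> R[i]) -> R[i]) :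
  schwartz_functional T -> extends T D -> temperate D.
Proof.
move=> sT ext; split; last by exists T.
case: sT => Tlin Tcont; split.
  move=> c f g tf tg; rewrite -!ext//; first by apply: Tlin; exact: test_schwartz.
  split; first by apply: smooth_lin; [exact: tf.1|exact: tg.1].
  have [M1 [M10 [v1 w1]]] := test_vanishes tf.
  have [M2 [M20 [v2 w2]]] := test_vanishes tg.
  pose M := Num.max M1 M2.
  apply: (subclosed_compact _ (@segment_compact _ (- M) M)).
    exact: closed_closure.
  rewrite /supp [X in _ `<=` X](closure_id _).1; last exact: itv_closed.
  apply: closure_subset => x /= H; rewrite in_itv/= -ler_norml leNgt.
  apply/negP; rewrite gt_max => /andP[h1 h2]; move/negP: H; apply; apply/eqP.
  have -> : f x = 0 by apply: eqC; [exact: v1|exact: w1].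
  have -> : g x = 0 by apply: eqC; [exact: v2|exact: w2].
  by rewrite mulr0 addr0.
move=> K cK f [tf _] e e0.
have [W [d [d0 H]]] := Tcont f (test_schwartz tf) e e0.
exists W, d; split=> // g [tg _] Hg; rewrite -!ext//.
by apply: H => //; exact: test_schwartz.
Qed.

Lemma radial_lift0E f (x : E) : smooth f -> x != 0 ->
  radial_lift 0 f x = (f (enorm x) - f (- enorm x)) / (enorm x)%:C.
Proof.
move=> sf x0; rewrite -sym_liftE// /sym_lift /sym_quot enorm_eq0 (negbTE x0).
have e0 : enorm x != 0 by rewrite enorm_eq0.
have e0' : (enorm x)%:C != 0 :> R[i] by rewrite fmorph_eq0.
apply: (mulIf e0'); rewrite divfK//.
by apply: eqC; rewrite !ReE /=; field.
Qed.

Lemma dirac_sum_split0 n (A : set E) (a : E -> R[i]) f :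
  locally_finite A -> (forall x, ~ A x -> a x = 0) -> test_function f ->
  dirac_sum A a (radial_lift n f) = a 0 * radial_lift n f (0 : E) +
    \sum_(x \in A `\ 0) a x * radial_lift n f x.
Proof.
move=> lfA a0 tf; rewrite /dirac_sum (@fsum_split0 _ _ 0)//.
  have [_ cs] := @radial_lift_test R k n f tf.
  apply: sub_finite_set (locally_finite_compact lfA cs) => x [Ax /= fx].
  split=> //; apply: subset_closure => /=; apply: contraNneq fx => ->.
  by rewrite mulr0.
by move=> /a0 ->; rewrite mul0r.
Qed.

Lemma dirac_sum_lift (A : set E) (a : E -> R[i]) f :
  locally_finite A -> (forall x, ~ A x -> a x = 0) -> test_function f ->
  dirac_sum A a (sym_lift f) =
    - 2 * a 0 * delta 1 0 f +
    \sum_(l \in A `\ 0)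
      a l / (enorm l)%:C * (delta 0 (enorm l) f - delta 0 (- enorm l) f).
Proof.
move=> lfA a0 tf; have sf := tf.1.
rewrite sym_liftE// dirac_sum_split0//; congr (_ + _).
  rewrite -sym_liftE// /sym_lift enorm0 /sym_quot eqxx /delta expr1.
  by apply: eqC; rewrite !ReE /=; ring.
apply: eq_fsbigr => x; rewrite inE => -[Ax /= /eqP x0].
rewrite radial_lift0E// /delta !expr0 !mul1r mulrA mulrAC; congr (_ * _).
by apply: eqC; rewrite !ReE.
Qed.

End Lift.

(** * The quotients as combinations of derivatives *)

Section ExplicitFormula.
Context {R : realType}.
Implicit Types (f : R -> R[i]) (u : R -> R).

(** Up to sign, the coefficients of the Bessel polynomial of degree [m]. *)
Definition bessel_coef (m j : nat) : R :=
  (-1) ^+ (m + j) * ((m.*2 - j)`!)%:R / (j`! * (2 ^ (m - j) * (m - j)`!))%:R.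

Lemma bessel_coef0 m : bessel_coef m.+1 0 = - (m.*2.+1)%:R * bessel_coef m 0.
Proof.
rewrite /bessel_coef !addn0 !subn0 doubleS !factS fact0 !mul1n expnS.
rewrite !natrM exprS.
have p0 : (2 ^ m)%:R != 0 :> R by rewrite pnatr_eq0 expn_eq0.
have f0 : m`!%:R != 0 :> R by rewrite pnatr_eq0 -lt0n fact_gt0.
have h : (m.*2.+2)%:R = 2 * (m.+1)%:R :> R by rewrite -natrM mul2n doubleS.
have m0 : (m.+1)%:R != 0 :> R by rewrite pnatr_eq0.
by rewrite h; field; rewrite p0 f0 nat1r.
Qed.

Lemma bessel_coef_last m : bessel_coef m.+1 m.+1 = bessel_coef m m.
Proof.
rewrite /bessel_coef !subnn -!addnn !addnK addnS addSn !exprS !mulN1r opprK.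
rewrite !fact0 !expn0 !muln1.
have f0 n : n`!%:R != 0 :> R by rewrite pnatr_eq0 -lt0n fact_gt0.
by rewrite -!mulrA !divff ?f0.
Qed.

Lemma bessel_coefS m j : (j < m)%N -> bessel_coef m.+1 j.+1 =
  (j.+1%:R - (m.*2.+1)%:R) * bessel_coef m j.+1 + bessel_coef m j.
Proof.
move=> jm; have [n ->] : exists n, m = (n + j.+1)%N.
  by exists (m - j.+1)%N; rewrite subnK.
rewrite /bessel_coef.
have -> : ((n + j.+1).+1 - j.+1 = n.+1)%N by rewrite -addSn addnK.
have -> : (n + j.+1 - j.+1 = n)%N by rewrite addnK.
have -> : (n + j.+1 - j = n.+1)%N by rewrite addnS -addSn addnK.
have -> : ((n + j.+1).+1.*2 - j.+1 = (n.*2 + j).+3)%N.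
  by rewrite -!addnn; lia.
have -> : ((n + j.+1).*2 - j.+1 = (n.*2 + j).+1)%N by rewrite -!addnn; lia.
have -> : ((n + j.+1).*2 - j = (n.*2 + j).+2)%N by rewrite -!addnn; lia.
have s1 : (-1) ^+ ((n + j.+1).+1 + j.+1) = - ((-1) ^+ (n + j.+1 + j.+1)) :> R.
  by rewrite addSn exprS mulN1r.
have s2 : (-1) ^+ (n + j.+1 + j.+1) = - ((-1) ^+ (n + j.+1 + j)) :> R.
  by rewrite addnS exprS mulN1r.
rewrite s1 s2 opprK; set s := (-1) ^+ _.
rewrite !factS expnS !natrM.
have p0 : (2 ^ n)%:R != 0 :> R by rewrite pnatr_eq0 expn_eq0.
have f0 i : i`!%:R != 0 :> R by rewrite pnatr_eq0 -lt0n fact_gt0.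
have S0 i : i.+1%:R != 0 :> R by rewrite pnatr_eq0.
have e1 : (n + j.+1).*2.+1%:R = 2 * n%:R + 2 * j%:R + 3 :> R.
  by rewrite -addnn -natr1 !natrD -natr1; ring.
have e2 : (n.*2 + j).+3%:R = 2 * n%:R + j%:R + 3 :> R.
  by rewrite -!natr1 natrD -addnn natrD; ring.
have e3 : (n.*2 + j).+2%:R = 2 * n%:R + j%:R + 2 :> R.
  by rewrite -!natr1 natrD -addnn natrD; ring.
have e4 : n.+1%:R = n%:R + 1 :> R by rewrite natr1.
have e5 : j.+1%:R = j%:R + 1 :> R by rewrite natr1.
have n0 := S0 n; have j0 := S0 j.
move: n0 j0; rewrite e1 e2 e3 e4 e5 => n0 j0.
by field; rewrite p0 n0 j0 !f0.
Qed.

Lemma is_derive_expr n (r : R) :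
  is_derive r 1 (fun r => r ^+ n) (n%:R * r ^+ n.-1).
Proof.
case: n => [|n]; first by rewrite mul0r; exact: is_derive_cst.
have -> : (fun r : R => r ^+ n.+1) = (id : R -> R) ^+ n.+1.
  by apply/funext => x; rewrite fctE.
by apply: is_derive_eq; rewrite /GRing.scale/= mulr1 -mulr_natl.
Qed.

Local Notation psi u := (odd_part u).

(** Let [y_m] be the [m]-th function of the tower.  Differentiating the identity
    for [m], multiplying by [r] and using [y_m' = r y_(m+1)] gives the identity
    for [m + 1], and the coefficients obey the recurrence of Bessel
    polynomials. *)
Lemma rtower_formula m u r : smooth1 u ->
  r ^+ m.*2.+1 * rtower m u r =
  \sum_(j < m.+1) bessel_coef m j * (r ^+ j * (psi u)^`(j) r).
Proof.
move=> su; have [_ so] := smooth1_odd_part su.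
elim: m r => [|m IH] r.
  rewrite big_ord1 /= expr1 expr0 mul1r /bessel_coef /= expr0 fact0.
  by rewrite divr1 !mul1r; exact: odd_quotE.
have [sy ey] := rtower_even m su.
pose S (r : R) := \sum_(j < m.+1) bessel_coef m j * (r ^+ j * (psi u)^`(j) r).
have yE : (fun r => r ^+ m.*2.+1 * rtower m u r) = S by apply/funext.
have D1 : is_derive r 1 (fun r => r ^+ m.*2.+1 * rtower m u r)
    (m.*2.+1%:R * r ^+ m.*2 * rtower m u r + r ^+ m.*2.+1 * (r * rtower m.+1 u r)).
  have ? := smooth1_is_derive1 r sy.
  have ? := is_derive_expr m.*2.+1 r.
  rewrite /= (rdivE r sy ey); apply: is_derive_eq.
  by rewrite /GRing.scale/=; ring.
have D2 : is_derive r 1 S (\sum_(j < m.+1) bessel_coef m j *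
    (j%:R * r ^+ j.-1 * (psi u)^`(j) r + r ^+ j * (psi u)^`(j.+1) r)).
  have -> : S = \sum_(j < m.+1) (fun r => bessel_coef m j *: (r ^+ j * (psi u)^`(j) r)).
    by apply/funext => x; rewrite fct_sumE.
  apply: is_derive_eq.
    apply: is_derive_sum => j; apply: is_deriveZ.
    apply: is_deriveM; first exact: is_derive_expr.
    exact: (smooth1_is_derive j r so).
  by apply: eq_bigr => j _; rewrite /GRing.scale/=; congr (_ * _); ring.
move: D1; rewrite yE => D1.
have := is_derive_derive1 D1; rewrite (is_derive_derive1 D2) => /esym D.
have -> : r ^+ m.+1.*2.+1 * rtower m.+1 u r =
    r * (m.*2.+1%:R * r ^+ m.*2 * rtower m u r + r ^+ m.*2.+1 * (r * rtower m.+1 u r))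
    - m.*2.+1%:R * (r ^+ m.*2.+1 * rtower m u r).
  by rewrite doubleS !exprS; ring.
rewrite D IH mulr_sumr mulr_sumr.
pose T j := r ^+ j * (psi u)^`(j) r.
rewrite (eq_bigr (fun j : 'I_m.+1 => bessel_coef m j * (j%:R * T j + T j.+1))); last first.
  move=> j _; rewrite /T exprS; case: (nat_of_ord j) => [|i] /=; first by ring.
  by rewrite exprS; ring.
rewrite -sumrB.
rewrite (eq_bigr (fun j : 'I_m.+1 => (j%:R - m.*2.+1%:R) * bessel_coef m j * T j +
    bessel_coef m j * T j.+1)); last by move=> j _; rewrite -/(T j); ring.
rewrite big_split/= big_ord_recl [X in _ + X]big_ord_recr/=.
rewrite -/(T 0%N) [RHS]big_ord_recl [X in _ = _ + X]big_ord_recr/=.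
rewrite bessel_coef0 /bump /= !add1n bessel_coef_last.
rewrite (eq_bigr (fun i : 'I_m => (i.+1%:R - m.*2.+1%:R) * bessel_coef m i.+1 * T i.+1))//.
rewrite [in RHS](eq_bigr (fun i : 'I_m => (i.+1%:R - m.*2.+1%:R) *
    bessel_coef m i.+1 * T i.+1 + bessel_coef m i * T i.+1)); last first.
  by move=> i _; rewrite bessel_coefS// mulrDl.
by rewrite big_split/= sub0r -/(T 0%N) -/(T m.+1) !addrA.
Qed.

Lemma mulid_derive0 (y v : R -> R) n : smooth1 y -> (forall r, r * y r = v r) ->
  n.+1%:R * y^`(n) 0 = v^`(n.+1) 0.
Proof.
move=> sy E; have [H _] := smooth1_mulid sy.
have := congr1 (fun f : R -> R => f 0) (H n.+1).
rewrite /= mul0r add0r => <-.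
by congr (derive1 (iter n _ _) _); apply/funext => r; rewrite E.
Qed.

Lemma double_factSS n : double_fact n.+2 = (n.+2 * double_fact n)%N.
Proof. by []. Qed.

(** The relations [r y_0 = psi] and [r y_(m+1) = y_m'], differentiated at the
    origin, give [(i+1) y_(m+1)^(i)(0) = y_m^(i+2)(0)]: the odd factors [2n+1]
    accumulate to a double factorial. *)
Lemma rtower_at0 m n u : smooth1 u ->
  (double_fact (m + n).*2.+1)%:R * (rtower m u)^`(n.*2) 0 =
  (double_fact n.*2.-1)%:R * (psi u)^`((m + n).*2.+1) 0.
Proof.
move=> su.
have df i : (double_fact i.*2.+1 = i.*2.+1 * double_fact i.*2.-1)%N by case: i.
elim: m n => [|m IH] n.
  have [so _] := odd_quot_even su.
  rewrite add0n -(mulid_derive0 n.*2 so (fun r => odd_quotE r su)).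
  by rewrite df natrM; ring.
have [sy ey] := rtower_even m su.
have [sz _] := rtower_even m.+1 su.
have z : n.*2.+1%:R * (rtower m.+1 u)^`(n.*2) 0 = (rtower m u)^`(n.+1.*2) 0.
  rewrite (@mulid_derive0 _ (rtower m u)^`())// ?derive1nSr//.
  by move=> r; exact: rdivE.
have n0 : n.*2.+1%:R != 0 :> R by rewrite pnatr_eq0.
apply: (mulfI n0); rewrite mulrCA z addSnnS IH (_ : n.+1.*2.-1 = n.*2.+1)%N// df natrM; ring.
Qed.

End ExplicitFormula.

Section FourierSide.
Context {R : realType} {k : nat}.
Hypotheses (k_ge3 : (3 <= k)%N) (k_odd : odd k).
Implicit Types (f : R -> R[i]) (u : R -> R).
Local Notation m := ((k - 3) %/ 2)%N.
Local Notation E := 'rV[R]_k.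

Let kE : k = m.*2.+3.
Proof. by have := k_ge3; have := k_odd; rewrite -!addnn; lia. Qed.

Let scaled_parts (e c x y : R) :
  complex.Re (e%:C * (c%:C * (x +i* y))) = e * (c * x) /\
  complex.Im (e%:C * (c%:C * (x +i* y))) = e * (c * y).
Proof. by rewrite !ReE /=; split; ring. Qed.

Lemma double_fact_double n : double_fact n.*2 = (2 ^ n * n`!)%N.
Proof.
elim: n => // n IH; rewrite doubleS double_factSS IH expnS factS -doubleS -mul2n.
ring.
Qed.

Lemma betajkE j : (j <= m)%N ->
  betajk j k = (-1) ^+ m * bessel_coef m j * (1 / (2 * pi)) ^+ m :> R.
Proof.
move=> jm; rewrite /betajk /bessel_coef.
have -> : (k - j - 3 = m.*2 - j)%N by rewrite {1}kE -!addnn; lia.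
have -> : (k - 2 * j - 3 = (m - j).*2)%N by rewrite {1}kE -!addnn; lia.
rewrite double_fact_double exprD; congr (_ * _); rewrite !mulrA.
by rewrite -expr2 sqrr_sign mul1r.
Qed.

Lemma rtower_betajk u r : smooth1 u ->
  r ^+ (k - 2) * ((- (1 / (2 * pi))) ^+ m * rtower m u r) =
  \sum_(0 <= j < m.+1) betajk j k * r ^+ j * (odd_part u)^`(j) r.
Proof.
move=> su; have -> : (k - 2 = m.*2.+1)%N by rewrite {1}kE -!addnn; lia.
rewrite mulrCA rtower_formula// big_mkord mulr_sumr; apply: eq_bigr => j _.
rewrite betajkE; last by rewrite -ltnS ltn_ord.
by rewrite [in LHS]exprNn; ring.
Qed.

Lemma rtower_alphak u : smooth1 u ->
  (- (1 / (2 * pi))) ^+ m * rtower m u 0 = 2 * alphak k * u^`(k - 2) 0.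
Proof.
move=> su; have sg : (-1) ^+ m.*2.+1 = -1 :> R.
  by rewrite -signr_odd /= odd_double.
rewrite /alphak; have -> : (k - 2 = m.*2.+1)%N by rewrite {1}kE -!addnn; lia.
have := rtower_at0 m 0 su; have [-> _] := smooth1_odd_part su.
rewrite addn0 sg oppr0 mulN1r opprK.
move: (u^`(_) 0 : R) => t H.
have d0 i : (0 < double_fact i)%N.
  by elim/ltn_ind: i => -[|[|i]]// IH; rewrite double_factSS muln_gt0 IH.
have df0 : (double_fact m.*2.+1)%:R != 0 :> R by rewrite pnatr_eq0 -lt0n.
have -> : rtower m u 0 = (t + t) / (double_fact m.*2.+1)%:R.
  by apply: (mulfI df0); rewrite [LHS]H mulrCA divff// mul1r mulr1.
rewrite (exprNn (1 / (2 * pi))); move: (_%:R^-1) => d; ring.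
Qed.

Lemma dirac_sum_hat (S : set E) (b : E -> R[i]) f :
  locally_finite S -> (forall s, ~ S s -> b s = 0) -> test_function f ->
  - 'i%C * ((- (1 / (2 * pi))) ^+ m)%:C * dirac_sum S b (radial_lift m f) =
    2 * 'i%C * b 0 * (alphak k)%:C * delta (k - 2) 0 f -
    'i%C * \sum_(s \in S `\ 0)
      b s / (enorm s ^+ (k - 2))%:C *
      \sum_(0 <= j < m.+1)
        (betajk j k * enorm s ^+ j)%:C *
        ((-1) ^+ j * delta j (enorm s) f - delta j (- enorm s) f).
Proof.
move=> lfS b0 tf; have /smooth_line[s1 s2] := tf.1.
rewrite dirac_sum_split0// mulrDr; congr (_ + _).
  rewrite /radial_lift enorm0 /delta.
  have -> : (-1) ^+ (k - 2) = -1 :> R[i].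
    by rewrite -signr_odd oddB ?k_odd//; exact: leq_trans k_ge3.
  have h1 := rtower_alphak s1; have h2 := rtower_alphak s2.
  set c := _ ^+ m in h1 h2 *.
  set x := rtower m (ReF f) 0 in h1 *; set y := rtower m (ImF f) 0 in h2 *.
  transitivity (- 'i%C * b 0 * ((c * x) +i* (c * y))).
    by apply: eqC; rewrite !ReE /=; ring.
  transitivity (- 'i%C * b 0 * ((2 * alphak k * (ReF f)^`(k - 2) 0) +i*
      (2 * alphak k * (ImF f)^`(k - 2) 0))).
    by congr (_ * (_ +i* _)).
  move: ((ReF f)^`(k - 2) 0 : R) ((ImF f)^`(k - 2) 0 : R) (alphak k : R) (b 0).
  move=> p q al [b1 b2].
  by apply: eqC; rewrite !ReE /=; ring.
rewrite -[RHS]mulNr -[LHS]mulrA; congr (_ * _); rewrite mulr_fsumr.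
apply: eq_fsbigr => x; rewrite inE => -[Sx /= /eqP x0].
have e0 : enorm x ^+ (k - 2) != 0 by rewrite expf_neq0// enorm_eq0.
have e0' : (enorm x ^+ (k - 2))%:C != 0 :> R[i] by rewrite fmorph_eq0.
rewrite mulrCA mulrAC -mulrA; congr (_ * _).
apply: (mulfI e0'); rewrite [RHS]mulrC mulfVK//.
have D j : (-1) ^+ j * delta j (enorm x) f - delta j (- enorm x) f =
    (odd_part (ReF f))^`(j) (enorm x) +i* (odd_part (ImF f))^`(j) (enorm x).
  have [-> _] := smooth1_odd_part s1; have [-> _] := smooth1_odd_part s2.
  rewrite /delta mulrA -expr2 sqrr_sign mul1r.
  have -> : (-1) ^+ j = ((-1) ^+ j)%:C :> R[i] by rewrite rmorphXn rmorphN1.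
  by apply: eqC; rewrite !ReE /=; ring.
under [RHS]eq_bigr do rewrite D.
have H1 := rtower_betajk (enorm x) s1; have H2 := rtower_betajk (enorm x) s2.
apply: (@eqC R).
  rewrite (raddf_sum (@complex.Re R : {additive R[i] -> R})).
  rewrite [in RHS](eq_bigr (fun j =>
      betajk j k * enorm x ^+ j * (odd_part (ReF f))^`(j) (enorm x))).
    by apply: etrans H1; apply: (scaled_parts _ _ _ _).1.
  by move=> j _ /=; rewrite mul0r subr0.
rewrite (raddf_sum (@complex.Im R : {additive R[i] -> R})).
rewrite [in RHS](eq_bigr (fun j =>
      betajk j k * enorm x ^+ j * (odd_part (ImF f))^`(j) (enorm x))).
  by apply: etrans H2; apply: (scaled_parts _ _ _ _).2.
by move=> j _ /=; rewrite mul0r addr0.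
Qed.

End FourierSide.

(** * Gaussian integrals on the line *)

Section RealIntegrable.
Context {d} {T : measurableType d} {R : realType} {mu : {measure set T -> \bar R}}.
Implicit Types (f g : T -> R).

Definition Rintegrable (nu : set T -> \bar R) f :=
  nu.-integrable setT (EFin \o f).

Lemma Rintegrable_le f g : measurable_fun setT f -> (forall x, `|f x| <= g x) ->
  Rintegrable mu g -> Rintegrable mu f.
Proof.
move=> mf fg ig; apply: (le_integrable measurableT _ _ ig).
  exact/measurable_EFinP.
by move=> x _; rewrite /= lee_fin (le_trans (fg x))// ler_norm.
Qed.

Lemma RintegrableD f g : Rintegrable mu f -> Rintegrable mu g ->
  Rintegrable mu (fun x => f x + g x).
Proof. by move=> hf hg; exact: (integrableD measurableT hf hg). Qed.

Lemma RintegrableZ c f : Rintegrable mu f -> Rintegrable mu (fun x => c * f x).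
Proof. by move=> hf; exact: (integrableZl measurableT c hf). Qed.

Lemma RintegrableB f g : Rintegrable mu f -> Rintegrable mu g ->
  Rintegrable mu (fun x => f x - g x).
Proof. by move=> hf hg; exact: (integrableB measurableT hf hg). Qed.

Lemma Rintegrable_measurable f : Rintegrable mu f -> measurable_fun setT f.
Proof. by move=> /(measurable_int mu) /measurable_EFinP. Qed.

Lemma Rintegral_norm_le f g : measurable_fun setT f -> (forall x, `|f x| <= g x) ->
  Rintegrable mu g -> `|\int[mu]_x f x| <= \int[mu]_x g x.
Proof.
move=> mf fg ig; have if_ := Rintegrable_le mf fg ig.
apply: le_trans (le_normr_Rintegral measurableT if_) _.
apply: le_Rintegral => //.
have -> : EFin \o (fun t => `|f t|) = abse \o (EFin \o f) by [].
exact: integrable_abse.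
Qed.

End RealIntegrable.

Section Gaussian.
Context {R : realType}.
Implicit Types (f g : R -> R) (t w x : R).
Local Notation leb := (@lebesgue_measure R).
Local Notation Lint := (Rintegrable leb).

Definition gauss t x : R := expR (- (t * x ^+ 2)).

Lemma gauss_gt0 t x : 0 < gauss t x. Proof. exact: expR_gt0. Qed.

Lemma gauss_ge0 t x : 0 <= gauss t x. Proof. exact: expR_ge0. Qed.

Lemma gaussN t x : gauss t (- x) = gauss t x.
Proof. by rewrite /gauss sqrrN. Qed.

Lemma gauss_derive t x : is_derive x 1 (gauss t) (- (2 * t * x * gauss t x)).
Proof.
have ? : is_derive x 1 (fun x => - (t * x ^+ 2)) (- (2 * t * x)).
  have ? := is_derive_expr 2 x.
  by apply: is_derive_eq; rewrite /GRing.scale/=; ring.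
apply: is_derive_eq; rewrite /GRing.scale/= /gauss; ring.
Qed.

Lemma derive_continuous f (f' : R -> R) :
  (forall x, is_derive x 1 f (f' x)) -> continuous f.
Proof.
by move=> H x; apply/differentiable_continuous/derivable1_diffP; case: (H x).
Qed.

Lemma gauss_continuous t : continuous (gauss t).
Proof. exact: (derive_continuous (gauss_derive t)). Qed.

Lemma integral_gauss t : 0 < t ->
  Lint (gauss t) /\ \int[leb]_x gauss t x = Num.sqrt (pi / t).
Proof.
move=> t0; pose s := Num.sqrt ((2 * t)^-1).
have t2 : 0 < (2 * t)^-1 by rewrite invr_gt0 mulr_gt0.
have s0 : s != 0 by rewrite sqrtr_eq0 -ltNge.
have s2 : s ^+ 2 = (2 * t)^-1 by rewrite sqr_sqrtr// ltW.
have pt : 0 < pi / t by rewrite divr_gt0// pi_gt0.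
have p0 : Num.sqrt (pi / t) != 0 by rewrite sqrtr_eq0 -ltNge.
have E x : gauss t x = Num.sqrt (pi / t) * normal_pdf 0 s x.
  rewrite normal_pdfE// /normal_peak /normal_fun subr0 s2 mulrA.
  have -> : (2 * t)^-1 * pi *+ 2 = pi / t.
    by rewrite -mulr_natl; field; rewrite gt_eqF.
  rewrite divff// mul1r /gauss; congr expR.
  by rewrite -mulr_natl; field; rewrite gt_eqF.
have i1 : Lint (normal_pdf 0 s) by exact: integrable_normal_pdf.
have -> : gauss t = (fun x => Num.sqrt (pi / t) * normal_pdf 0 s x).
  exact/funext.
split; first exact: RintegrableZ.
by rewrite RintegralZl// /Rintegral integral_normal_pdf mulr1.
Qed.

(** Half of the exponent absorbs the factor [x]. *)
Lemma gauss_mulid t x : 0 < t -> `|x * gauss t x| <= (1 + 2 / t) * gauss (t / 2) x.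
Proof.
move=> t0; rewrite normrM (ger0_norm (gauss_ge0 _ _)).
have -> : gauss t x = gauss (t / 2) x * gauss (t / 2) x.
  by rewrite /gauss -expRD; congr expR; field.
rewrite mulrA ler_wpM2r ?gauss_ge0//.
have g1 : gauss (t / 2) x <= 1.
  by rewrite -[leRHS]expR0 ler_expR oppr_le0 mulr_ge0 ?sqr_ge0// divr_ge0// ltW.
have sq : `|x| <= 1 + x ^+ 2.
  rewrite -real_normK ?num_real//; have := sqr_ge0 (`|x| - 2^-1); nra.
have sg : x ^+ 2 * gauss (t / 2) x <= 2 / t.
  rewrite /gauss expRN ler_pdivrMr ?expR_gt0//.
  have := expR_ge1Dx (t / 2 * x ^+ 2); set e := expR _ => he.
  have : t / 2 * x ^+ 2 <= e by lra.
  rewrite -(ler_pM2l (_ : 0 < 2 / t)); last by rewrite divr_gt0.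
  by rewrite (_ : 2 / t * (t / 2 * x ^+ 2) = x ^+ 2)//; field; rewrite gt_eqF.
apply: (@le_trans _ _ ((1 + x ^+ 2) * gauss (t / 2) x)).
  by rewrite ler_wpM2r// gauss_ge0.
by rewrite mulrDl mul1r lerD.
Qed.

(** A decay condition under which continuous functions are integrable, and which
    multiplication by [x] preserves, as differentiating a cosine or sine
    transform requires. *)
Definition gauss_bounded f := exists C t, [/\ 0 <= C, 0 < t &
  forall x, `|f x| <= C * gauss t x].

Lemma gauss_boundedM f : gauss_bounded f -> gauss_bounded (fun x => x * f x).
Proof.
move=> [C [t [C0 t0 H]]]; exists (C * (1 + 2 / t)), (t / 2).
have t2 : 0 <= 2 / t by rewrite divr_ge0// ltW.
split; [by rewrite mulr_ge0// addr_ge0|by rewrite divr_gt0|] => x.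
rewrite normrM; apply: (@le_trans _ _ (C * `|x * gauss t x|)).
  by rewrite normrM mulrCA ler_wpM2l// (ger0_norm (gauss_ge0 _ _)).
by rewrite -mulrA ler_wpM2l// gauss_mulid.
Qed.

Lemma gauss_bounded_le f g : gauss_bounded g -> (forall x, `|f x| <= `|g x|) ->
  gauss_bounded f.
Proof.
move=> [C [t [C0 t0 H]]] fg; exists C, t; split=> // x.
exact: le_trans (fg x) _.
Qed.

Lemma gauss_boundedZ c f : gauss_bounded f -> gauss_bounded (fun x => c * f x).
Proof.
move=> [C [t [C0 t0 H]]]; exists (`|c| * C), t; split=> // [|x].
  by rewrite mulr_ge0.
by rewrite normrM -mulrA ler_wpM2l.
Qed.

Lemma gauss_boundedD f g : gauss_bounded f -> gauss_bounded g ->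
  gauss_bounded (fun x => f x + g x).
Proof.
move=> [C [t [C0 t0 H]]] [D [s [D0 s0 K]]]; exists (C + D), (Num.min t s).
split; [by rewrite addr_ge0|by rewrite lt_min t0|] => x.
rewrite (le_trans (ler_normD _ _))// mulrDl lerD//.
  apply: (le_trans (H x)); rewrite ler_wpM2l// ler_expR lerN2 ler_wpM2r ?sqr_ge0//.
  by rewrite ge_min lexx.
apply: (le_trans (K x)); rewrite ler_wpM2l// ler_expR lerN2 ler_wpM2r ?sqr_ge0//.
by rewrite ge_min lexx orbT.
Qed.

Lemma gauss_gauss_bounded t : 0 < t -> gauss_bounded (gauss t).
Proof.
move=> t0; exists 1, t; split=> // x.
by rewrite mul1r ger0_norm// gauss_ge0.
Qed.

Lemma gauss_bounded_integrable f : continuous f -> gauss_bounded f -> Lint f.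
Proof.
move=> cf [C [t [C0 t0 H]]].
apply: (@Rintegrable_le _ (measurableTypeR R) _ leb f
  (fun x => C * gauss t x)) => //.
  exact: continuous_measurable_fun.
by apply: RintegrableZ; case: (integral_gauss t0).
Qed.

Lemma gauss_cvg0 t : 0 < t -> gauss t (n.+1%:R) @[n --> \oo] --> 0.
Proof.
move=> t0; apply: (@squeeze_cvgr _ _ _ _ (cst 0) (fun n => t^-1 * n.+1%:R^-1)).
- near=> n; rewrite gauss_ge0/= /gauss expRN -invfM lef_pV2 ?posrE ?expR_gt0//; last first.
    by rewrite mulr_gt0.
  have := expR_ge1Dx (t * n.+1%:R ^+ 2); set e := expR _ => he.
  apply: le_trans (_ : t * n.+1%:R ^+ 2 <= _); last by lra.
  by rewrite ler_wpM2l ?(ltW t0)// expr2 ler_peMr// ler1n.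
- exact: cvg_cst.
- rewrite -(mulr0 t^-1); apply: cvgM; [exact: cvg_cst|exact: cvg_harmonic].
Unshelve. all: by end_near. Qed.

(** The boundary terms of the fundamental theorem of calculus vanish at
    infinity. *)
Lemma Rintegral_derive_eq0 (F f : R -> R) : (forall x, is_derive x 1 F (f x)) ->
  continuous f -> gauss_bounded F -> gauss_bounded f -> \int[leb]_x f x = 0.
Proof.
move=> dF cf [C [t [C0 t0 HF]]] gf; have if_ := gauss_bounded_integrable cf gf.
pose I n : set (measurableTypeR R) := `[- n.+1%:R, n.+1%:R]%classic.
have mI n : measurable (I n) by exact: measurable_itv.
have FTC n : (\int[leb]_x ((f \_ (I n)) x)%:E = (F n.+1%:R)%:E - (F (- n.+1%:R))%:E)%E.
  have cF : continuous F by exact: derive_continuous dF.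
  rewrite -(@continuous_FTC2 _ f F); first last.
  - by move=> x _; apply: is_derive_derive1.
  - split; first by move=> x _; case: (dF x).
      by apply: cvg_at_right_filter; exact: cF.
    by apply: cvg_at_left_filter; exact: cF.
  - exact: continuous_subspaceT.
  - by rewrite (@lt_trans _ _ 0)// ?oppr_lt0.
  by rewrite [RHS]integral_mkcond restrict_EFin.
have L1 : (\int[leb]_x ((f \_ (I n)) x)%:E @[n --> \oo] --> \int[leb]_x (f x)%:E)%E.
  apply: (@dominated_cvg _ _ _ leb _ measurableT
    (fun n x => ((f \_ (I n)) x)%:E) _ (fun x => `|f x|%:E)).
  - move=> n; apply/measurable_EFinP/(measurable_restrictT _ _).1 => //.
    apply: measurable_funTS; exact: continuous_measurable_fun.
  - move=> x _; apply: cvg_EFin; first exact: nearW.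
    apply: (@cvg_trans _ ((fun=> f x) @ \oo)); last exact: cvg_cst.
    apply: near_eq_cvg; near=> n; rewrite /= patchE ifT//.
    rewrite inE /I /= in_itv/= -ler_norml.
    near: n; exists (Num.truncn `|x|) => // n /= hn.
    by rewrite (le_trans (ltW (truncnS_gt _)))// ler_nat.
  - by [].
  - have -> : (fun x => `|f x|%:E) = abse \o (EFin \o f) by [].
    exact: integrable_abse.
  - move=> n x _; rewrite lee_fin patchE; case: ifP => // _.
    by rewrite normr0.
have L2 : ((F n.+1%:R)%:E - (F (- n.+1%:R))%:E @[n --> \oo] --> 0)%E.
  apply: cvg_EFin; first exact: nearW.
  rewrite /=; apply/norm_cvg0P.
  apply: (@squeeze_cvgr _ _ _ _ (cst 0) (fun n => 2 * C * gauss t n.+1%:R)).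
  - near=> n; rewrite normr_ge0/= (le_trans (ler_normB _ _))//.
    have := HF (- n.+1%:R); have := HF n.+1%:R.
    rewrite gaussN; lra.
  - exact: cvg_cst.
  - rewrite -(mulr0 (2 * C)); apply: cvgM; [exact: cvg_cst|exact: gauss_cvg0].
have := L2; under eq_fun do rewrite -FTC.
move=> L3; have := cvg_unique _ L1 L3; rewrite /Rintegral => -> //.
Unshelve. all: by end_near. Qed.

End Gaussian.

Section GaussianFourier.
Context {R : realType}.
Implicit Types (f g : R -> R) (t v w x : R).
Local Notation leb := (@lebesgue_measure R).
Local Notation Lint := (Rintegrable leb).

Lemma cos_scale_derive w x : is_derive x 1 (fun x => cos (w * x)) (- (w * sin (w * x))).
Proof.
have ? : is_derive x 1 (fun x => w * x) w.
  by apply: is_derive_eq; rewrite /GRing.scale/= mulr1.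
by apply: is_derive_eq; rewrite /GRing.scale/=; ring.
Qed.

Lemma sin_scale_derive w x : is_derive x 1 (fun x => sin (w * x)) (w * cos (w * x)).
Proof.
have ? : is_derive x 1 (fun x => w * x) w.
  by apply: is_derive_eq; rewrite /GRing.scale/= mulr1.
by apply: is_derive_eq; rewrite /GRing.scale/=; ring.
Qed.

Lemma cos_scale_continuous w : continuous (fun x => cos (w * x)).
Proof. exact: (derive_continuous (cos_scale_derive w)). Qed.

Lemma sin_scale_continuous w : continuous (fun x => sin (w * x)).
Proof. exact: (derive_continuous (sin_scale_derive w)). Qed.

Lemma norm_cos_le1 x : `|cos x| <= 1.
Proof. by rewrite ler_norml cos_geN1 cos_le1. Qed.

Lemma norm_sin_le1 x : `|sin x| <= 1.
Proof. by rewrite ler_norml sin_geN1 sin_le1. Qed.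

Lemma gauss_bounded_cos g w : gauss_bounded g -> gauss_bounded (fun x => g x * cos (w * x)).
Proof.
move=> gg; apply: gauss_bounded_le gg _ => x.
by rewrite normrM ler_piMr// norm_cos_le1.
Qed.

Lemma gauss_bounded_sin g w : gauss_bounded g -> gauss_bounded (fun x => g x * sin (w * x)).
Proof.
move=> gg; apply: gauss_bounded_le gg _ => x.
by rewrite normrM ler_piMr// norm_sin_le1.
Qed.

Lemma Lint_cos g w : continuous g -> gauss_bounded g -> Lint (fun x => g x * cos (w * x)).
Proof.
move=> cg gg; apply: gauss_bounded_integrable; last exact: gauss_bounded_cos.
by move=> x; apply: cvgM; [exact: cg|exact: cos_scale_continuous].
Qed.

Lemma Lint_sin g w : continuous g -> gauss_bounded g -> Lint (fun x => g x * sin (w * x)).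
Proof.
move=> cg gg; apply: gauss_bounded_integrable; last exact: gauss_bounded_sin.
by move=> x; apply: cvgM; [exact: cg|exact: sin_scale_continuous].
Qed.

Lemma mulid_continuous g : continuous g -> continuous (fun x => x * g x).
Proof. by move=> cg x; apply: cvgM; [exact: cvg_id|exact: cg]. Qed.

Let integral_derive g (h h' : R -> R) w :
  continuous g -> gauss_bounded g ->
  (forall v x, is_derive v 1 (fun v => h (v * x)) (x * h' (v * x))) ->
  (forall v, Lint (fun x => g x * h (v * x))) -> (forall x, `|h' x| <= 1) ->
  is_derive w 1 (fun v => \int[leb]_x (g x * h (v * x)))
    (\int[leb]_x (x * g x * h' (w * x))).
Proof.
move=> cg gg dh ih h1.
pose f v x := g x * h (v * x).
have Ia : `]w - 1, w + 1[%classic w.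
  by rewrite /= in_itv/=; apply/andP; split; lra.
have df v x : is_derive v 1 (f ^~ x) (x * g x * h' (v * x)).
  by apply: is_derive_eq; rewrite /GRing.scale/=; ring.
have d1f v x : partial1of2 f v x = x * g x * h' (v * x).
  by rewrite partial1of2E; apply: derive_val.
have intG : leb.-integrable setT (EFin \o (fun x => `|x * g x|)).
  have -> : EFin \o (fun x => `|x * g x|) = abse \o (EFin \o (fun x => x * g x)) by [].
  apply: integrable_abse => //; apply: gauss_bounded_integrable.
    exact: mulid_continuous.
  exact: gauss_boundedM.
have bnd v x : `]w - 1, w + 1[%classic v -> setT x ->
    `|partial1of2 f v x| <= `|x * g x|.
  by move=> _ _; rewrite d1f normrM ler_piMr.
have intf v : `]w - 1, w + 1[%classic v -> leb.-integrable setT (EFin \o f v).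
  by move=> _; exact: ih.
have derf v x : `]w - 1, w + 1[%classic v -> setT x -> derivable (f ^~ x) v 1.
  by move=> _ _; case: (df v x).
have D1 := derivable_under_integral measurableT Ia intf derf (fun=> normr_ge0 _) intG bnd.
have D2 := differentiation_under_integral measurableT Ia intf derf (fun=> normr_ge0 _) intG bnd.
apply: DeriveDef; first exact: D1.
by rewrite -derive1E D2; apply: eq_Rintegral => x _; exact: d1f.
Qed.

Lemma cos_integral_derive g w : continuous g -> gauss_bounded g ->
  is_derive w 1 (fun v => \int[leb]_x (g x * cos (v * x)))
    (- \int[leb]_x (x * g x * sin (w * x))).
Proof.
move=> cg gg.
have -> : - (\int[leb]_x (x * g x * sin (w * x))) = \int[leb]_x (x * g x * (- sin (w * x))).
  rewrite -mulN1r -RintegralZl//; first by apply: eq_Rintegral => x _; ring.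
  by apply: Lint_sin; [exact: mulid_continuous|exact: gauss_boundedM].
apply: (@integral_derive g cos (fun x => - sin x)) => //.
- move=> v x; have := cos_scale_derive x v.
  by under eq_fun do rewrite mulrC; rewrite mulrN (mulrC x v).
- by move=> v; exact: Lint_cos.
- by move=> x; rewrite normrN norm_sin_le1.
Qed.

Lemma sin_integral_derive g w : continuous g -> gauss_bounded g ->
  is_derive w 1 (fun v => \int[leb]_x (g x * sin (v * x)))
    (\int[leb]_x (x * g x * cos (w * x))).
Proof.
move=> cg gg; apply: (@integral_derive g sin cos) => //.
- move=> v x; have := sin_scale_derive x v.
  by under eq_fun do rewrite mulrC; rewrite (mulrC x v).
- by move=> v; exact: Lint_sin.
- exact: norm_cos_le1.
Qed.

(** The quotient of [y] by the expected solution has derivative zero. *)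
Lemma linear_ode (y : R -> R) c :
  (forall w, is_derive w 1 y (- (2 * c * w * y w))) ->
  forall w, y w = y 0 * expR (- (c * w ^+ 2)).
Proof.
move=> dy w.
pose z v := y v * expR (c * v ^+ 2).
have dz v : is_derive v 1 z 0.
  have ? : is_derive v 1 (fun v => c * v ^+ 2) (2 * c * v).
    have ? := is_derive_expr 2 v.
    by apply: is_derive_eq; rewrite /GRing.scale/=; ring.
  have ? := dy v.
  by apply: is_derive_eq; rewrite /GRing.scale/=; ring.
have := is_derive_0_is_cst w 0 dz.
rewrite /z expr0n /= mulr0 expR0 mulr1 => <-.
by rewrite -mulrA -expRD subrr expR0 mulr1.
Qed.

Section Transforms.
Variables (t : R) (t0 : 0 < t).
Let cg := @gauss_continuous R t.
Let gg := gauss_gauss_bounded t0.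
Let cxg := mulid_continuous cg.
Let gxg := gauss_boundedM gg.

Lemma gauss_sin_by_parts w :
  \int[leb]_x (x * gauss t x * sin (w * x)) =
  w / (2 * t) * \int[leb]_x (gauss t x * cos (w * x)).
Proof.
have H := @Rintegral_derive_eq0 R (fun x => gauss t x * sin (w * x))
  (fun x => (- (2 * t)) * (x * gauss t x * sin (w * x)) + w * (gauss t x * cos (w * x))).
have i1 := Lint_sin w cxg gxg; have i2 := Lint_cos w cg gg.
have c1 : continuous (fun x => x * gauss t x * sin (w * x)).
  by move=> x; apply: cvgM; [exact: cxg|exact: sin_scale_continuous].
have c2 : continuous (fun x => gauss t x * cos (w * x)).
  by move=> x; apply: cvgM; [exact: cg|exact: cos_scale_continuous].
have : \int[leb]_x ((- (2 * t)) * (x * gauss t x * sin (w * x)) +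
    w * (gauss t x * cos (w * x))) = 0.
  apply: H.
  - move=> x; have ? := gauss_derive t x; have ? := sin_scale_derive w x.
    by apply: is_derive_eq; rewrite /GRing.scale/=; ring.
  - by move=> x; apply: cvgD; apply: cvgM; [exact: cvg_cst|exact: c1|exact: cvg_cst|exact: c2].
  - exact: gauss_bounded_sin.
  - apply: gauss_boundedD; apply: gauss_boundedZ.
      exact: gauss_bounded_sin.
    exact: gauss_bounded_cos.
rewrite RintegralD//; [|exact: RintegrableZ|exact: RintegrableZ].
rewrite !RintegralZl// => H1.
apply: (mulfI (_ : 2 * t != 0)); first by rewrite mulf_neq0 ?gt_eqF.
have -> : 2 * t * (w / (2 * t) * \int[leb]_x (gauss t x * cos (w * x))) =
    w * \int[leb]_x (gauss t x * cos (w * x)) by field; rewrite gt_eqF.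
by apply/esym/eqP; rewrite -subr_eq0 addrC -mulNr H1.
Qed.

Lemma gauss_cos_by_parts w :
  \int[leb]_x (x * gauss t x * cos (w * x)) =
  - (w / (2 * t) * \int[leb]_x (gauss t x * sin (w * x))).
Proof.
have H := @Rintegral_derive_eq0 R (fun x => gauss t x * cos (w * x))
  (fun x => (- (2 * t)) * (x * gauss t x * cos (w * x)) + (- w) * (gauss t x * sin (w * x))).
have i1 := Lint_cos w cxg gxg; have i2 := Lint_sin w cg gg.
have c1 : continuous (fun x => x * gauss t x * cos (w * x)).
  by move=> x; apply: cvgM; [exact: cxg|exact: cos_scale_continuous].
have c2 : continuous (fun x => gauss t x * sin (w * x)).
  by move=> x; apply: cvgM; [exact: cg|exact: sin_scale_continuous].
have : \int[leb]_x ((- (2 * t)) * (x * gauss t x * cos (w * x)) +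
    (- w) * (gauss t x * sin (w * x))) = 0.
  apply: H.
  - move=> x; have ? := gauss_derive t x; have ? := cos_scale_derive w x.
    by apply: is_derive_eq; rewrite /GRing.scale/=; ring.
  - by move=> x; apply: cvgD; apply: cvgM; [exact: cvg_cst|exact: c1|exact: cvg_cst|exact: c2].
  - exact: gauss_bounded_cos.
  - apply: gauss_boundedD; apply: gauss_boundedZ.
      exact: gauss_bounded_cos.
    exact: gauss_bounded_sin.
rewrite RintegralD//; [|exact: RintegrableZ|exact: RintegrableZ].
rewrite !RintegralZl// => H1.
apply: (mulfI (_ : 2 * t != 0)); first by rewrite mulf_neq0 ?gt_eqF.
have -> : 2 * t * - (w / (2 * t) * \int[leb]_x (gauss t x * sin (w * x))) =
    - w * \int[leb]_x (gauss t x * sin (w * x)) by field; rewrite gt_eqF.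
by apply/esym/eqP; rewrite -subr_eq0 addrC -mulNr H1.
Qed.

(** Integrating by parts, the derivative of the transform at [w] is [- w / (2 t)]
    times the transform. *)
Lemma gauss_cos_integral w : \int[leb]_x (gauss t x * cos (w * x)) =
  Num.sqrt (pi / t) * expR (- (w ^+ 2 / (4 * t))).
Proof.
have -> : w ^+ 2 / (4 * t) = (4 * t)^-1 * w ^+ 2 by rewrite mulrC.
have D v : is_derive v 1 (fun w => \int[leb]_x (gauss t x * cos (w * x)))
    (- (2 * (4 * t)^-1 * v * \int[leb]_x (gauss t x * cos (v * x)))).
  have D := cos_integral_derive v cg gg.
  apply: is_derive_eq; rewrite gauss_sin_by_parts; congr (- _).
  by field; rewrite gt_eqF.
rewrite (linear_ode D); congr (_ * _); have [_ <-] := integral_gauss t0.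
by apply: eq_Rintegral => x _; rewrite mul0r cos0 mulr1.
Qed.

(** The sine transform solves the same equation and vanishes at [0]. *)
Lemma gauss_sin_integral w : \int[leb]_x (gauss t x * sin (w * x)) = 0.
Proof.
have D v : is_derive v 1 (fun w => \int[leb]_x (gauss t x * sin (w * x)))
    (- (2 * (4 * t)^-1 * v * \int[leb]_x (gauss t x * sin (v * x)))).
  have D := sin_integral_derive v cg gg.
  apply: is_derive_eq; rewrite gauss_cos_by_parts; congr (- _).
  by field; rewrite gt_eqF.
rewrite (linear_ode D); under eq_Rintegral do rewrite mul0r sin0 mulr0.
by rewrite Rintegral_cst//= !mul0r.
Qed.

Lemma gauss_second_moment :
  \int[leb]_x (x * (x * gauss t x)) = (2 * t)^-1 * Num.sqrt (pi / t).
Proof.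
have H := @Rintegral_derive_eq0 R (fun x => x * gauss t x)
  (fun x => gauss t x + (- (2 * t)) * (x * (x * gauss t x))).
have c2 : continuous (fun x => x * (x * gauss t x)) by exact: mulid_continuous.
have g2 : gauss_bounded (fun x => x * (x * gauss t x)) by exact: gauss_boundedM.
have i1 := gauss_bounded_integrable c2 g2.
have [i2 E2] := integral_gauss t0.
have : \int[leb]_x (gauss t x + (- (2 * t)) * (x * (x * gauss t x))) = 0.
  apply: H => //.
  - move=> x; have ? := gauss_derive t x.
    by apply: is_derive_eq; rewrite /GRing.scale/=; ring.
  - by move=> x; apply: cvgD; [exact: cg|apply: cvgM; [exact: cvg_cst|exact: c2]].
  - by apply: gauss_boundedD => //; exact: gauss_boundedZ.
rewrite RintegralD//; last exact: RintegrableZ.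
rewrite RintegralZl// E2 => H1.
apply: (mulfI (_ : 2 * t != 0)); first by rewrite mulf_neq0 ?gt_eqF.
have -> : 2 * t * ((2 * t)^-1 * Num.sqrt (pi / t)) = Num.sqrt (pi / t).
  by field; rewrite gt_eqF.
by apply/esym/eqP; rewrite -subr_eq0 -mulNr H1.
Qed.

End Transforms.
End GaussianFourier.

(** * Integrals of products over the coordinates *)

Section TensorProducts.
Context {R : realType}.
Local Notation leb := (@lebesgue_measure R).
Local Notation TR := (measurableTypeR R).
Local Notation L := (lebesgue_measureR R).

Definition Cintegrable {d} {T : measurableType d} (nu : set T -> \bar R)
    (f : T -> R[i]) := Rintegrable nu (ReF f) /\ Rintegrable nu (ImF f).

Lemma prod_Rintegral d1 d2 (T1 : measurableType d1) (T2 : measurableType d2)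
    (m1 : {sigma_finite_measure set T1 -> \bar R})
    (m2 : {sigma_finite_measure set T2 -> \bar R}) (f : T1 -> R) (g : T2 -> R) :
  Rintegrable m1 f -> Rintegrable m2 g ->
  Rintegrable (m1 \x m2)%E (fun z => f z.1 * g z.2) /\
  fine (\int[(m1 \x m2)%E]_z (f z.1 * g z.2)%:E)%E =
    \int[m1]_x f x * \int[m2]_y g y.
Proof.
move=> if_ ig.
have mf := Rintegrable_measurable if_; have mg := Rintegrable_measurable ig.
have mfg : measurable_fun setT (fun z : T1 * T2 => (f z.1 * g z.2)%:E).
  apply/measurable_EFinP/measurable_funM.
    exact: measurableT_comp mf measurable_fst.
  exact: measurableT_comp mg measurable_snd.
have ifg : (m1 \x m2)%E.-integrable setT (fun z : T1 * T2 => (f z.1 * g z.2)%:E).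
  apply/integrable12ltyP => //=.
  have [B [B0 HB]] : exists B : R, 0 <= B /\ (\int[m2]_y (`|g y|%:E) = B%:E)%E.
    exists (fine (\int[m2]_y (`|g y|%:E)))%E; split.
      by apply: fine_ge0; apply: integral_ge0.
    rewrite fineK// ge0_fin_numE; last exact: integral_ge0.
    by have /integrableP[] := ig.
  have E x : (\int[m2]_y `|(f x * g y)%:E| = (`|f x| * B)%:E)%E.
    under eq_integral do rewrite /= normrM EFinM.
    rewrite ge0_integralZl//=.
    - by rewrite HB.
    - by apply/measurable_EFinP; exact: measurableT_comp.
  under eq_integral do rewrite E EFinM.
  rewrite ge0_integralZr//=.
  - rewrite lte_mul_pinfty//; first exact: integral_ge0.
      rewrite ge0_fin_numE; last exact: integral_ge0.
      by have /integrableP[] := if_.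
    by rewrite ltry.
  - by apply/measurable_EFinP; exact: measurableT_comp.
split=> //.
rewrite -(integral12_prod_meas1 ifg)/= /fubini_F/=.
have E x : (\int[m2]_y (f x * g y)%:E = (f x * \int[m2]_y g y)%:E)%E.
  under eq_integral do rewrite EFinM.
  rewrite integralZl// EFinM; congr (_ * _)%E.
  by rewrite /Rintegral fineK//; exact: integrable_fin_num.
by under eq_integral do rewrite E; rewrite -RintegralZr.
Qed.

Lemma cons_Rintegral n (f : R -> R) (g : n.-tuple TR -> R) (h : n.+1.-tuple TR -> R) :
  (forall (x : TR) (s : n.-tuple TR), h [tuple of x :: s] = f x * g s) ->
  Rintegrable leb f -> Rintegrable (L n) g ->
  Rintegrable (L n.+1) h /\ \int[L n.+1]_s h s = \int[leb]_x f x * \int[L n]_s g s.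
Proof.
move=> hE if_ ig.
have [ip Ep] := @prod_Rintegral _ _ _ _ leb (L n) f g if_ ig.
pose phi (p : TR * n.-tuple TR) : n.+1.-tuple TR := [tuple of p.1 :: p.2].
have mphi : measurable_fun setT phi by exact: measurable_cons.
have mh : measurable_fun setT h.
  have -> : h = (fun s : n.+1.-tuple TR => f (thead s) * g [tuple of behead s]).
    apply/funext => s; rewrite [in LHS](tuple_eta s) hE.
    by congr (_ * g _); apply: val_inj.
  apply: measurable_funM.
    apply: (measurableT_comp (Rintegrable_measurable if_)); exact: measurable_tnth.
  apply: (measurableT_comp (Rintegrable_measurable ig)); exact: measurable_behead.
have mh' : measurable_fun setT (EFin \o h) by exact/measurable_EFinP.
have hp : (EFin \o h) \o phi = (fun z => (f z.1 * g z.2)%:E).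
  by apply/funext => -[x s] /=; rewrite hE.
pose l : {sigma_finite_measure set TR -> \bar R} := leb.
pose l' : {sigma_finite_measure set (n.-tuple TR) -> \bar R} := L n.
pose M : {measure set (TR * n.-tuple TR)%type -> \bar R} := (l \x l')%E.
have ihp : M.-integrable (phi @^-1` setT) ((EFin \o h) \o phi).
  by rewrite hp preimage_setT.
split; first exact: (@integrable_pushforward _ _ _ _ R phi mphi M setT _ mh' ihp measurableT).
have Ei := @integral_pushforward _ _ _ _ R phi mphi M setT _ mh' ihp measurableT.
rewrite -Ep; congr fine; apply: (etrans Ei).
by rewrite hp preimage_setT.
Qed.

Lemma integralCE d (T : measurableType d) (mu : {measure set T -> \bar R}) f :
  (complex.Re (integralC mu f) = \int[mu]_x complex.Re (f x)) *
  (complex.Im (integralC mu f) = \int[mu]_x complex.Im (f x)).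
Proof. by []. Qed.

Lemma tensor_integral n (f : 'I_n -> R -> R[i]) :
  (forall j, Cintegrable leb (f j)) ->
  Cintegrable (L n) (fun s => \prod_(j < n) f j (tnth s j)) /\
  integralC (L n) (fun s => \prod_(j < n) f j (tnth s j)) =
    \prod_(j < n) integralC leb (f j).
Proof.
elim: n f => [|n IH] f intf.
  have E : (fun s : 0.-tuple TR => \prod_(j < 0) f j (tnth s j)) = (fun=> 1).
    by apply/funext => s; rewrite big_ord0.
  have c (r : R) : Rintegrable (L 0) (fun=> r).
    apply/integrableP; split; first exact: measurable_cst.
    rewrite integral_cst//= /dirac indicE.
    by rewrite mem_set// mule1 ltry.
  rewrite E big_ord0; split; first by split; exact: c.
  by apply: eqC; rewrite integralCE Rintegral_cst//= /dirac indicE mem_set ?mulr1.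
have [[iR iI] Ep] := IH (fun j => f (lift ord0 j)) (fun j => intf _).
have [fR fI] := intf ord0.
have E (x : TR) (s : n.-tuple TR) : \prod_(j < n.+1) f j (tnth [tuple of x :: s] j) =
    f ord0 x * \prod_(j < n) f (lift ord0 j) (tnth s j).
  by rewrite big_ord_recl tnth0; congr (_ * _); apply: eq_bigr => j _; rewrite tnthS.
pose G (s : n.-tuple TR) := \prod_(j < n) f (lift ord0 j) (tnth s j).
pose H (s : n.+1.-tuple TR) := \prod_(j < n.+1) f j (tnth s j).
have thE (s : n.+1.-tuple TR) : s = [tuple of thead s :: [tuple of behead s]].
  by rewrite [LHS]tuple_eta; apply: val_inj.
pose P (u : R -> R) (v : n.-tuple TR -> R) (s : n.+1.-tuple TR) :=
  u (thead s) * v [tuple of behead s].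
have PE u v (x : TR) (s : n.-tuple TR) : P u v [tuple of x :: s] = u x * v s.
  by rewrite /P theadE; congr (_ * v _); apply: val_inj.
have [i1 E1] := cons_Rintegral (PE _ _) fR iR.
have [i2 E2] := cons_Rintegral (PE _ _) fI iI.
have [i3 E3] := cons_Rintegral (PE _ _) fR iI.
have [i4 E4] := cons_Rintegral (PE _ _) fI iR.
have HR : ReF H = (fun s => P (ReF (f ord0)) (ReF G) s - P (ImF (f ord0)) (ImF G) s).
  by apply/funext => s; rewrite (thE s) !PE /H E ReE.
have HI : ImF H = (fun s => P (ReF (f ord0)) (ImF G) s + P (ImF (f ord0)) (ReF G) s).
  by apply/funext => s; rewrite (thE s) !PE /H E ReE.
split.
  rewrite /Cintegrable -/H HR HI; split; [exact: RintegrableB|exact: RintegrableD].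
rewrite big_ord_recl -Ep; apply: eqC; rewrite ReE !integralCE.
  by rewrite -E1 -E2 -RintegralB// -HR.
by rewrite -E3 -E4 -RintegralD// -HI.
Qed.

End TensorProducts.

(** * Gaussian integrals on the space *)

Section GaussianSpace.
Context {R : realType} {k : nat}.
Local Notation leb := (@lebesgue_measure R).
Local Notation TR := (measurableTypeR R).
Local Notation L := (lebesgue_measureR R k).
Implicit Types (xi : 'rV[R]_k) (s : k.-tuple TR) (t : R) (h : R -> R).

Definition tnorm s : R := enorm (rowt s).
Definition phase xi s : R := 2 * pi * dotR xi (rowt s).

Lemma expiD (a b : R) : expi (a + b) = expi a * expi b.
Proof. by apply: eqC; rewrite ReE /= ?cosD ?sinD //; ring. Qed.

Lemma expi_sum n (a : 'I_n -> R) : expi (\sum_j a j) = \prod_j expi (a j).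
Proof.
apply: (big_ind2 (fun u v => expi u = v)) => //.
  by rewrite /expi cos0 sin0.
by move=> ? ? ? ? <- <-; exact: expiD.
Qed.

Lemma gauss_sum n t (a : 'I_n -> R) :
  expR (- (t * \sum_j a j ^+ 2)) = \prod_j gauss t (a j).
Proof.
rewrite mulr_sumr -sumrN; apply: (big_ind2 (fun u v => expR u = v)) => //.
  exact: expR0.
by move=> ? ? ? ? <- <-; exact: expRD.
Qed.

Lemma tnorm_sqr s : tnorm s ^+ 2 = \sum_(j < k) tnth s j ^+ 2.
Proof.
by rewrite enorm_sqr /dotR; apply: eq_bigr => j _; rewrite mxE expr2.
Qed.

Lemma measurable_phase xi : measurable_fun setT (phase xi).
Proof.
have -> : phase xi = (fun s => 2 * pi * \sum_(j < k) xi ord0 j * tnth s j).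
  by apply/funext => s; rewrite /phase /dotR; under eq_bigr do rewrite mxE.
apply: measurable_funM => //; apply: measurable_sum => j.
by apply: measurable_funM => //; exact: measurable_tnth.
Qed.

Lemma measurable_tnorm : measurable_fun setT tnorm.
Proof.
have -> : tnorm = (fun s => Num.sqrt (\sum_(j < k) tnth s j ^+ 2)).
  by apply/funext => s; rewrite -tnorm_sqr sqrtr_sqr ger0_norm// enorm_ge0.
have ms : measurable_fun setT (Num.sqrt : R -> R).
  by apply: continuous_measurable_fun; exact: sqrt_continuous.
apply: (measurableT_comp ms); apply: measurable_sum => j.
by apply: measurable_funX; exact: measurable_tnth.
Qed.

Lemma measurable_radial h (tr : R -> R) xi : continuous h -> continuous tr ->
  measurable_fun setT (fun s => h (tnorm s) * tr (phase xi s)).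
Proof.
move=> ch ct; apply: measurable_funM.
  exact: (measurableT_comp (continuous_measurable_fun ch) measurable_tnorm).
exact: (measurableT_comp (continuous_measurable_fun ct) (measurable_phase xi)).
Qed.

Let gaussC t (w x : R) : R[i] := (gauss t x)%:C * expi (- (w * x)).

Let gaussC_parts t w x : complex.Re (gaussC t w x) = gauss t x * cos (w * x) /\
  complex.Im (gaussC t w x) = -1 * (gauss t x * sin (w * x)).
Proof. by rewrite !ReE /= cosN sinN; split; ring. Qed.

Let gaussC_integral t w : 0 < t -> Cintegrable leb (gaussC t w) /\
  integralC leb (gaussC t w) = (Num.sqrt (pi / t) * expR (- (w ^+ 2 / (4 * t))))%:C.
Proof.
move=> t0; have cg := @gauss_continuous R t; have gg := gauss_gauss_bounded t0.
have ic := Lint_cos w cg gg; have is_ := Lint_sin w cg gg.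
have HR : ReF (gaussC t w) = (fun x => gauss t x * cos (w * x)).
  by apply/funext => x; case: (gaussC_parts t w x).
have HI : ImF (gaussC t w) = (fun x => -1 * (gauss t x * sin (w * x))).
  by apply/funext => x; case: (gaussC_parts t w x).
split; first by rewrite /Cintegrable HR HI; split=> //; exact: RintegrableZ.
apply: eqC; rewrite integralCE.
  by rewrite HR; exact: gauss_cos_integral.
by rewrite HI RintegralZl// (gauss_sin_integral t0) mulr0.
Qed.

(** The Gaussian and the character [expi] both turn sums over the coordinates
    into products, so the integral is a product of one-dimensional ones. *)
Lemma gauss_radial_integral t xi : 0 < t ->
  [/\ Rintegrable L (fun s => gauss t (tnorm s)),
    \int[L]_s (gauss t (tnorm s) * cos (phase xi s)) =
      Num.sqrt (pi / t) ^+ k * expR (- (pi ^+ 2 / t * enorm xi ^+ 2)) &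
    \int[L]_s (gauss t (tnorm s) * sin (phase xi s)) = 0].
Proof.
move=> t0.
have P (z : 'rV[R]_k) s : (gauss t (tnorm s))%:C * expi (- phase z s) =
    \prod_(j < k) gaussC t (2 * pi * z ord0 j) (tnth s j).
  rewrite big_split/= -rmorph_prod/= -gauss_sum -expi_sum /gauss tnorm_sqr.
  congr (_ * expi _); rewrite sumrN /phase /dotR mulr_sumr; congr (- _).
  by apply: eq_bigr => j _; rewrite mxE mulrA.
have PE (z : 'rV[R]_k) : (fun s => (gauss t (tnorm s))%:C * expi (- phase z s)) =
    (fun s : k.-tuple TR => \prod_(j < k) gaussC t (2 * pi * z ord0 j) (tnth s j)).
  by apply/funext => s; rewrite P.
have Q (z : 'rV[R]_k) : Cintegrable L (fun s => (gauss t (tnorm s))%:C * expi (- phase z s)) /\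
    integralC L (fun s => (gauss t (tnorm s))%:C * expi (- phase z s)) =
    \prod_(j < k) integralC leb (gaussC t (2 * pi * z ord0 j)).
  rewrite PE; apply: (@tensor_integral R k (fun j => gaussC t (2 * pi * z ord0 j))).
  by move=> j; case: (gaussC_integral (2 * pi * z ord0 j) t0).
have HR z : ReF (fun s => (gauss t (tnorm s))%:C * expi (- phase z s)) =
    (fun s => gauss t (tnorm s) * cos (phase z s)).
  by apply/funext => s; rewrite ReE /= mul0r subr0 cosN.
have HI z : ImF (fun s => (gauss t (tnorm s))%:C * expi (- phase z s)) =
    (fun s => - (gauss t (tnorm s) * sin (phase z s))).
  by apply/funext => s; rewrite ReE /= mul0r addr0 sinN mulrN.
split.
- have [[]] := Q 0; rewrite HR => i0 _ _; move: i0.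
  rewrite (_ : (fun s => _ * _) = (fun s => gauss t (tnorm s)))//.
  apply/funext => s.
  by rewrite /phase /dotR big1 ?mulr0 ?cos0 ?mulr1// => j _; rewrite mxE mul0r.
- have [_ E] := Q xi; move/(congr1 (@complex.Re R)): E; rewrite integralCE HR => ->.
  under eq_bigr do rewrite (gaussC_integral _ t0).2.
  rewrite -rmorph_prod/= big_split/= prodr_const card_ord; congr (_ * _).
  rewrite enorm_sqr /dotR.
  under [in RHS]eq_bigr do rewrite -expr2.
  rewrite gauss_sum; apply: eq_bigr => j _; congr (expR (- _)).
  by field; rewrite gt_eqF.
- have [[_ iI] E] := Q xi; move/(congr1 (@complex.Im R)): E; rewrite integralCE.
  move: iI; rewrite HI => iI E.
  rewrite (_ : (fun s => gauss t (tnorm s) * sin (phase xi s)) =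
     (fun s => -1 * - (gauss t (tnorm s) * sin (phase xi s)))); last first.
    by apply/funext => s; rewrite mulN1r opprK.
  rewrite RintegralZl// E; under eq_bigr do rewrite (gaussC_integral _ t0).2.
  by rewrite -rmorph_prod/= mulr0.
Qed.

Lemma radial_Rintegrable h (tr : R -> R) xi (C : R) : continuous h -> continuous tr ->
  (forall r, 0 <= r -> `|h r| <= C * gauss 1 r) -> (forall r, `|tr r| <= 1) ->
  Rintegrable L (fun s => h (tnorm s) * tr (phase xi s)) /\
  `|\int[L]_s (h (tnorm s) * tr (phase xi s))| <=
     C * \int[L]_s (gauss 1 (tnorm s)).
Proof.
move=> ch ct hC t1; have [ig _ _] := @gauss_radial_integral 1 0 ltr01.
have igC : Rintegrable L (fun s => C * gauss 1 (tnorm s)) by exact: RintegrableZ.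
have le s : `|h (tnorm s) * tr (phase xi s)| <= C * gauss 1 (tnorm s).
  apply: le_trans (hC _ (enorm_ge0 _)).
  by rewrite normrM ler_piMr.
have m := measurable_radial xi ch ct.
split; first exact: (Rintegrable_le m le igC).
by rewrite -RintegralZl//; exact: (Rintegral_norm_le m le igC).
Qed.

End GaussianSpace.

(** * Approximation by polynomials and by Gaussians *)

Section Bernstein.
Context {R : realType}.
Implicit Types (x c : R) (phi psi : nat -> R).

(** The expectation of [phi] of the number of heads in [n] independent tosses
    of a coin of bias [x]; for [phi k = f (k / n)] this is the Bernstein
    polynomial of [f]. *)
Fixpoint binomial_mean x n phi : R :=
  if n is n'.+1 then
    x * binomial_mean x n' (fun i => phi i.+1) + (1 - x) * binomial_mean x n' phi
  else phi 0%N.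

Lemma binomial_mean_lin x n a b phi psi :
  binomial_mean x n (fun i => a * phi i + b * psi i) =
  a * binomial_mean x n phi + b * binomial_mean x n psi.
Proof. by elim: n phi psi => [|n IH] phi psi //=; rewrite !IH; ring. Qed.

Lemma binomial_mean_cst x n c : binomial_mean x n (fun=> c) = c.
Proof. by elim: n => //= n ->; ring. Qed.

Lemma binomial_mean_le x n phi psi : 0 <= x <= 1 ->
  (forall i, (i <= n)%N -> phi i <= psi i) ->
  binomial_mean x n phi <= binomial_mean x n psi.
Proof.
move=> /andP[x0 x1]; elim: n phi psi => [|n IH] phi psi H /=; first exact: H.
apply: lerD; apply: ler_wpM2l; rewrite ?subr_ge0//; apply: IH => i ni; apply: H => //.
exact: leqW.
Qed.

Lemma binomial_mean_poly n phi : exists p : {poly R}, forall x, binomial_mean x n phi = p.[x].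
Proof.
elim: n phi => [|n IH] phi; first by exists (phi 0%N)%:P => x; rewrite hornerC.
have [p Hp] := IH (fun i => phi i.+1); have [q Hq] := IH phi.
exists ('X * p + (1 - 'X) * q) => x.
by rewrite /= Hp Hq !hornerE.
Qed.

(** Conditioning on one toss: it shifts the mean by [x] and adds [x (1 - x)] to
    the variance. *)
Lemma binomial_moments x n :
  binomial_mean x n (fun i => i%:R - n%:R * x) = 0 /\
  binomial_mean x n (fun i => (i%:R - n%:R * x) ^+ 2) = n%:R * (x * (1 - x)).
Proof.
elim: n => [|n [E1 E2]] /=; first by rewrite !mul0r subr0 expr0n.
pose z i := i%:R - n%:R * x.
have H1 : (fun i : nat => i.+1%:R - n.+1%:R * x) = (fun i => 1 * z i + (1 - x) * (fun=> 1) i).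
  by apply/funext => i; rewrite /z -!natr1; ring.
have H2 : (fun i : nat => i%:R - n.+1%:R * x) = (fun i => 1 * z i + (- x) * (fun=> 1) i).
  by apply/funext => i; rewrite /z -!natr1; ring.
have H3 : (fun i : nat => (i.+1%:R - n.+1%:R * x) ^+ 2) =
    (fun i => 1 * (fun i => 1 * z i ^+ 2 + 2 * (1 - x) * z i) i + (1 - x) ^+ 2 * (fun=> 1) i).
  by apply/funext => i; rewrite /z -!natr1; ring.
have H4 : (fun i : nat => (i%:R - n.+1%:R * x) ^+ 2) =
    (fun i => 1 * (fun i => 1 * z i ^+ 2 + - (2 * x) * z i) i + x ^+ 2 * (fun=> 1) i).
  by apply/funext => i; rewrite /z -!natr1; ring.
rewrite H1 H2 H3 H4 !binomial_mean_lin !binomial_mean_cst E1 E2 -natr1.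
by split; ring.
Qed.

(** The Bernstein polynomial differs from [f x] by at most [K] times the mean of
    [|i / n - x|], which the variance [x (1 - x) / n] controls. *)
Lemma weierstrass_lipschitz (f : R -> R) (K e : R) : 0 < e -> 0 <= K ->
  (forall x y, 0 <= x <= 1 -> 0 <= y <= 1 -> `|f x - f y| <= K * `|x - y|) ->
  exists p : {poly R}, forall x, 0 <= x <= 1 -> `|f x - p.[x]| <= e.
Proof.
move=> e0 K0 lip.
pose d := e / (2 * (K + 1)).
have K1 : 0 < K + 1 by rewrite ltr_wpDl.
have d0 : 0 < d by rewrite divr_gt0// mulr_gt0.
pose n := (Num.truncn (d ^- 2)).+1.
have n0 : 0 < n%:R :> R by rewrite ltr0n.
have nd : (n%:R)^-1 <= d ^+ 2.
  rewrite -[leRHS]invrK lef_pV2 ?posrE ?invr_gt0 ?exprn_gt0//.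
  exact: ltW (truncnS_gt _).
have [p Hp] := binomial_mean_poly n (fun i => f (i%:R / n%:R)).
exists p => x x01; rewrite -Hp.
(* [|t| <= d + t^2/d] turns the first absolute moment into the variance *)
have abs_le (t : R) : `|t| <= d + d^-1 * t ^+ 2.
  rewrite -(ler_pM2l d0) (_ : d * (d + _) = d ^+ 2 + t ^+ 2); last first.
    by field; rewrite gt_eqF.
  rewrite -(real_normK (num_real t)).
  have := sqr_ge0 (`|t| - d); have := mulr_ge0 (ltW d0) (normr_ge0 t); nra.
have bound i : (i <= n)%N -> `|f x - f (i%:R / n%:R)| <=
    K * d * (fun=> 1) i + K * d^-1 * n%:R^-1 ^+ 2 * (i%:R - n%:R * x) ^+ 2.
  move=> ni; apply: le_trans (lip _ _ x01 _) _.
    by rewrite divr_ge0//= ler_pdivrMr// mul1r ler_nat.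
  rewrite /= mulr1 -!mulrA -mulrDr ler_wpM2l//.
  apply: le_trans (abs_le _) _; rewrite lerD2l ler_wpM2l ?invr_ge0 ?(ltW d0)//.
  by rewrite le_eqVlt; apply/orP; left; apply/eqP; field; rewrite gt_eqF.
have [_ E2] := binomial_moments x n.
have M : binomial_mean x n (fun i => K * d * (fun=> 1) i +
    K * d^-1 * n%:R^-1 ^+ 2 * (i%:R - n%:R * x) ^+ 2) <= e.
  rewrite binomial_mean_lin binomial_mean_cst E2.
  have -> : K * d^-1 * n%:R^-1 ^+ 2 * (n%:R * (x * (1 - x))) =
      K * d^-1 * (n%:R^-1 * (x * (1 - x))).
    by field; rewrite !gt_eqF.
  have v : n%:R^-1 * (x * (1 - x)) <= d ^+ 2.
    rewrite -[leRHS]mulr1 ler_pM ?invr_ge0 ?(ltW n0)//; nra.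
  have : K * d^-1 * (n%:R^-1 * (x * (1 - x))) <= K * d.
    rewrite (_ : K * d = K * d^-1 * d ^+ 2); last by field; rewrite gt_eqF.
    by rewrite ler_wpM2l// mulr_ge0// invr_ge0 ltW.
  have : K * d <= e / 2.
    rewrite /d mulrA ler_pdivrMr ?mulr_gt0//.
    by rewrite (_ : e / 2 * (2 * (K + 1)) = K * e + e) ?lerDl ?ltW//; field.
  rewrite !mulr1; lra.
rewrite ler_norml; apply/andP; split.
  rewrite lerBrDl.
  apply: le_trans (_ : binomial_mean x n (fun i =>
    1 * (fun=> f x) i + 1 * (fun i => K * d * (fun=> 1) i +
    K * d^-1 * n%:R^-1 ^+ 2 * (i%:R - n%:R * x) ^+ 2) i) - e <= _).
    rewrite lerD2r; apply: binomial_mean_le => // i ni.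
    by have := bound i ni; rewrite ler_norml => /andP[h _]; lra.
  by rewrite binomial_mean_lin binomial_mean_cst; lra.
rewrite lerBlDr.
apply: le_trans (_ : e + binomial_mean x n (fun i =>
    1 * (fun=> f x) i + (-1) * (fun i => K * d * (fun=> 1) i +
    K * d^-1 * n%:R^-1 ^+ 2 * (i%:R - n%:R * x) ^+ 2) i) <= _).
  by rewrite binomial_mean_lin binomial_mean_cst; lra.
rewrite lerD2l; apply: binomial_mean_le => // i ni.
by have := bound i ni; rewrite ler_norml => /andP[_ h]; lra.
Qed.

End Bernstein.

Section ExponentialApproximation.
Context {R : realType}.
Implicit Types (u g : R -> R) (r w x y M e : R).

(** In the variable [w = exp (- r^2)] the profile divided by [w] is Lipschitz on
    the unit interval, because it vanishes for small [w]; so it is a uniform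
    limit of polynomials in [w]. *)
Lemma gaussian_approximation m u M e : 0 <= M -> smooth1 u -> vanishes_beyond M u ->
  0 < e -> exists p : {poly R}, forall r,
    `|rtower m u r - gauss 1 r * p.[gauss 1 r]| <= e * gauss 1 r.
Proof.
move=> M0 su vu e0.
have [sg eg] := rtower_even m su; have [sh eh] := rtower_even m.+1 su.
have vg := vanishes_rtower m M0 su vu; have vh := vanishes_rtower m.+1 M0 su vu.
set g := rtower m u in sg eg vg *; set h := rtower m.+1 u in sh eh vh.
have cg : continuous g := smooth1_continuous (n := 0%N) sg.
have ch : continuous h := smooth1_continuous (n := 0%N) sh.
have [B0 HB0] := vanishes_bounded cg vg; have [B1 HB1] := vanishes_bounded ch vh.
have B00 : 0 <= B0 := le_trans (normr_ge0 _) (HB0 0).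
have B10 : 0 <= B1 := le_trans (normr_ge0 _) (HB1 0).
pose w0 := expR (- M ^+ 2).
have w00 : 0 < w0 by exact: expR_gt0.
pose f w := g (Num.sqrt (- ln w)) / w.
pose f' w := - (h (Num.sqrt (- ln w)) / 2 + g (Num.sqrt (- ln w))) / w ^+ 2.
have far w : 0 < w -> w < w0 -> M < `|Num.sqrt (- ln w)|.
  move=> wp ww0; have lw : ln w < - M ^+ 2.
    by rewrite -(expRK (- M ^+ 2)) ltr_ln ?posrE.
  rewrite ger0_norm ?sqrtr_ge0// -[ltLHS]ger0_norm// -sqrtr_sqr ltr_sqrt.
    by rewrite ltrNr.
  by rewrite oppr_gt0 (lt_le_trans lw)// oppr_le0 sqr_ge0.
have f0 w : 0 < w -> w < w0 -> f w = 0.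
  by move=> wp /(far w wp) H; rewrite /f vg// mul0r.
have df w : 0 < w -> w < 1 -> is_derive w 1 f (f' w).
  move=> wp w1; have l0 : 0 < - ln w by rewrite oppr_gt0 ln_lt0// wp.
  have ? := sqrt_profile_derive sg eg l0.
  have ? := is_derive1_ln wp.
  have ? : is_derive w 1 (fun w => g (Num.sqrt (- ln w))) (h (Num.sqrt (- ln w)) / 2 * - w^-1).
    exact: (@is_derive1_comp _ (fun s => g (Num.sqrt s)) (fun w => - ln w)).
  have ? : is_derive w 1 (fun w : R => w^-1) (- w ^- 2).
    have := @is_deriveV R id w 1 1; rewrite /= => H.
    have {}H : is_derive w 1 (fun w : R => w^-1) (- w ^- 2 *: 1).
      by apply: H; rewrite gt_eqF.
    by apply: is_derive_eq; rewrite /GRing.scale/= mulr1.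
  have w_neq0 : w != 0 by rewrite gt_eqF.
  by apply: is_derive_eq; rewrite /GRing.scale/= /f'; field.
(* [f'] vanishes for [w < w0], and elsewhere [1 / w^2] is at most [exp (2 M^2)] *)
pose K := (B1 / 2 + B0) * expR (2 * M ^+ 2).
have K0 : 0 <= K by rewrite mulr_ge0 ?expR_ge0 ?addr_ge0 ?divr_ge0.
have f'K w : 0 < w -> `|f' w| <= K.
  move=> wp; have [ww|ww] := ltP w w0.
    by rewrite /f' vg ?vh ?far// mul0r addr0 oppr0 mul0r normr0.
  rewrite /f' normrM normrN ler_pM//.
    rewrite (le_trans (ler_normD _ _))// lerD//.
    by rewrite normrM ler_pM// ger0_norm.
  rewrite ger0_norm ?invr_ge0 ?sqr_ge0//.
  have -> : expR (2 * M ^+ 2) = (w0 ^+ 2)^-1.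
    by rewrite /w0 -expRM_natl -expRN; congr expR; ring.
  by rewrite lef_pV2 ?posrE ?exprn_gt0// ler_pXn2r// nnegrE ltW.
have lipp x y : 0 < x -> x < y -> y <= 1 -> `|f y - f x| <= K * (y - x).
  move=> x0 xy y1.
  have [||c /[!in_itv]/= /andP[xc cy] ->] := @MVT _ f f' x y xy.
  - move=> z /[!in_itv]/= /andP[xz zy]; apply: df; first exact: lt_trans xz.
    exact: lt_le_trans y1.
  - apply: continuous_in_subspaceT => z /set_mem/=; rewrite in_itv/= => /andP[xz _].
    have z0 : 0 < z by exact: lt_le_trans xz.
    apply: cvgM; last by apply: cvgV; [rewrite gt_eqF|exact: cvg_id].
    apply: (continuous_comp (f := fun w => Num.sqrt (- ln w))); last exact: cg.
    apply: (continuous_comp (f := fun w => - ln w)); last exact: sqrt_continuous.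
    by apply: cvgN; exact: continuous_ln.
  rewrite normrM ler_pM//; first by apply: f'K; exact: lt_trans xc.
  by rewrite ger0_norm// subr_ge0 ltW.
have fz : f 0 = 0 by rewrite /f invr0 mulr0.
(* at the end point [0] compare with a point of the interval where [f] vanishes *)
have lip0 y : 0 < y -> y <= 1 -> `|f y| <= K * y.
  move=> y0 y1; pose x := Num.min (y / 2) (w0 / 2).
  have x0 : 0 < x by rewrite lt_min !divr_gt0.
  have xy : x < y by rewrite gt_min; apply/orP; left; lra.
  have xw : x < w0 by rewrite gt_min; apply/orP; right; lra.
  have := lipp x y x0 xy y1; rewrite (f0 x x0 xw) subr0 => /le_trans; apply.
  by rewrite ler_wpM2l// gerBl ltW.
have lip x y : 0 <= x <= 1 -> 0 <= y <= 1 -> `|f x - f y| <= K * `|x - y|.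
  have W a b : 0 <= a <= 1 -> 0 <= b <= 1 -> a < b -> `|f a - f b| <= K * `|a - b|.
    move=> /andP[a0 _] /andP[_ b1] ab.
    rewrite (distrC a) (gtr0_norm (_ : 0 < b - a)) ?subr_gt0// distrC.
    move: a0; rewrite le_eqVlt => /predU1P[a0|a0]; last exact: lipp.
    by rewrite -a0 fz !subr0; apply: lip0 => //; rewrite a0.
  move=> hx hy; have [xy|yx|->] := ltgtP x y; first exact: W.
    by rewrite distrC (distrC x); exact: W.
  by rewrite !subrr !normr0 mulr0.
have [p Hp] := weierstrass_lipschitz e0 K0 lip.
exists p => r.
have gp := gauss_gt0 1 r.
have g1 : gauss 1 r <= 1.
  by rewrite -[leRHS]expR0 ler_expR oppr_le0 mul1r sqr_ge0.
have := Hp (gauss 1 r); rewrite (ltW gp) g1 => /(_ isT).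
have lnw : - ln (gauss 1 r) = r ^+ 2 by rewrite /gauss expRK opprK mul1r.
rewrite /f lnw sqrtr_sqr.
have -> : g `|r| = g r by case: (ger0P r) => // _; exact: eg.
move=> H; rewrite (_ : g r - _ = (g r / gauss 1 r - p.[gauss 1 r]) * gauss 1 r).
  by rewrite normrM (gtr0_norm gp) ler_wpM2r// ltW.
by field; rewrite gt_eqF.
Qed.

End ExponentialApproximation.

(** * Towers of radial derivatives *)

Section RadialTowers.
Context {R : realType}.
Implicit Types (P Q : nat -> R -> R) (r c e : R).

(** What the functions [rtower i u] of a test function share with Gaussians and
    with linear combinations of both. *)
Definition tower P := (forall i r, is_derive r 1 (P i) (r * P i.+1 r)) /\
  forall i, gauss_bounded (P i).

Lemma tower_continuous P i : tower P -> continuous (P i).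
Proof. by move=> [dP _]; exact: (derive_continuous (dP i)). Qed.

Lemma vanishes_gauss_bounded (g : R -> R) M : continuous g -> vanishes_beyond M g ->
  exists C, forall r, `|g r| <= C * gauss 1 r.
Proof.
move=> cg vg; have [B HB] := vanishes_bounded cg vg.
have B0 : 0 <= B := le_trans (normr_ge0 _) (HB 0).
exists (B * expR (M ^+ 2)) => r; have [rM|/vg ->] := leP `|r| M; last first.
  by rewrite normr0 !mulr_ge0 ?expR_ge0.
rewrite -mulrA -expRD (le_trans (HB r))// ler_peMr// -[leLHS]expR0 ler_expR.
rewrite subr_ge0 mul1r -(real_normK (num_real r)).
by rewrite ler_pXn2r// nnegrE (le_trans (normr_ge0 r)).
Qed.

Lemma rtower_tower u M : 0 <= M -> smooth1 u -> vanishes_beyond M u ->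
  tower (fun i => rtower i u).
Proof.
move=> M0 su vu; split=> i.
  move=> r; have [s e] := rtower_even i su; rewrite /= rdivE//.
  exact: smooth1_is_derive1.
have [s _] := rtower_even i su.
have [C HC] := vanishes_gauss_bounded (smooth1_continuous (n := 0%N) s)
  (vanishes_rtower i M0 su vu).
exists C, 1; split=> //.
have := HC 0; rewrite /gauss expr0n/= mulr0 oppr0 expR0 mulr1.
exact: le_trans.
Qed.

Lemma tower_lin P Q c : tower P -> tower Q -> tower (fun i r => P i r + c * Q i r).
Proof.
move=> [dP gP] [dQ gQ]; split=> i.
  move=> r; have ? := dP i r; have ? := dQ i r.
  by apply: is_derive_eq; rewrite /GRing.scale/=; ring.
by apply: gauss_boundedD => //; exact: gauss_boundedZ.
Qed.

Lemma gauss_tower t c : 0 < t -> tower (fun i r => c * (- (2 * t)) ^+ i * gauss t r).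
Proof.
move=> t0; split=> i.
  move=> r; have ? := gauss_derive t r.
  by apply: is_derive_eq; rewrite /GRing.scale/= exprS; ring.
by apply: gauss_boundedZ; exact: gauss_gauss_bounded.
Qed.

Let nonneg_of_decreasing (f f' : R -> R) : (forall r, is_derive r 1 f (f' r)) ->
  (forall r, 0 <= r -> f' r <= 0) -> gauss_bounded f ->
  forall r, 0 <= r -> 0 <= f r.
Proof.
move=> df f'0 [C [t [C0 t0 HC]]] r r0.
have flim : f n.+1%:R @[n --> \oo] --> 0.
  apply/norm_cvg0P.
  apply: (@squeeze_cvgr _ _ _ _ (cst 0) (fun n => C * gauss t n.+1%:R)).
  - by near=> n; rewrite normr_ge0 HC.
  - exact: cvg_cst.
  - by rewrite -(mulr0 C); apply: cvgM; [exact: cvg_cst|exact: gauss_cvg0].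
apply: (cvgr_to_le flim); near=> n.
apply: (@ler0_derive1_nincry _ f 0) => //.
- move=> x; rewrite in_itv/= andbT => x0.
  by rewrite (is_derive_derive1 (df x)) f'0// ltW.
- apply: continuous_subspaceT; exact: derive_continuous df.
- near: n; exists (Num.truncn r) => // n /= hn.
  by rewrite (le_trans (ltW (truncnS_gt _)))// ler_nat.
Unshelve. all: by end_near. Qed.

Let half_step (f h : R -> R) e : (forall r, is_derive r 1 f (r * h r)) ->
  gauss_bounded f -> (forall r, `|h r| <= e * gauss 1 r) ->
  forall r, 0 <= r -> `|f r| <= e / 2 * gauss 1 r.
Proof.
move=> df gf hb r r0.
have S c : `|c| = 1 -> 0 <= c * f r + e / 2 * gauss 1 r.
  move=> c1; apply: (@nonneg_of_decreasing (fun r => c * f r + e / 2 * gauss 1 r)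
     (fun r => r * (c * h r - e * gauss 1 r))) => //.
  - move=> x; have ? := df x; have ? := gauss_derive 1 x.
    by apply: is_derive_eq; rewrite /GRing.scale/=; field.
  - move=> x x0; rewrite mulr_ge0_le0// subr_le0 (le_trans (ler_norm _))//.
    by rewrite normrM c1 mul1r.
  - apply: gauss_boundedD; apply: gauss_boundedZ => //.
    exact: gauss_gauss_bounded.
have h1 := S 1 (normr1 _); have := S (-1) (normrN1 _); rewrite ler_norml.
by move=> h2; apply/andP; split; lra.
Qed.

(** Integrating [P_i' = r P_(i+1)] from infinity against the Gaussian does not
    increase the bound. *)
Lemma tower_small P m e : tower P -> 0 <= e ->
  (forall r, `|P m r| <= e * gauss 1 r) -> forall r, `|P 0%N r| <= e * gauss 1 r.
Proof.
move=> [dP gP] e0; elim: m => // m IH H; apply: IH => r.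
have half x : e / 2 * gauss 1 x <= e * gauss 1 x.
  by rewrite ler_wpM2r ?gauss_ge0//; lra.
have [r0|r0] := leP 0 r.
  by apply: le_trans (half_step (dP m) (gP m) H r0) (half r).
have gN : gauss_bounded (fun x => P m (- x)).
  have [C [t [C0 t0 HC]]] := gP m; exists C, t; split=> // x.
  by rewrite -(gaussN t x).
have dN (x : R) : is_derive x 1 (fun x => P m (- x)) (x * P m.+1 (- x)).
  have ? := dP m (- x).
  by apply: is_derive_eq; rewrite /GRing.scale/=; ring.
have HN x : `|P m.+1 (- x)| <= e * gauss 1 x by rewrite -gaussN.
have := half_step dN gN HN (ltW (_ : 0 < - r)).
rewrite oppr_gt0 => /(_ r0); rewrite opprK gaussN => /le_trans; apply.
exact: half.
Qed.

End RadialTowers.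

(** * The radial inversion identity *)

Section HankelIdentity.
Context {R : realType} {k m : nat}.
Hypothesis kE : k = m.*2.+3.
Local Notation leb := (@lebesgue_measure R).
Local Notation Lint := (Rintegrable leb).
Local Notation L := (lebesgue_measureR R k).
Implicit Types (P Q : nat -> R -> R) (xi : 'rV[R]_k) (w x c e : R) (g : R -> R).

(** [x sin (w x) / w], extended continuously to [w = 0]. *)
Definition sine_kernel w x : R := if w == 0 then x * x else x * sin (w * x) / w.

Lemma norm_sin_le x : `|sin x| <= `|x|.
Proof.
wlog x0 : x / 0 < x => [H|].
  have [x0|x0|<-] := ltgtP 0 x; first exact: H.
    by have := H (- x); rewrite oppr_gt0 sinN !normrN; exact.
  by rewrite sin0 normr0.
have cs : {within `[0, x], continuous (@sin R)}.
  by apply: continuous_subspaceT; exact: continuous_sin.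
have [c _] := @MVT _ (@sin R) (@cos R) 0 x x0 (fun y _ => is_derive_sin y) cs.
rewrite sin0 !subr0 => ->; rewrite normrM ler_piMl//.
exact: norm_cos_le1.
Qed.

Lemma sine_kernel_le w x : `|sine_kernel w x| <= x * x.
Proof.
rewrite /sine_kernel; case: ifPn => w0.
  by rewrite ger0_norm// -expr2 sqr_ge0.
rewrite !normrM normfV ler_pdivrMr ?normr_gt0//.
have -> : x * x * `|w| = `|x| * `|w * x|.
  by rewrite normrM -expr2 -(real_normK (num_real x)); ring.
by rewrite ler_wpM2l// norm_sin_le.
Qed.

Lemma sine_kernel_continuous w : continuous (sine_kernel w).
Proof.
have [w0|w0] := eqVneq w 0.
  have -> : sine_kernel w = (fun x => x * id x).
    by apply/funext => x; rewrite /sine_kernel w0 eqxx.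
  by apply: mulid_continuous => x; exact: cvg_id.
have -> : sine_kernel w = (fun x => x * sin (w * x) * w^-1).
  by apply/funext => x; rewrite /sine_kernel (negbTE w0).
move=> x; apply: cvgM; last exact: cvg_cst.
by apply: mulid_continuous; exact: sin_scale_continuous.
Qed.

Lemma sine_kernel_Lint g w : continuous g -> gauss_bounded g ->
  Lint (fun x => g x * sine_kernel w x).
Proof.
move=> cg gg; apply: gauss_bounded_integrable.
  by move=> x; apply: cvgM; [exact: cg|exact: sine_kernel_continuous].
apply: gauss_bounded_le (gauss_boundedM (gauss_boundedM gg)) _ => x.
rewrite mulrA mulrC !normrM ler_wpM2r// -normrM.
by rewrite (le_trans (sine_kernel_le _ _))// ler_norm.
Qed.

Lemma gauss_sine_kernel t w : 0 < t ->
  \int[leb]_x (gauss t x * sine_kernel w x) =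
  (2 * t)^-1 * (Num.sqrt (pi / t) * expR (- (w ^+ 2 / (4 * t)))).
Proof.
move=> t0; have [->|w0] := eqVneq w 0.
  under eq_Rintegral do rewrite /sine_kernel eqxx mulrC -mulrA.
  by rewrite gauss_second_moment// expr0n mul0r oppr0 expR0 mulr1.
have -> : \int[leb]_x (gauss t x * sine_kernel w x) =
    w^-1 * \int[leb]_x (x * gauss t x * sin (w * x)).
  rewrite -RintegralZl//.
    by apply: eq_Rintegral => x _; rewrite /sine_kernel (negbTE w0); ring.
  apply: Lint_sin; first exact/mulid_continuous/gauss_continuous.
  exact/gauss_boundedM/gauss_gauss_bounded.
rewrite (gauss_sin_by_parts t0) (gauss_cos_integral t0).
by field; rewrite w0 gt_eqF.
Qed.

Definition space_cos g xi : R := \int[L]_s (g (tnorm s) * cos (phase xi s)).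
Definition space_sin g xi : R := \int[L]_s (g (tnorm s) * sin (phase xi s)).
Definition line_sine g xi : R := \int[leb]_x (g x * sine_kernel (2 * pi * enorm xi) x).

(** The difference of the two sides of the inversion identity; it is linear in
    the tower and vanishes on Gaussians. *)
Definition hankel_defect P xi : R :=
  (- (1 / (2 * pi))) ^+ m * space_cos (P m) xi - 2 * pi * line_sine (P 0%N) xi.

(** A tower whose top is dominated by the standard Gaussian, so that it can be
    integrated radially over the space. *)
Definition dominated_tower P := tower P /\ exists C, forall r, `|P m r| <= C * gauss 1 r.

Lemma dominated_tower_lin P Q c : dominated_tower P -> dominated_tower Q ->
  dominated_tower (fun i r => P i r + c * Q i r).
Proof.
move=> [tP [C HC]] [tQ [D HD]]; split; first exact: tower_lin.
exists (C + `|c| * D) => r; rewrite (le_trans (ler_normD _ _))// mulrDl lerD//.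
by rewrite normrM -mulrA ler_wpM2l.
Qed.

Let top_integrable P xi : dominated_tower P ->
  Rintegrable L (fun s => P m (tnorm s) * cos (phase xi s)) /\
  Rintegrable L (fun s => P m (tnorm s) * sin (phase xi s)).
Proof.
move=> [tP [C HC]]; split.
  exact: (radial_Rintegrable xi (tower_continuous tP) (@continuous_cos R)
    (fun r _ => HC r) (@norm_cos_le1 R)).1.
exact: (radial_Rintegrable xi (tower_continuous tP) (@continuous_sin R)
  (fun r _ => HC r) (@norm_sin_le1 R)).1.
Qed.

Lemma hankel_lin P Q c xi : dominated_tower P -> dominated_tower Q ->
  hankel_defect (fun i r => P i r + c * Q i r) xi =
    hankel_defect P xi + c * hankel_defect Q xi /\
  space_sin (fun r => P m r + c * Q m r) xi =
    space_sin (P m) xi + c * space_sin (Q m) xi.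
Proof.
move=> dP dQ; have [pc ps] := top_integrable xi dP; have [qc qs] := top_integrable xi dQ.
have lP := sine_kernel_Lint (2 * pi * enorm xi) (tower_continuous (i := 0%N) dP.1) (dP.1.2 0%N).
have lQ := sine_kernel_Lint (2 * pi * enorm xi) (tower_continuous (i := 0%N) dQ.1) (dQ.1.2 0%N).
have E1 : space_cos (fun r => P m r + c * Q m r) xi =
    space_cos (P m) xi + c * space_cos (Q m) xi.
  rewrite /space_cos -RintegralZl// -RintegralD//; last exact: RintegrableZ.
  by apply: eq_Rintegral => s _; rewrite mulrDl mulrA.
have E2 : line_sine (fun r => P 0%N r + c * Q 0%N r) xi =
    line_sine (P 0%N) xi + c * line_sine (Q 0%N) xi.
  rewrite /line_sine -RintegralZl// -RintegralD//; last exact: RintegrableZ.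
  by apply: eq_Rintegral => x _; rewrite mulrDl mulrA.
split; first by rewrite /hankel_defect E1 E2; ring.
rewrite /space_sin -RintegralZl// -RintegralD//; last exact: RintegrableZ.
by apply: eq_Rintegral => s _; rewrite mulrDl mulrA.
Qed.

Lemma gauss_dominated_tower t c : 1 <= t ->
  dominated_tower (fun i r => c * (- (2 * t)) ^+ i * gauss t r).
Proof.
move=> t1; have t0 : 0 < t by lra.
split; first exact: gauss_tower.
exists `|c * (- (2 * t)) ^+ m| => r; rewrite normrM ler_wpM2l//.
rewrite ger0_norm ?gauss_ge0// ler_expR lerN2 ler_wpM2r// sqr_ge0//.
Qed.

(** Both sides are explicit, and the powers of [pi / t] agree because
    [k = 2 m + 3]. *)
Lemma gauss_hankel t c xi : 1 <= t ->
  hankel_defect (fun i r => c * (- (2 * t)) ^+ i * gauss t r) xi = 0 /\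
  space_sin (fun r => c * (- (2 * t)) ^+ m * gauss t r) xi = 0.
Proof.
move=> t1; have t0 : 0 < t by lra.
have [ig Ec Es] := gauss_radial_integral xi t0.
have [ic is_] := top_integrable xi (gauss_dominated_tower 1 t1).
have cgt : exists C : R, forall r, 0 <= r -> `|gauss t r| <= C * gauss 1 r.
  exists 1 => r _; rewrite mul1r ger0_norm ?gauss_ge0//.
  by rewrite ler_expR lerN2 ler_wpM2r// sqr_ge0.
have [C HC] := cgt.
have jc : Rintegrable L (fun s => gauss t (tnorm s) * cos (phase xi s)) :=
  (radial_Rintegrable xi (@gauss_continuous R t) (@continuous_cos R) HC (@norm_cos_le1 R)).1.
have js : Rintegrable L (fun s => gauss t (tnorm s) * sin (phase xi s)) :=
  (radial_Rintegrable xi (@gauss_continuous R t) (@continuous_sin R) HC (@norm_sin_le1 R)).1.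
split; last first.
  rewrite /space_sin; under eq_Rintegral do rewrite -mulrA.
  by rewrite RintegralZl// Es mulr0.
have E1 : space_cos (fun r => c * (- (2 * t)) ^+ m * gauss t r) xi =
   c * (- (2 * t)) ^+ m * (Num.sqrt (pi / t) ^+ k * expR (- (pi ^+ 2 / t * enorm xi ^+ 2))).
  rewrite /space_cos; under eq_Rintegral do rewrite -mulrA.
  by rewrite RintegralZl// Ec.
have E2 : line_sine (fun r => c * (- (2 * t)) ^+ 0 * gauss t r) xi =
   c * ((2 * t)^-1 * (Num.sqrt (pi / t) * expR (- (pi ^+ 2 / t * enorm xi ^+ 2)))).
  rewrite /line_sine; under eq_Rintegral do rewrite expr0 mulr1 -mulrA.
  rewrite RintegralZl//.
    rewrite gauss_sine_kernel//; congr (_ * (_ * (_ * expR (- _)))).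
    by field; rewrite gt_eqF.
  apply: sine_kernel_Lint; [exact: gauss_continuous|exact: gauss_gauss_bounded].
rewrite /hankel_defect E1 E2.
have pt : 0 <= pi / t by rewrite divr_ge0// ?pi_ge0// ltW.
have -> : Num.sqrt (pi / t) ^+ k = (pi / t) ^+ m * (pi / t) * Num.sqrt (pi / t).
  rewrite kE -addn3 exprD -mul2n exprM sqr_sqrtr// exprSr sqr_sqrtr//.
  by rewrite mulrA.
have -> : (- (1 / (2 * pi))) ^+ m * (c * (- (2 * t)) ^+ m *
   ((pi / t) ^+ m * (pi / t) * Num.sqrt (pi / t) * expR (- (pi ^+ 2 / t * enorm xi ^+ 2)))) =
   c * ((- (1 / (2 * pi)) * - (2 * t) * (pi / t)) ^+ m) * (pi / t) *
   (Num.sqrt (pi / t) * expR (- (pi ^+ 2 / t * enorm xi ^+ 2))).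
  by rewrite !exprMn; ring.
have p0 : pi != 0 :> R by rewrite gt_eqF ?pi_gt0.
have t_neq0 : t != 0 by rewrite gt_eqF.
have cancel (q : R) : q != 0 -> - (1 / (2 * q)) * - (2 * t) * (q / t) = 1.
  by move=> q0; field; rewrite t_neq0 q0.
rewrite (cancel _ p0).
have fin (q z : R) : c * 1 ^+ m * (q / t) * z - 2 * q * (c * ((2 * t)^-1 * z)) = 0.
  by rewrite expr1n; field; rewrite t_neq0.
exact: fin.
Qed.

(** Gaussian towers are scaled so that the coefficient is prescribed at the top,
    at height [m], where the approximation takes place. *)
Lemma polynomial_tower n (a : nat -> R) : exists P, [/\ dominated_tower P,
    forall r, P m r = \sum_(j < n) a j * gauss j.+1%:R r &
    forall xi, hankel_defect P xi = 0 /\ space_sin (P m) xi = 0].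
Proof.
elim: n => [|n [P [dP Pm hP]]].
  exists (fun i r => 0 * (- (2 * 1)) ^+ i * gauss 1 r); split.
  - exact: gauss_dominated_tower.
  - by move=> r; rewrite big_ord0 !mul0r.
  - by move=> xi; exact: gauss_hankel.
pose t : R := n.+1%:R; have t1 : 1 <= t by rewrite ler1n.
pose b := a n / (- (2 * t)) ^+ m.
have db := gauss_dominated_tower b t1.
exists (fun i r => P i r + 1 * (b * (- (2 * t)) ^+ i * gauss t r)); split.
- exact: dominated_tower_lin.
- move=> r; rewrite big_ord_recr/= Pm mul1r; congr (_ + _ * _).
  by rewrite /b divfK// expf_neq0// oppr_eq0 mulf_neq0// gt_eqF//; lra.
- move=> xi; have [h1 h2] := hP xi; have [h3 h4] := gauss_hankel b xi t1.
  have [-> ->] := hankel_lin 1 xi dP db.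
  by rewrite h1 h2 h3 h4 mulr0 addr0.
Qed.

(** The error at the top of the tower bounds the one at the bottom, so both
    integrals are at most [e] times a Gaussian integral. *)
Lemma small_defect P e xi : 0 <= e -> dominated_tower P ->
  (forall r, `|P m r| <= e * gauss 1 r) ->
  let A := \int[L]_s (gauss 1 (tnorm s)) in
  let B := \int[leb]_x (x * (x * gauss 1 x)) in
  `|hankel_defect P xi| <= e * (`|(- (1 / (2 * pi))) ^+ m| * A + 2 * pi * B) /\
  `|space_sin (P m) xi| <= e * A.
Proof.
move=> e0 dP Pm A B; have [tP _] := dP.
have P0 := tower_small tP e0 Pm.
have cP := tower_continuous (i := m) tP.
split; last first.
  exact: (radial_Rintegrable xi cP (@continuous_sin R) (fun r _ => Pm r) (@norm_sin_le1 R)).2.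
have h1 : `|space_cos (P m) xi| <= e * A.
  exact: (radial_Rintegrable xi cP (@continuous_cos R) (fun r _ => Pm r) (@norm_cos_le1 R)).2.
have cB : continuous (fun x : R => x * (x * gauss 1 x)).
  exact/mulid_continuous/mulid_continuous/gauss_continuous.
have gB : gauss_bounded (fun x : R => x * (x * gauss 1 x)).
  exact/gauss_boundedM/gauss_boundedM/gauss_gauss_bounded.
have iB := gauss_bounded_integrable cB gB.
have h2 : `|line_sine (P 0%N) xi| <= e * B.
  rewrite -RintegralZl//; apply: Rintegral_norm_le.
  - apply: continuous_measurable_fun => x.
    apply: cvgM; first exact: (tower_continuous (i := 0%N) tP).
    exact: sine_kernel_continuous.
  - move=> x; rewrite normrM mulrC.
    rewrite [leRHS](_ : _ = x * x * (e * gauss 1 x)); last by ring.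
    by rewrite ler_pM// sine_kernel_le.
  - exact: RintegrableZ.
rewrite /hankel_defect (le_trans (ler_normB _ _))// [leRHS]mulrDr. apply: lerD.
  by rewrite normrM mulrCA ler_wpM2l.
have pi2 : 0 <= 2 * pi :> R by rewrite mulr_ge0// pi_ge0.
by rewrite normrM (ger0_norm pi2) mulrCA ler_wpM2l.
Qed.

Lemma le_arbitrary (z K : R) : (forall e, 0 < e -> `|z| <= e * K) -> z = 0.
Proof.
move=> H; apply/eqP; rewrite -normr_le0; apply/ler_addgt0Pr => e e0; rewrite add0r.
have K1 : 0 < `|K| + 1 by rewrite ltr_wpDl.
apply: le_trans (H (e / (`|K| + 1)) _) _; first by rewrite divr_gt0.
rewrite mulrAC ler_pdivrMr// ler_pM2l//.
by rewrite (le_trans (ler_norm _))// lerDl.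
Qed.

(** Subtracting a combination of Gaussians changes neither the defect nor the
    sine integral, and makes the top of the tower at most [e exp (- r^2)]. *)
Lemma hankel_identity u M xi : 0 <= M -> smooth1 u -> vanishes_beyond M u ->
  (- (1 / (2 * pi))) ^+ m * space_cos (rtower m u) xi =
    2 * pi * line_sine (odd_quot u) xi /\
  space_sin (rtower m u) xi = 0.
Proof.
move=> M0 su vu; pose U i := rtower i u.
have dU : dominated_tower U.
  split; first exact: rtower_tower su vu.
  have [s _] := rtower_even m su.
  exact: vanishes_gauss_bounded (smooth1_continuous (n := 0%N) s) (vanishes_rtower m M0 su vu).
have approx e : 0 < e -> exists D, [/\ dominated_tower D,
    forall r, `|D m r| <= e * gauss 1 r, hankel_defect U xi = hankel_defect D xi &
    space_sin (U m) xi = space_sin (D m) xi].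
  move=> e0; have [p Hp] := gaussian_approximation m M0 su vu e0.
  have [P [dP Pm hP]] := polynomial_tower (size p) (fun i => p`_i).
  exists (fun i r => U i r + (-1) * P i r); split.
  - exact: dominated_tower_lin.
  - move=> r; rewrite mulN1r Pm.
    rewrite (_ : \sum_(j < size p) _ = gauss 1 r * p.[gauss 1 r]); first exact: Hp.
    rewrite horner_coef mulr_sumr; apply: eq_bigr => j _.
    rewrite mulrCA -exprS; congr (_ * _); rewrite /gauss -expRM_natl; congr expR.
    by ring.
  - by have [-> _] := hankel_lin (-1) xi dU dP; rewrite (hP xi).1 mulr0 addr0.
  - by have [_ ->] := hankel_lin (-1) xi dU dP; rewrite (hP xi).2 mulr0 addr0.
split.
  apply/eqP; rewrite -subr_eq0; apply/eqP.
  apply: le_arbitrary => e e0; have [D [dD Dm E1 _]] := approx e e0.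
  rewrite -[X in `|X|]/(hankel_defect U xi) E1.
  exact: (small_defect xi (ltW e0) dD Dm).1.
apply: le_arbitrary => e e0; have [D [dD Dm _ E2]] := approx e e0.
rewrite -[X in `|X|]/(space_sin (U m) xi) E2.
exact: (small_defect xi (ltW e0) dD Dm).2.
Qed.

End HankelIdentity.

(** * Fourier transforms of radial lifts *)

Lemma test_function_scale (R : realType) (V : normedModType R) (c : R[i]) (F : V -> R[i]) :
  test_function F -> test_function (fun x => c * F x).
Proof.
move=> [sF cF].
have lin (p q : V -> R) a b :
    (forall s x, differentiable (iter_derive s p) x) ->
    (forall s x, differentiable (iter_derive s q) x) ->
    forall s x, differentiable (iter_derive s (fun y => a * p y + b * q y)) x.
  move=> dp dq s; suff -> : iter_derive s (fun y => a * p y + b * q y) =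
      (fun x => a *: iter_derive s p x + b *: iter_derive s q x).
    by move=> x; apply: differentiableD; exact: differentiableZ.
  elim: s => // v s IH; apply/funext => x.
  rewrite -[LHS]/('D_v (iter_derive s _) x) IH.
  have dp' : derivable (iter_derive s p) x v by exact: diff_derivable.
  have dq' : derivable (iter_derive s q) x v by exact: diff_derivable.
  rewrite (@deriveD _ _ _ (fun x => a *: iter_derive s p x)
    (fun x => b *: iter_derive s q x)); [|exact: derivableZ|exact: derivableZ].
  by rewrite (deriveZ a dp') (deriveZ b dq').
have dR s x : differentiable (iter_derive s (ReF F)) x by case: (sF s x).
have dI s x : differentiable (iter_derive s (ImF F)) x by case: (sF s x).
split; last first.
  apply: (subclosed_compact _ cF); first exact: closed_closure.
  apply: closure_subset => x /=; apply: contraNneq => ->.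
  by rewrite mulr0.
case: c => a b s x; split.
  rewrite (_ : (fun y => _) = (fun y => a * complex.Re (F y) + (- b) * complex.Im (F y))).
    exact: lin.
  by apply/funext => y; rewrite ReE mulNr.
rewrite (_ : (fun y => _) = (fun y => a * complex.Im (F y) + b * complex.Re (F y))).
  exact: lin.
by apply/funext => y; rewrite ReE.
Qed.

Section FourierTransforms.
Context {R : realType}.
Implicit Types (f : R -> R[i]) (u v h : R -> R) (w r M : R).
Local Notation leb := (@lebesgue_measure R).
Local Notation Lint := (Rintegrable leb).

Lemma Rintegral_opp h M : continuous h -> vanishes_beyond M h ->
  \int[leb]_x h (- x) = \int[leb]_x h x.
Proof.
move=> ch vh; pose N : R := `|M| + 1.
have vN (x : R) : x \notin `[- N, N] -> h x = 0.
  rewrite in_itv/= -ler_norml -ltNge => Nx; apply: vh.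
  rewrite (le_lt_trans _ Nx)//.
  by rewrite (le_trans (ler_norm M))// /N lerDl.
have E (g : R -> R) : (forall x : R, x \notin `[- N, N] -> g x = 0) ->
    (\int[leb]_x (g x)%:E = \int[leb]_(x in `[(- N)%R, N]) (g x)%:E)%E.
  move=> gN; rewrite [RHS]integral_mkcond; apply: eq_integral => x _.
  rewrite patchE; case: ifPn => // /negP H; rewrite gN//.
  by apply/negP => xN; apply: H; exact: mem_set.
have N0 : - N <= N by rewrite (@le_trans _ _ 0)// ?oppr_le0 addr_ge0.
have S := @integration_by_substitution_oppr R h (- N) N N0.
rewrite /Rintegral E; last first.
  by move=> x; rewrite in_itv/= -ler_norml => xN; apply: vN; rewrite in_itv/= -ler_norml normrN.
rewrite [in RHS]E//; congr fine; rewrite -S ?opprK//.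
exact: continuous_subspaceT.
Qed.

Let smooth_gb u M : 0 <= M -> smooth1 u -> vanishes_beyond M u ->
  continuous u /\ gauss_bounded u.
Proof.
move=> M0 su vu; have cu : continuous u := smooth1_continuous (n := 0%N) su.
split=> //; have [C HC] := vanishes_gauss_bounded cu vu; exists C, 1; split=> //.
have := le_trans (normr_ge0 _) (HC 0).
by rewrite pmulr_lge0// gauss_gt0.
Qed.

Definition line_cos u w : R := \int[leb]_x (u x * cos (w * x)).
Definition line_sin u w : R := \int[leb]_x (u x * sin (w * x)).

Lemma fourierR_parts f M r : 0 <= M -> smooth f ->
  vanishes_beyond M (ReF f) -> vanishes_beyond M (ImF f) ->
  complex.Re (fourierR f r) =
    line_cos (ReF f) (2 * pi * r) + line_sin (ImF f) (2 * pi * r) /\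
  complex.Im (fourierR f r) =
    line_cos (ImF f) (2 * pi * r) - line_sin (ReF f) (2 * pi * r).
Proof.
move=> M0 /smooth_line[su sv] vu vv.
have [cu gu] := smooth_gb M0 su vu; have [cv gv] := smooth_gb M0 sv vv.
split; rewrite integralCE /line_cos /line_sin.
  rewrite -RintegralD//; [|exact: Lint_cos|exact: Lint_sin].
  by apply: eq_Rintegral => x _; rewrite ReE /= cosN sinN mulrA mulrN opprK.
rewrite -RintegralB//; [|exact: Lint_cos|exact: Lint_sin].
apply: eq_Rintegral => x _; rewrite ReE /= cosN sinN mulrA mulrN addrC.
by [].
Qed.

(** As [x * odd_quot u x] is the odd part of [u], the integral against the kernel
    is twice a sine integral of [u]; at the zero frequency it is a moment. *)
Lemma line_sine_odd_quot (k : nat) u M (xi : 'rV[R]_k) :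
  0 <= M -> smooth1 u -> vanishes_beyond M u ->
  2 * pi * line_sine (odd_quot u) xi =
  if enorm xi == 0 then 2 * (2 * pi * \int[leb]_x (x * u x))
  else 2 * line_sin u (2 * pi * enorm xi) / enorm xi.
Proof.
move=> M0 su vu; have [cu gu] := smooth_gb M0 su vu.
have two (tr : R -> R) : continuous tr -> (forall x, tr (- x) = - tr x) ->
    \int[leb]_x (odd_part u x * tr x) = 2 * \int[leb]_x (u x * tr x).
  move=> ct ot.
  have ch : continuous (fun x => u x * tr x).
    by move=> x; apply: cvgM; [exact: cu|exact: ct].
  have ch' : continuous (fun x => u (- x) * tr (- x)).
    by move=> x; apply: (continuous_comp (f := -%R) (g := fun x => u x * tr x));
      [exact: opp_continuous|exact: ch].
  have vh : vanishes_beyond M (fun x => u x * tr x).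
    by move=> x /vu ->; rewrite mul0r.
  have vh' : vanishes_beyond M (fun x => u (- x) * tr (- x)).
    by move=> x Mx; rewrite vu ?mul0r// normrN.
  have gi g : continuous g -> vanishes_beyond M g -> Lint g.
    move=> cg vg; apply: gauss_bounded_integrable => //.
    have [C HC] := vanishes_gauss_bounded cg vg; exists C, 1; split=> //.
    have := le_trans (normr_ge0 _) (HC 0).
    by rewrite pmulr_lge0// gauss_gt0.
  rewrite [RHS]mulr_natl mulr2n -{2}(Rintegral_opp ch vh).
  rewrite -RintegralD//; [|exact: gi|exact: gi].
  by apply: eq_Rintegral => x _; rewrite /odd_part ot; ring.
have pi0 : pi != 0 :> R by rewrite gt_eqF// pi_gt0.
have pi2 : 2 * pi != 0 :> R by rewrite mulf_neq0.
rewrite /line_sine; have [x0|x0] := eqVneq (enorm xi) 0.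
  rewrite x0 mulr0 (mulrCA 2); congr (_ * _).
  transitivity (\int[leb]_x (odd_part u x * x)).
    by apply: eq_Rintegral => x _; rewrite /sine_kernel eqxx mulrA (mulrC (odd_quot u x)) odd_quotE.
  rewrite two//; last by move=> x; exact: cvg_id.
  by congr (_ * _); apply: eq_Rintegral => x _; rewrite mulrC.
set w := 2 * pi * enorm xi; have w0 : w != 0 by rewrite mulf_neq0.
have -> : \int[leb]_x (odd_quot u x * sine_kernel w x) =
    w^-1 * \int[leb]_x (odd_part u x * sin (w * x)).
  have [so _] := odd_quot_even su.
  have [_ sp] := smooth1_odd_part su.
  have vp : vanishes_beyond M (odd_part u).
    by move=> x Mx; rewrite /odd_part !vu ?normrN// subr0.
  have [cp gp] := smooth_gb M0 sp vp.
  rewrite -RintegralZl//; last exact: Lint_sin.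
  apply: eq_Rintegral => x _; rewrite /sine_kernel (negbTE w0) -odd_quotE//; ring.
rewrite two; last 2 first.
- exact: sin_scale_continuous.
- by move=> x; rewrite mulrN sinN.
rewrite -/(line_sin u w); move: (line_sin u w) => z.
by rewrite /w; move: (pi : R) pi0 => q q0; field; rewrite x0 q0.
Qed.

(** Cosine integrals are even in the frequency and cancel from the odd part of
    the Fourier transform. *)
Lemma sym_quot_fourierR (k : nat) f M (xi : 'rV[R]_k) : 0 <= M -> smooth f ->
  vanishes_beyond M (ReF f) -> vanishes_beyond M (ImF f) ->
  sym_quot (ReF (fourierR f)) (enorm xi) = 2 * pi * line_sine (odd_quot (ImF f)) xi /\
  sym_quot (ImF (fourierR f)) (enorm xi) = - (2 * pi * line_sine (odd_quot (ReF f)) xi).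
Proof.
move=> M0 sf vu vv; have [su sv] := (smooth_line f).1 sf.
have [cu gu] := smooth_gb M0 su vu; have [cv gv] := smooth_gb M0 sv vv.
have FP r := fourierR_parts r M0 sf vu vv.
have cosN' u w : line_cos u (- w) = line_cos u w.
  by apply: eq_Rintegral => x _; rewrite mulNr cosN.
have sinN' u w : continuous u -> gauss_bounded u -> line_sin u (- w) = - line_sin u w.
  move=> c g; rewrite -[RHS]mulN1r /line_sin -RintegralZl//; last exact: Lint_sin.
  by apply: eq_Rintegral => x _; rewrite mulNr sinN; ring.
have EI := line_sine_odd_quot xi M0 sv vv; have ER := line_sine_odd_quot xi M0 su vu.
suff [G1 G2] : sym_quot (ReF (fourierR f)) (enorm xi) =
    (if enorm xi == 0 then 2 * (2 * pi * \int[leb]_x (x * (ImF f) x))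
     else 2 * line_sin (ImF f) (2 * pi * enorm xi) / enorm xi) /\
    sym_quot (ImF (fourierR f)) (enorm xi) =
    - (if enorm xi == 0 then 2 * (2 * pi * \int[leb]_x (x * (ReF f) x))
     else 2 * line_sin (ReF f) (2 * pi * enorm xi) / enorm xi).
  split; first exact: etrans G1 (esym EI).
  by apply: (etrans G2); congr (- _); exact: esym ER.
clear EI ER; rewrite /sym_quot; case: ifPn => x0.
  have D u v c : continuous u -> gauss_bounded u -> continuous v -> gauss_bounded v ->
      (fun r => line_cos u (2 * pi * r) + c * line_sin v (2 * pi * r))^`() 0 =
      c * (2 * pi * \int[leb]_x (x * v x)).
    move=> cu' gu' cv' gv'; apply: is_derive_derive1.
    have l0 : is_derive (0 : R) 1 (fun r => 2 * pi * r) (2 * pi).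
      by apply: is_derive_eq; rewrite /GRing.scale/= mulr1.
    have d1 : is_derive (2 * pi * (0 : R)) 1 (line_cos u) 0.
      have := cos_integral_derive (2 * pi * 0) cu' gu'.
      rewrite mulr0; under eq_Rintegral do rewrite mul0r sin0 mulr0.
      by rewrite Rintegral_cst//= mul0r oppr0.
    have d2 : is_derive (2 * pi * (0 : R)) 1 (line_sin v) (\int[leb]_x (x * v x)).
      have := sin_integral_derive (2 * pi * 0) cv' gv'.
      by rewrite mulr0; under eq_Rintegral do rewrite mul0r cos0 mulr1.
    have e1 : is_derive (0 : R) 1 (fun r => line_cos u (2 * pi * r)) (0 * (2 * pi)).
      exact: (@is_derive1_comp _ (line_cos u) (fun r => 2 * pi * r)).
    have e2 : is_derive (0 : R) 1 (fun r => line_sin v (2 * pi * r))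
        ((\int[leb]_x (x * v x)) * (2 * pi)).
      exact: (@is_derive1_comp _ (line_sin v) (fun r => 2 * pi * r)).
    by apply: is_derive_eq; rewrite /GRing.scale/=; ring.
  have -> : ReF (fourierR f) = (fun r => line_cos (ReF f) (2 * pi * r) +
      1 * line_sin (ImF f) (2 * pi * r)).
    by apply/funext => r; rewrite (FP r).1 mul1r.
  have -> : ImF (fourierR f) = (fun r => line_cos (ImF f) (2 * pi * r) +
      (-1) * line_sin (ReF f) (2 * pi * r)).
    by apply/funext => r; rewrite (FP r).2 mulN1r.
  by rewrite !D// mul1r mulN1r mulrN.
rewrite !(FP _).1 !(FP _).2 mulrN !cosN' !sinN'//; split.
  by rewrite opprD opprK; congr (_ / _); ring.
by rewrite -mulNr; congr (_ / _); ring.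
Qed.

Let lin_integral {d} {T : measurableType d} {mu : {measure set T -> \bar R}}
    (g h : T -> R) (c e : R) : Rintegrable mu g -> Rintegrable mu h ->
  \int[mu]_s h s = 0 ->
  \int[mu]_s (c * g s + e * h s) = c * \int[mu]_s g s.
Proof.
move=> ig ih h0; rewrite RintegralD//; [|exact: RintegrableZ|exact: RintegrableZ].
by rewrite !RintegralZl// h0 mulr0 addr0.
Qed.

(** By [hankel_identity] the transform of the lift on the left is a sine integral
    of the profile, and by [sym_quot_fourierR] so is the right-hand side. *)
Lemma fourierRk_radial_lift (k m : nat) (kE : k = m.*2.+3) f : test_function f ->
  fourierRk (fun x : 'rV[R]_k =>
    - 'i%C * ((- (1 / (2 * pi))) ^+ m)%:C * radial_lift m f x) =
  sym_lift (fourierR f).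
Proof.
move=> tf; have [M [M0 [vu vv]]] := test_vanishes tf.
have [su sv] := (smooth_line f).1 tf.1.
apply/funext => xi; have [SR SI] := sym_quot_fourierR xi M0 tf.1 vu vv.
have [Hu Hu'] := hankel_identity kE xi M0 su vu.
have [Hv Hv'] := hankel_identity kE xi M0 sv vv.
set c := (- (1 / (2 * pi))) ^+ m in Hu Hv *.
suff [G1 G2] : complex.Re (fourierRk (fun x : 'rV[R]_k =>
      - 'i%C * c%:C * radial_lift m f x) xi) = c * space_cos (rtower m (ImF f)) xi /\
    complex.Im (fourierRk (fun x : 'rV[R]_k =>
      - 'i%C * c%:C * radial_lift m f x) xi) = - (c * space_cos (rtower m (ReF f)) xi).
  apply: eqC; first exact: etrans (etrans G1 Hv) (esym SR).
  by apply: (etrans G2); apply: etrans (esym SI); congr (- _); exact: Hu.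
clear SR SI Hu Hv.
have int u (trig : R -> R) : smooth1 u -> vanishes_beyond M u -> continuous trig ->
    (forall x, `|trig x| <= 1) ->
    Rintegrable (lebesgue_measureR R k) (fun s => rtower m u (tnorm s) * trig (phase xi s)).
  move=> su' vu' ct t1; have [s _] := rtower_even m su'.
  have cs : continuous (rtower m u) := smooth1_continuous (n := 0%N) s.
  have [C HC] := vanishes_gauss_bounded cs (vanishes_rtower m M0 su' vu').
  exact: (radial_Rintegrable xi cs ct (fun r _ => HC r) t1).1.
have iuc := int _ _ su vu (@continuous_cos R) (@norm_cos_le1 R).
have ius := int _ _ su vu (@continuous_sin R) (@norm_sin_le1 R).
have ivc := int _ _ sv vv (@continuous_cos R) (@norm_cos_le1 R).
have ivs := int _ _ sv vv (@continuous_sin R) (@norm_sin_le1 R).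
have prodE (d p q a b : R) : - 'i%C * d%:C * (p +i* q) * (a +i* - b) =
    (d * (q * a) + (- d) * (p * b)) +i* ((- d) * (q * b) + (- d) * (p * a)) :> R[i].
  by apply: eqC; rewrite !ReE /=; ring.
split; rewrite integralCE.
  transitivity (\int[lebesgue_measureR R k]_s
    (c * (rtower m (ImF f) (tnorm s) * cos (phase xi s)) +
     (- c) * (rtower m (ReF f) (tnorm s) * sin (phase xi s)))).
    by apply: eq_Rintegral => s _; rewrite /expi cosN sinN /radial_lift prodE.
  exact: (lin_integral _ _ ivc ius Hu').
transitivity (\int[lebesgue_measureR R k]_s
    ((- c) * (rtower m (ImF f) (tnorm s) * sin (phase xi s)) +
     (- c) * (rtower m (ReF f) (tnorm s) * cos (phase xi s)))).
  by apply: eq_Rintegral => s _; rewrite /expi cosN sinN /radial_lift prodE.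
have -> : \int[lebesgue_measureR R k]_s
    ((- c) * (rtower m (ImF f) (tnorm s) * sin (phase xi s)) +
     (- c) * (rtower m (ReF f) (tnorm s) * cos (phase xi s))) =
    \int[lebesgue_measureR R k]_s
    ((- c) * (rtower m (ReF f) (tnorm s) * cos (phase xi s)) +
     (- c) * (rtower m (ImF f) (tnorm s) * sin (phase xi s))).
  by apply: eq_Rintegral => s _; rewrite addrC.
by apply: (etrans (lin_integral _ _ iuc ivs Hv')); rewrite mulNr.
Qed.

End FourierTransforms.

Theorem theorem5p1 (R : realType) (k : nat) (k_ge3 : (3 <= k)%N)
  (k_odd : odd k) (Lambda S : set 'rV[R]_k) (a b : 'rV[R]_k -> R[i])
  (Lambda_lf : locally_finite Lambda)
  (Lambda_supp : Lambda = [set x | a x != 0])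
  (S_lf : locally_finite S)
  (S_supp : forall s, ~ S s -> b s = 0)
  (mu_temperate : temperate (dirac_sum Lambda a))
  (mu_fourier :
     fourier_transform_is fourierRk (dirac_sum Lambda a) (dirac_sum S b)) :
  let sigma := fun phi : R -> R[i] =>
    - 2 * a 0 * delta 1 0 phi +
    \sum_(l \in Lambda `\ 0)
      a l / (enorm l)%:C * (delta 0 (enorm l) phi - delta 0 (- enorm l) phi) in
  let sigma_hat := fun phi : R -> R[i] =>
    2 * 'i%C * b 0 * (alphak k)%:C * delta (k - 2) 0 phi -
    'i%C * \sum_(s \in S `\ 0)
      b s / (enorm s ^+ (k - 2))%:C *
      \sum_(0 <= j < ((k - 3) %/ 2).+1)
        (betajk j k * enorm s ^+ j)%:C *
        ((-1) ^+ j * delta j (enorm s) phi - delta j (- enorm s) phi) in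
  temperate sigma /\ fourier_transform_is fourierR sigma sigma_hat.
Proof.
move=> sigma sigma_hat.
have [T [sT Tmu Tmuhat]] := mu_fourier.
have a0 x : ~ Lambda x -> a x = 0.
  by rewrite Lambda_supp /= => /negP; rewrite negbK => /eqP.
have sT' := schwartz_functional_lift sT.
have ext : extends (fun f => T (sym_lift f)) sigma.
  move=> f tf; rewrite Tmu; first exact: dirac_sum_lift.
  by rewrite sym_liftE; [exact: radial_lift_test|exact: tf.1].
split; first exact: temperate_restriction sT' ext.
exists (fun f => T (sym_lift f)); split=> // f tf.
have kE : k = ((k - 3) %/ 2).*2.+3.
  by have := k_ge3; have := k_odd; rewrite -!addnn; lia.
rewrite -(fourierRk_radial_lift kE tf) Tmuhat; last first.
  by apply: test_function_scale; exact: radial_lift_test.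
rewrite /dirac_sum; under eq_fsbigr do rewrite mulrCA.
rewrite -mulr_fsumr -/(dirac_sum S b _).
exact: dirac_sum_hat.
Qed.
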